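(* Let $q\ge 2$ be an integer, and for $\beta,\lambda>0$ let $m(q,\beta,\lambda)$ be the magnetization of the long-range $q$-state Potts model on $\mathbb Z$. Then: (i) For every $\beta>1$, there exists $\lambda<\infty$ large enough so that $m(q,\beta,\lambda)>0$. (ii) For every $\beta,\lambda>0$, if $m(q,\beta,\lambda)>0$ then $\beta\,m(q,\beta,\lambda)^2\ge 1$.
   Context: For $i\ne j$ in $\mathbb Z$ let $J_{i,j}=1/|i-j|^2$. For $\beta,\lambda>0$ let $K_{i,j}=\beta J_{i,j}$ if $|i-j|\ge2$ and $K_{i,j}=\lambda$ if $|i-j|=1$. For a positive integer $L$ let $B_L=[-L,L)\cap\mathbb Z$. The long-range $q$-state Potts model on $B_L$ with monochromatic boundary condition $1$ is the probability measure $\mu^1_{L}$ on $\sigma\in\{1,\dots,q\}^{B_L}$, with the convention $\sigma_j=1$ for all $j\in\mathbb Z\setminus B_L$, given by $$\mu^1_L[\sigma]=\frac1Z\exp\Big[\sum_{\{i,j\}:\ \{i,j\}\cap B_L\ne\emptyset}K_{i,j}\,\mathbf 1_{\{\sigma_i=\sigma_j\}}\Big],$$ where the sum is over unordered pairs of distinct elements of $\mathbb Z$ with at least one element in $B_L$, and $Z$ is the normalizing constant. The case $q=2$ is the Ising model. The magnetization is $$m(q,\beta,\lambda)=\lim_{L\to\infty}\frac{q\,\mu^1_L[\sigma_0=1]-1}{q-1}$$ (the limit exists by standard monotonicity). With this normalization, the standard Edwards–Sokal coupling with Fortuin–Kasteleyn percolation with edge parameters $p_{i,j}=1-e^{-K_{i,j}}$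 and cluster weight $q$ identifies $m(q,\beta,\lambda)$ with the probability that $0$ is connected to infinity under the wired infinite-volume measure. *)

(* Defs.v *)
From HB Require Import structures.
From mathcomp Require Import all_boot all_order all_algebra.
From mathcomp Require Import all_classical all_reals all_analysis.

Set Implicit Arguments.
Unset Strict Implicit.
Unset Printing Implicit Defensive.

Import Order.TTheory GRing.Theory Num.Theory.
Import numFieldNormedType.Exports.

Local Open Scope classical_set_scope.
Local Open Scope ring_scope.

(* The value at i = j is irrelevant: only pairs with i < j are summed over. *)
Definition J (R : realType) (i j : int) : R := 1 / `|i - j|%:~R ^+ 2.

Definition K (R : realType) (beta lambda : R) (i j : int) : R :=
  if `|i - j| == 1 then lambda else beta * J R i j.

Definition in_box (L : nat) (i : int) : bool := - L%:Z <= i < L%:Z.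

(* The box [-L, L) is indexed by 'I_(2L): the index x stands for x - L. *)
Definition site (L : nat) (x : 'I_(L.*2)) : int := x%:Z - L%:Z.

Definition config (q L : nat) := {ffun 'I_(L.*2) -> 'I_q}.

(* The spin at j of the extension of s to all of int by 1 outside the box.
   Spins take values in {1, ..., q}, hence the shift by one from 'I_q. *)
Definition spin (q L : nat) (s : config q L) (j : int) : nat :=
  if [pick x : 'I_(L.*2) | site x == j] is Some x then (s x).+1 else 1%N.

(* An unordered pair of distinct integers is represented by the ordered pair
   with increasing coordinates. *)
Definition bonds (L : nat) : set (int * int) :=
  [set e | (e.1 < e.2) && (in_box L e.1 || in_box L e.2)].

(* The summands are nonnegative for beta, lambda > 0, so that esum is their
   (unconditional) sum; it is finite because J decays like 1/|i - j|^2. *)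
Definition interaction (R : realType) (q L : nat) (beta lambda : R)
    (s : config q L) : R :=
  fine (\esum_(e in bonds L)
    (K beta lambda e.1 e.2 * (spin s e.1 == spin s e.2)%:R)%:E).

Definition weight (R : realType) (q L : nat) (beta lambda : R)
    (s : config q L) : R := expR (interaction beta lambda s).

Definition partition_function (R : realType) (q L : nat) (beta lambda : R) : R :=
  \sum_(s : config q L) weight beta lambda s.

Definition potts (R : realType) (q L : nat) (beta lambda : R)
    (s : config q L) : R :=
  weight beta lambda s / partition_function q L beta lambda.

Definition potts_prob (R : realType) (q L : nat) (beta lambda : R)
    (E : pred (config q L)) : R :=
  \sum_(s : config q L | E s) potts beta lambda s.

Definition finite_magnetization (R : realType) (q : nat) (beta lambda : R)
    (L : nat) : R :=
  (q%:R * potts_prob beta lambda (fun s : config q L => spin s 0 == 1%N) - 1)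
    / (q%:R - 1).

(* If the sequence did not converge, limn would be the default value 0 of R, so
   a positive magnetization is always a genuine limit. *)
Definition magnetization (R : realType) (q : nat) (beta lambda : R) : R :=
  limn (finite_magnetization q beta lambda).

(* Main.v *)
Require Import Defs.
From mathcomp Require Import all_boot all_order all_algebra.
From mathcomp Require Import all_classical all_reals all_analysis.
From mathcomp Require Import ring lra zify.

(* The colourings of the vertices by Z/q that are constant along the edges of a
   given set form a subgroup, so the product formula for subgroups and the four
   functions theorem make Griffiths-type inequalities available for Potts models:
   the probability that spins agree increases with the couplings and when
   vertices are contracted. Contracting the complement of an interval compares
   all volumes with one another.

   (ii) In an interval with boundary colour 1, exchange the colours 1 and d to the
   right of a wall placed at one of n = 2^D positions. This produces the boundary
   condition 1/d, whose partition function is at most that of 1/1. A wall costs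
   about beta m^2 ln n on average, as distant spins decorrelate, so by Jensen's
   inequality the n walls would have total weight n^(1 - beta m^2) -> oo if
   beta m^2 < 1, provided that a configuration does not come from too many walls:
   the wall is recovered from the majority colours in the two halves of dyadic
   intervals, up to few mistakes.

   (i) Renormalize the random-cluster model. Call a block good if it has a cluster
   of density theta > 3/4, so that clusters of overlapping good blocks meet. A
   larger block is bad only if it contains two distant bad blocks, or if it
   contains one and the clusters on both sides of it are not joined. The coupling
   between these is at least beta theta^2 ln S with S their size in blocks, and
   for beta theta^2 > 1 the factor S^(- beta theta^2) beats the number of blocks.
   Large clusters bound the free two-point function from below on average, and
   the latter is at most the magnetization in a finite box. *)

Set Implicit Arguments.
Unset Strict Implicit.
Unset Printing Implicit Defensive.

Import Order.TTheory GRing.Theory Num.Theory.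
Import numFieldNormedType.Exports.

Local Open Scope ring_scope.

(** * Correlation inequalities by counting colourings *)

(** The number of colourings compatible with an edge set is the cluster factor of the random-cluster
    weight, so an inequality between orders of subgroups carries the monotonicity usually drawn from
    percolation. In (ii), the contrast 1{x = 1} - 1{x = d} changes sign when 1 and d are exchanged,
    and its average over d has the magnetization as expectation; hence every estimate is averaged
    over d. Comparison yields only lower bounds on means and upper bounds on correlations, which is
    enough both for the cost of a wall and for the variances behind the majority votes. The wall
    stays n sites away from the ends of an interval of 3n sites, so that boundary effects remain
    bounded. In (i), blocks are not independent. The failure of a block is therefore bounded
    uniformly over all events determined by edges outside it, and such bounds multiply for disjoint
    blocks. Two bad blocks give p^2, which absorbs the number of pairs. A single bad block gives
    only p, and there the number of positions has to be compensated by the cost of a cut, which is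
    where beta theta^2 > 1 enters. *)

Lemma eq_subCA (V : zmodType) (a b c d : V) : a - b = c - d -> a - c = b - d.
Proof.
move/eqP; rewrite subr_eq => /eqP ->.
by rewrite addrAC [c - d]addrC addrK addrC.
Qed.

Section SubgroupCounting.
Variables (X : finType) (Q : nat).
Local Notation G := {ffun X -> 'I_Q.+1}.

(** The map (s, t) -> s - t sends [A] x [B] to [H]. A fibre embeds in the intersection by
    subtracting one of its elements (s0, t0), as s - t = s0 - t0 gives s - s0 = t - t0. For
    subgroups this is the product formula. *)
Lemma leq_card_mul_subgroups (A B H : {set G}) :
  (forall s t, s \in A -> t \in A -> s - t \in A) ->
  (forall s t, s \in B -> t \in B -> s - t \in B) ->
  (forall s t, s \in A -> t \in B -> s - t \in H) ->
  (#|A| * #|B| <= #|(A :&: B)%SET| * #|H|)%N.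
Proof.
move=> cA cB cH; rewrite -cardsX -sum1_card.
rewrite (partition_big (fun p : G * G => p.1 - p.2) (mem H)) /=; last first.
  by move=> [s t]; rewrite !inE /= => /andP[/cH]; apply.
rewrite mulnC -sum_nat_const; apply: leq_sum => h hH; rewrite sum1_card.
set P : pred (G * G) := fun p => _.
have [[s0 t0] /= P0|P0] := pickP P; last by rewrite eq_card0.
have /andP[/finset.setXP[/= s0A t0B] /eqP e0] := P0.
have inj : {in P &, injective (fun p : G * G => p.1 - s0)}.
  move=> [s t] [s' t'] /andP[_ /eqP /= e] /andP[_ /eqP /= e'] /addIr es; subst s'.
  by congr pair; apply: oppr_inj; apply: (@addrI _ s); exact: etrans e (esym e').
rewrite -(card_in_image inj); apply: subset_leq_card.
apply/fintype.subsetP => _ /fintype.imageP[[s t] /andP[/finset.setXP[/= sA tB] /eqP /= e] ->].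
rewrite inE cA //=.
suff -> : s - s0 = t - t0 by exact: cB.
by apply: eq_subCA; rewrite e e0.
Qed.

(** Subtracting one of its elements moves a nonempty fibre into the kernel. Applied to differences
    of spins, this makes agreement the most likely outcome. *)
Lemma leq_fiber_sub (A : {set G}) (f : G -> 'I_Q.+1) (c : 'I_Q.+1) :
  (forall s t, f (s - t) = f s - f t) ->
  (forall s t, s \in A -> t \in A -> s - t \in A) ->
  (#|[set s in A | f s == c]%SET| <= #|[set s in A | f s == 0%R]%SET|)%N.
Proof.
move=> fB cA; have [s0 P0|P0] := pickP (fun s => (s \in A) && (f s == c)); last first.
  rewrite (_ : [set s in A | _]%SET = finset.set0) ?cards0//; apply/setP => s.
  by rewrite !inE; exact: (P0 s).
rewrite -(card_imset _ (@addIr _ (- s0))); apply: subset_leq_card.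
apply/fintype.subsetP => _ /imsetP[s + ->]; rewrite !inE.
move: P0 => /andP[s0A /eqP e0] /andP[sA /eqP e]; rewrite cA //=.
by rewrite fB e e0 subrr.
Qed.

Variables (E : finType) (sat : E -> pred G).
Hypothesis sat0 : forall e, sat e 0.
Hypothesis satB : forall e s t, sat e s -> sat e t -> sat e (s - t).

Definition compat (F : {set E}) (s : G) := [forall e in F, sat e s].

(** When the constraints ask spins to agree along edges, this is [Q.+1] to the number of clusters
    that avoid the pinned vertex. *)
Definition ncompat F := #|[set s | compat F s]%SET|.

Lemma compatB F s t : compat F s -> compat F t -> compat F (s - t).
Proof.
move=> /forall_inP cs /forall_inP ct; apply/forall_inP => e eF.
by apply: satB; [exact: cs|exact: ct].
Qed.

Lemma compat0 F : compat F 0.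
Proof. by apply/forall_inP => e _; exact: sat0. Qed.

Lemma compatU F F' s : compat (F :|: F')%SET s = compat F s && compat F' s.
Proof.
apply/forall_inP/andP => [h|[/forall_inP h /forall_inP h'] e].
  by split; apply/forall_inP => e eF; apply: h; rewrite inE eF ?orbT.
by rewrite inE => /orP[/h|/h'].
Qed.

Lemma compat1 e s : compat [set e]%SET s = sat e s.
Proof.
apply/forall_inP/idP => [|h e']; first by apply; rewrite inE.
by rewrite inE => /eqP ->.
Qed.

Lemma compatS (F F' : {set E}) s : F \subset F' -> compat F' s -> compat F s.
Proof. by move=> /finset.setUidPr <-; rewrite compatU => /andP[]. Qed.

Lemma ncompat_supermodular A B :
  (ncompat A * ncompat B <= ncompat (A :|: B)%SET * ncompat (A :&: B)%SET)%N.
Proof.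
rewrite /ncompat.
have := @leq_card_mul_subgroups [set s | compat A s]%SET [set s | compat B s]%SET
  [set s | compat (A :&: B)%SET s]%SET.
set C := (_ :&: [set s | _])%SET; have -> : C = [set s | compat (A :|: B)%SET s]%SET.
  by apply/setP => s; rewrite !inE compatU.
apply=> [s t|s t|s t]; rewrite !inE => hs ht; apply: compatB => //.
  by apply: compatS hs; exact: finset.subsetIl.
by apply: compatS ht; exact: finset.subsetIr.
Qed.

Variable R : realType.
Implicit Types (es : seq (E * R)) (F : {set E}).

(** An entry (e, u) stands for a coupling k with u = exp k - 1, so that the factor is the Boltzmann
    weight of [e]; [F] collects the constraints of infinite coupling. *)
Definition csum es F : R :=
  \sum_(s | compat F s) \prod_(e <- es) (1 + e.2 * (sat e.1 s)%:R).

Lemma csum_nil F : csum [::] F = (ncompat F)%:R.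
Proof.
rewrite /csum /ncompat; under eq_bigr do rewrite big_nil.
by rewrite sumr_const cardsE.
Qed.

Lemma csum_cons e es F :
  csum (e :: es) F = csum es F + e.2 * csum es (F :|: [set e.1])%SET.
Proof.
rewrite /csum mulr_sumr.
under [X in _ = _ + X]eq_bigl do rewrite compatU compat1.
rewrite [X in _ = _ + X]big_mkcondr -big_split /=; apply: eq_bigr => s _.
by rewrite big_cons; case: ifP => _; rewrite ?mulr1 ?mulr0; ring.
Qed.

Definition nneg es := all (fun e => 0 <= e.2) es.

Lemma csum_gt0 es F : nneg es -> 0 < csum es F.
Proof.
elim: es F => [|e es IH] F /=; last first.
  move=> /andP[e0 es0]; rewrite csum_cons.
  by apply: ltr_wpDr; [apply: mulr_ge0 => //; apply: ltW; exact: IH|exact: IH].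
move=> _; rewrite csum_nil ltr0n; apply/card_gt0P; exists 0.
by rewrite inE compat0.
Qed.

(* The one-coordinate case of the Ahlswede-Daykin four functions theorem. *)
Lemma four_functions1 (a0 a1 b0 b1 c0 c1 d0 d1 : R) :
  0 <= a0 -> 0 <= a1 -> 0 <= b0 -> 0 <= b1 -> 0 < c1 -> 0 < d0 ->
  0 <= c0 -> 0 <= d1 ->
  a0 * b0 <= c0 * d0 -> a1 * b1 <= c1 * d1 ->
  a0 * b1 <= c1 * d0 -> a1 * b0 <= c1 * d0 ->
  (a0 + a1) * (b0 + b1) <= (c0 + c1) * (d0 + d1).
Proof.
move=> a00 a10 b00 b10 c10 d00 c00 d10 h00 h11 h01 h10.
suff h : a0 * b1 + a1 * b0 <= c1 * d0 + c0 * d1 by nra.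
have p0 : 0 < c1 * d0 by exact: mulr_gt0.
rewrite -(ler_pM2l p0).
have h1 : 0 <= (c1 * d0 - a0 * b1) * (c1 * d0 - a1 * b0).
  by apply: mulr_ge0; rewrite subr_ge0.
have h2 : (a0 * b0) * (a1 * b1) <= (c0 * d0) * (c1 * d1).
  by apply: ler_pM => //; exact: mulr_ge0.
nra.
Qed.

Lemma csum_antitone es F F' : nneg es -> F \subset F' -> csum es F' <= csum es F.
Proof.
move=> es0 FF'; rewrite /csum big_mkcond [leRHS]big_mkcond; apply: ler_sum => s _.
have p0 : 0 <= \prod_(e <- es) (1 + e.2 * (sat e.1 s)%:R).
  rewrite big_seq; apply: prodr_ge0 => e /(allP es0) e0.
  by rewrite addr_ge0 ?mulr_ge0 ?ler0n.
case: ifPn => [/(compatS FF') -> //|_]; by case: ifP.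
Qed.

(** Induction on the couplings: [csum_cons] splits each sum into a term with [e] deleted and one
    with [e] imposed, to which [four_functions1] applies. The mixed inequalities also use that
    [csum] decreases when constraints are added. *)
Lemma csum_supermodular es A B : nneg es ->
  csum es A * csum es B <= csum es (A :|: B)%SET * csum es (A :&: B)%SET.
Proof.
elim: es A B => [|[e u] es IH] A B /=.
  by rewrite !csum_nil -!natrM ler_nat ncompat_supermodular.
move=> /andP[u0 es0]; rewrite !csum_cons /=.
have p F : 0 < csum es F by exact: csum_gt0.
have up F : 0 <= u * csum es F by apply: mulr_ge0 => //; exact: ltW.
(* [four_functions1] wants the term with the imposed edge positive, hence the separate case of a
   vanishing coupling. *)
have [->|u1] := eqVneq u 0; first by rewrite !mul0r !addr0; exact: IH.
have {}u0 : 0 < u by rewrite lt_neqAle eq_sym u1.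
have setIUS F F' : (F :&: F' \subset F :&: (F' :|: [set e]))%SET.
  by apply: finset.setIS; exact: finset.subsetUl.
apply: four_functions1 => //; do ?[exact: ltW|exact: mulr_gt0].
- exact: IH.
- rewrite mulrACA [leRHS]mulrACA ler_pM2l ?mulr_gt0//.
  have := IH (A :|: [set e])%SET (B :|: [set e])%SET es0.
  by rewrite finset.setUACA finset.setUid -finset.setUIl.
- rewrite mulrCA -mulrA ler_pM2l//.
  apply: le_trans (IH _ _ es0) _; rewrite finset.setUA ler_pM2l//.
  by apply: csum_antitone => //; exact: setIUS.
- rewrite -mulrA -[leRHS]mulrA ler_pM2l// mulrC.
  apply: le_trans (IH _ _ es0) _; rewrite finset.setUA [(B :|: A)%SET]finset.setUC ler_pM2l//.
  by rewrite [(A :&: B)%SET]finset.setIC; apply: csum_antitone => //; exact: setIUS.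
Qed.

(* The second Griffiths inequality for the ferromagnet with weights [es]. *)
Lemma csum_ratio_mono es F F' A : nneg es -> F \subset F' ->
  csum es (F :|: A)%SET / csum es F <= csum es (F' :|: A)%SET / csum es F'.
Proof.
move=> es0 FF'; rewrite ler_pdivrMr ?csum_gt0// mulrAC ler_pdivlMr ?csum_gt0//.
apply: le_trans (csum_supermodular _ _ es0) _.
rewrite finset.setUAC (finset.setUidPr FF') ler_pM2l ?csum_gt0//.
apply: csum_antitone => //; rewrite finset.subsetI FF' andbT.
exact: finset.subsetUl.
Qed.

(** A new coupling replaces the ratio by a weighted mean of itself and of the ratio with [e]
    imposed, which is larger by [csum_ratio_mono]. *)
Lemma csum_ratio_cat es es' F A : nneg es -> nneg es' ->
  csum es (F :|: A)%SET / csum es F <= csum (es' ++ es) (F :|: A)%SET / csum (es' ++ es) F.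
Proof.
move=> es0; elim: es' => [//|[e u] es' IH] /= /andP[u0 es'0].
apply: le_trans (IH es'0) _; rewrite !csum_cons /=.
have {}es0 : nneg (es' ++ es) by rewrite /nneg all_cat; apply/andP.
move: (es' ++ es) es0 => l l0.
have p B : 0 < csum l B by exact: csum_gt0.
have up B : 0 <= u * csum l B by apply: mulr_ge0 => //; exact: ltW.
rewrite ler_pdivrMr// mulrAC ler_pdivlMr ?ltr_wpDr//.
rewrite mulrDr mulrDl lerD2l mulrCA -mulrA ler_wpM2l//.
have := @csum_ratio_mono l F (F :|: [set e])%SET A l0 (finset.subsetUl _ _).
by rewrite ler_pdivrMr// mulrAC ler_pdivlMr// finset.setUAC.
Qed.

End SubgroupCounting.

(** * Potts measures with a pinned boundary vertex *)

Section PinnedPotts.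
Variables (R : realType) (Q : nat) (X : finType).
Local Notation G := {ffun X -> 'I_Q.+1}.
Local Notation V := (option X).
Implicit Types (k : V * V -> R) (F : {set V * V}) (s : G).

(* The vertex [None] is the boundary; its spin is pinned to [ord0]. *)
Definition ext s (v : V) : 'I_Q.+1 := if v is Some x then s x else ord0.

Definition agree (e : V * V) : pred G := fun s => ext s e.1 == ext s e.2.

Lemma ext0 v : ext 0 v = 0.
Proof. by case: v => //= x; rewrite ffunE. Qed.

Lemma extB s t v : ext (s - t) v = ext s v - ext t v.
Proof. by case: v => [x|] /=; [rewrite !ffunE|rewrite subrr]. Qed.

Lemma agree0 e : agree e 0.
Proof. by rewrite /agree !ext0. Qed.

Lemma agreeB e s t : agree e s -> agree e t -> agree e (s - t).
Proof. by rewrite /agree !extB => /eqP -> /eqP ->. Qed.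

Definition energy k s : R := \sum_e k e * (agree e s)%:R.

Definition wt k s : R := expR (energy k s).

Definition pf k : R := \sum_s wt k s.

Definition ev k (f : G -> R) : R := (\sum_s wt k s * f s) / pf k.

Definition prob k F : R := ev k (fun s => (compat agree F s)%:R).

Lemma wt_gt0 k s : 0 < wt k s.
Proof. exact: expR_gt0. Qed.

Lemma pf_gt0 k : 0 < pf k.
Proof.
rewrite /pf (bigD1 ([ffun=> ord0] : G)) //=; apply: ltr_wpDr; last exact: wt_gt0.
by apply: sumr_ge0 => s _; apply: ltW; exact: wt_gt0.
Qed.

Definition wseq k : seq (V * V * R) := [seq (e, expR (k e) - 1) | e <- enum {: V * V}].

Lemma wseq_nneg k : (forall e, 0 <= k e) -> nneg (wseq k).
Proof.
move=> k0; apply/allP => _ /mapP[e _ ->] /=.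
by rewrite subr_ge0 -expR0 ler_expR.
Qed.

Lemma wt_wseq k s : wt k s = \prod_(e <- wseq k) (1 + e.2 * (agree e.1 s)%:R).
Proof.
rewrite /wt /energy expR_sum /wseq big_map big_enum /=; apply: eq_bigr => e _.
by case: (agree e s); rewrite ?mulr1 ?mulr0 ?expR0 ?addr0 //; ring.
Qed.

Lemma csum_wseq k F : csum agree (wseq k) F = \sum_(s | compat agree F s) wt k s.
Proof. by apply: eq_bigr => s _; rewrite wt_wseq. Qed.

Lemma compat_set0 s : compat agree finset.set0 s.
Proof. by apply/forall_inP => e; rewrite inE. Qed.

Lemma prob_csum k F :
  prob k F = csum agree (wseq k) F / csum agree (wseq k) finset.set0.
Proof.
rewrite /prob /ev !csum_wseq; congr (_ / _).
  rewrite [RHS]big_mkcond; apply: eq_bigr => s _.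
  by case: ifP; rewrite ?mulr1 ?mulr0.
by apply: eq_bigl => s; rewrite compat_set0.
Qed.

Lemma prob_csum_wiring k F F' : (forall e, 0 <= k e) ->
  prob k F <= csum agree (wseq k) (F' :|: F)%SET / csum agree (wseq k) F'.
Proof.
move=> k0; rewrite prob_csum.
have := @csum_ratio_mono _ _ _ _ agree0 agreeB R (wseq k) finset.set0 F' F (wseq_nneg k0) (finset.sub0set _).
by rewrite finset.set0U.
Qed.

(** Couplings are indexed by ordered pairs, but only the sum over both orientations acts on the
    spins; models that store a coupling in different orientations are compared through it. *)
Definition sym k e : R := (k e + k (e.2, e.1)) / 2.

Lemma energy_sym k s : energy k s = energy (sym k) s.
Proof.
have e1 : energy k s = \sum_e k (e.2, e.1) * (agree e s)%:R.
  rewrite /energy (reindex_onto (fun e : V * V => (e.2, e.1)) (fun e : V * V => (e.2, e.1))) /=; last by case.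
  apply: eq_big => [[v w]|[v w] _]; first by rewrite eqxx.
  by rewrite /agree /= eq_sym.
rewrite [in RHS]/energy /sym; under eq_bigr do rewrite mulrAC mulrDl.
by rewrite -mulr_suml big_split /= -e1 -/(energy k s); field.
Qed.

Lemma prob_mono k k' F : (forall e, 0 <= k e) ->
  (forall e, e.1 != e.2 -> k e + k (e.2, e.1) <= k' e + k' (e.2, e.1)) ->
  prob k F <= prob k' F.
Proof.
move=> k0 kk'.
pose D e := if e.1 == e.2 then 0 else sym k' e - sym k e.
have D0 e : 0 <= D e.
  rewrite /D; case: ifPn => // /kk' h; rewrite subr_ge0 /sym ler_pM2r//.
(* Diagonal pairs always agree, so they contribute a factor independent of [s] that cancels in
   probabilities. *)
pose c := \sum_(e : V * V | e.1 == e.2) (sym k' e - sym k e).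
have wtE s : wt k' s = expR c * \prod_(e <- wseq D ++ wseq k) (1 + e.2 * (agree e.1 s)%:R).
  rewrite big_cat /= -!wt_wseq /wt -!expRD; congr expR.
  rewrite (energy_sym k') (energy_sym k).
  suff : energy (sym k') s - energy (sym k) s = c + energy D s by lra.
  rewrite /energy -sumrB (bigID (fun e : V * V => e.1 == e.2)) /=.
  rewrite [in RHS](bigID (fun e : V * V => e.1 == e.2)) /=.
  rewrite [X in _ = _ + (X + _)]big1 => [|e]; last by rewrite /D => ->; rewrite mul0r.
  rewrite add0r; congr (_ + _).
    by apply: eq_bigr => e /eqP e12; rewrite /agree e12 eqxx !mulr1.
  by apply: eq_bigr => e /negPf e12; rewrite /D e12 mulrBl.
have csE A : csum agree (wseq k') A = expR c * csum agree (wseq D ++ wseq k) A.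
  by rewrite csum_wseq /csum mulr_sumr; apply: eq_bigr => s _; rewrite wtE.
rewrite !prob_csum !csE -mulf_div divff ?gt_eqF ?expR_gt0// mul1r.
have := @csum_ratio_cat _ _ _ _ agree0 agreeB R (wseq k) (wseq D) finset.set0 F (wseq_nneg k0) (wseq_nneg D0).
by rewrite finset.set0U.
Qed.

End PinnedPotts.

(** * Contraction of vertices *)

Section Contraction.
Variables (R : realType) (Q : nat) (X X' : finType).
Variables (pr : option X -> option X') (io : X' -> X).
Hypothesis prN : pr None = None.
Hypothesis prio : forall x', pr (Some (io x')) = Some x'.

Let pr2 (e : option X * option X) := (pr e.1, pr e.2).
Let pull (s' : {ffun X' -> 'I_Q.+1}) : {ffun X -> 'I_Q.+1} :=
  [ffun x => ext s' (pr (Some x))].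
Let push (s : {ffun X -> 'I_Q.+1}) : {ffun X' -> 'I_Q.+1} := [ffun x' => s (io x')].

Let ext_pull s' v : ext (pull s') v = ext s' (pr v).
Proof. by case: v => [x|] /=; rewrite ?ffunE ?prN. Qed.

Let push_pull s' : push (pull s') = s'.
Proof. by apply/ffunP => x'; rewrite !ffunE prio. Qed.

Let contracted := [set e : option X * option X | pr e.1 == pr e.2]%SET.

Let pull_push s : compat (@agree Q X) contracted s -> pull (push s) = s.
Proof.
move=> /forall_inP cs; apply/ffunP => x; rewrite ffunE.
case e: (pr (Some x)) => [x'|] /=; rewrite ?ffunE.
  by have := cs (Some (io x'), Some x); rewrite inE /= prio e eqxx => /(_ isT)/eqP.
by have := cs (None, Some x); rewrite inE /= prN e eqxx => /(_ isT)/eqP.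
Qed.

(** Imposing agreement inside the fibres of [pr] increases probabilities. The remaining colourings
    are the pullbacks of colourings of [X'], with couplings summed over fibres, and [prob_mono]
    passes from these to [k']. *)
Lemma prob_contract (k : _ -> R) (k' : _ -> R) F :
  (forall e, 0 <= k e) ->
  (forall v' w', v' != w' ->
    \sum_(v | pr v == v') \sum_(w | pr w == w') (k (v, w) + k (w, v))
      <= k' (v', w') + k' (w', v')) ->
  @prob R Q X k F <= @prob R Q X' k' [set pr2 e | e in F]%SET.
Proof.
move=> k0 kk'.
apply: le_trans (@prob_csum_wiring R Q X k F contracted k0) _.
pose k1 e' := \sum_(e | pr2 e == e') k e.
have wtE s' : wt k (pull s') = wt k1 s'.
  rewrite /wt /energy; congr expR; rewrite (partition_big pr2 xpredT) //=.
  apply: eq_bigr => e' _; rewrite mulr_suml; apply: eq_bigr => e /eqP <-.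
  by rewrite /agree !ext_pull.
have agree_pull e s' : agree e (pull s') = agree (pr2 e) s'.
  by rewrite /agree !ext_pull.
have csE A : csum (@agree Q X) (wseq k) (contracted :|: A)%SET
    = csum (@agree Q X') (wseq k1) [set pr2 e | e in A]%SET.
  rewrite !csum_wseq (reindex_onto pull push) /=; last first.
    by move=> s; rewrite compatU => /andP[/pull_push].
  apply: eq_big => [s'|s' _]; last exact: wtE.
  rewrite push_pull eqxx andbT compatU; apply/andP/forall_inP.
    by move=> [_ /forall_inP h] _ /imsetP[e eA ->]; rewrite -agree_pull h.
  move=> h; split; apply/forall_inP => e.
    by rewrite inE /agree !ext_pull => /eqP ->.
  by move=> eA; rewrite agree_pull h// imset_f.
have := csE finset.set0; rewrite finset.setU0 imset0 csE => ->.
rewrite -prob_csum; apply: prob_mono => [e'|[v' w'] /= vw'].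
  by apply: sumr_ge0.
apply: le_trans (kk' _ _ vw'); rewrite /k1.
rewrite pair_big /= big_split /= lerD//.
  rewrite le_eqVlt; apply/orP; left; apply/eqP.
  by apply: eq_big => [[v w]|[v w] _].
rewrite (reindex_onto (fun e : option X * option X => (e.2, e.1)) (fun e => (e.2, e.1))) /=; last by case.
rewrite le_eqVlt; apply/orP; left; apply/eqP.
apply: eq_big => [[v w]|[v w] _] //=.
by rewrite eqxx andbT xpair_eqE andbC.
Qed.

End Contraction.

(** * Random-cluster representation *)

Lemma prod1D_powerset (R : realType) (E : finType) (u : E -> R) (F : {set E}) :
  \prod_(e in F) (1 + u e) = \sum_(J : {set E} | J \subset F) \prod_(e in J) u e.
Proof.
rewrite big_mkcond /=.
transitivity (\prod_e ((if e \in F then u e else 0) + 1)).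
  by apply: eq_bigr => e _; case: ifP; rewrite ?add0r// addrC.
rewrite bigA_distr /= [RHS]big_mkcond /=; apply: eq_bigr => J _.
case: ifPn => [/fintype.subsetP JF|/subsetPn[e eJ /negPf eF]].
  rewrite [RHS]big_mkcond /=; apply: eq_bigr => e _; by case: ifP => // /JF ->.
by rewrite (bigD1 e) //= eJ eF mul0r.
Qed.

Section RandomCluster.
Variables (R : realType) (Q : nat) (X : finType).
Local Notation G := {ffun X -> 'I_Q.+1}.
Local Notation V := (option X).
Local Notation agree := (@agree Q X).
Implicit Types (k : V * V -> R) (om F : {set V * V}) (s : G).

(** With p = 1 - exp(- k e), the factor exp(k e) - 1 is p / (1 - p): this is the random-cluster
    weight up to the constant product of the 1 - p. *)
Definition fkw k om : R := (\prod_(e in om) (expR (k e) - 1)) * (ncompat agree om)%:R.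

Definition fkZ k : R := \sum_om fkw k om.

Lemma fkw_ge0 k om : (forall e, 0 <= k e) -> 0 <= fkw k om.
Proof.
move=> k0; apply: mulr_ge0 => //; apply: prodr_ge0 => e _.
by rewrite subr_ge0 -expR0 ler_expR.
Qed.

(* The Edwards-Sokal expansion. *)
Lemma sum_wt_cond k (P : pred G) : \sum_(s | P s) wt k s =
  \sum_(om : {set V * V}) (\prod_(e in om) (expR (k e) - 1)) *
    #|[set s | compat agree om s && P s]%SET|%:R.
Proof.
have E s : wt k s = \sum_(om : {set V * V})
    (\prod_(e in om) (expR (k e) - 1)) * (compat agree om s)%:R.
  rewrite wt_wseq /wseq big_map big_enum /=.
  transitivity (\prod_e ((expR (k e) - 1) * (agree e s)%:R + 1)).
    by apply: eq_bigr => e _; rewrite addrC.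
  rewrite bigA_distr /=; apply: eq_bigr => om _.
  rewrite -big_mkcond /= big_split /=; congr (_ * _).
  case: (boolP (compat _ _ _)) => [/forall_inP h|].
    by rewrite big1// => e /h ->.
  by move=> /forall_inPn[e eo /negPf ne]; rewrite (bigD1 e) //= ne mul0r.
under eq_bigr do rewrite E.
rewrite exchange_big /=; apply: eq_bigr => om _; rewrite -mulr_sumr; congr (_ * _).
rewrite -sum1_card natr_sum big_mkcond [RHS]big_mkcond /=.
by apply: eq_bigr => s _; rewrite inE; case: compat; case: P.
Qed.

Lemma sum_compat_wt k F : \sum_(s | compat agree F s) wt k s =
  \sum_(om : {set V * V}) (\prod_(e in om) (expR (k e) - 1)) * (ncompat agree (om :|: F)%SET)%:R.
Proof.
rewrite sum_wt_cond; apply: eq_bigr => om _; congr (_ * _%:R).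
by apply: eq_card => s; rewrite !inE compatU.
Qed.

(** Given the random-cluster configuration, the colourings form a group on which the difference of
    two spins is additive, so [leq_fiber_sub] applies term by term. This yields both the lower bound
    1 / q on agreement and the comparison of the boundary conditions 1/d and 1/1. *)
Lemma le_sum_wt_fiber k (v w : V) c : (forall e, 0 <= k e) ->
  \sum_(s : G | ext s v - ext s w == c) wt k s <= \sum_(s : G | ext s v == ext s w) wt k s.
Proof.
move=> k0; rewrite !sum_wt_cond; apply: ler_sum => om _; apply: ler_wpM2l.
  by apply: prodr_ge0 => e _; rewrite subr_ge0 -expR0 ler_expR.
rewrite ler_nat.
have := @leq_fiber_sub X Q [set s | compat agree om s]%SET (fun s => ext s v - ext s w) c.
rewrite (_ : [set s in _ | _]%SET = [set s | compat agree om s && (ext s v - ext s w == c)]%SET); last first.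
  by apply/setP => s; rewrite !inE.
move=> /(_ _ _)/leq_trans; apply.
- by move=> s t; rewrite !extB opprB addrACA opprB [- _ + _]addrC addrACA.
- by move=> s t; rewrite !inE; apply: compatB; exact: agreeB.
by apply: subset_leq_card; apply/fintype.subsetP => s; rewrite !inE subr_eq0.
Qed.

Lemma pf_le_agree k (v w : V) : (forall e, 0 <= k e) ->
  @pf R Q X k <= Q.+1%:R * \sum_(s : G | ext s v == ext s w) wt k s.
Proof.
move=> k0; rewrite /pf (partition_big (fun s : G => ext s v - ext s w) xpredT) //=.
apply: (@le_trans _ _ (\sum_(c : 'I_Q.+1) \sum_(s : G | ext s v == ext s w) wt k s)).
  by apply: ler_sum => c _; exact: le_sum_wt_fiber.
by rewrite sumr_const card_ord mulr_natl.
Qed.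

Lemma pf_fkZ k : @pf R Q X k = fkZ k.
Proof.
have := sum_compat_wt k finset.set0; rewrite /pf /fkZ.
under eq_bigl do rewrite compat_set0.
by move=> ->; apply: eq_bigr => om _; rewrite finset.setU0.
Qed.

(** Colourings are sorted by the difference of the spins at [v] and [w]; each of the [Q.+1] classes
    is at most as large as that of difference 0, where [eta] is satisfied. *)
Lemma leq_ncompat_merge om eta (v w : V) :
  (forall s, compat agree om s -> ext s v = ext s w -> compat agree eta s) ->
  (ncompat agree om <= Q.+1 * ncompat agree (om :|: eta)%SET)%N.
Proof.
move=> h; rewrite /ncompat -sum1_card.
rewrite (partition_big (fun s : G => ext s v - ext s w) xpredT) //=.
rewrite -[X in (_ <= X * _)%N]card_ord -sum_nat_const; apply: leq_sum => c _.
have := @leq_fiber_sub X Q [set s | compat agree om s]%SET (fun s => ext s v - ext s w) c.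
rewrite sum1_card cardsE => /(_ _ _)/leq_trans; apply.
- by move=> s t; rewrite !extB opprB addrACA opprB [- _ + _]addrC addrACA.
- by move=> s t; rewrite !inE; apply: compatB; exact: agreeB.
apply: subset_leq_card; apply/fintype.subsetP => s; rewrite !inE compatU.
by move=> /andP[cs]; rewrite subr_eq0 => /eqP e; rewrite cs h.
Qed.

Section Merge.
Variables (k : V * V -> R) (P : pred {set V * V}) (D : {set V * V}).
Variables (F : {set V * V} -> {set V * V}) (a b : {set V * V} -> V) (C : R).
Hypothesis k0 : forall e, 0 <= k e.
Hypothesis FD : forall om, F om \subset D.
Hypothesis FE : forall om, F (om :\: D)%SET = F om.
Hypothesis PE : forall om, P (om :\: D)%SET = P om.
Hypothesis merge : forall om s, P om -> compat agree (om :\: D)%SET s ->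
  ext s (a om) = ext s (b om) -> compat agree (F om) s.
Hypothesis le_C : forall om, P om ->
  (Q.+1)%:R * expR (- \sum_(e in F om) k e) <= C.

Let u e := expR (k e) - 1.

(* Opening arbitrary edges of [F om], all of which join the cluster of [a om]
   to that of [b om], divides the number of colourings by at most [Q.+1]. *)
Lemma fk_closed_le :
  \sum_(om | P om && [disjoint om & F om]) fkw k om <= C * \sum_(om | P om) fkw k om.
Proof.
(* Configurations are grouped by their part outside [F om]. Since [F] reads only edges outside [D],
   a class consists of the [om0 :|: J] with [J] inside [F om0], and only the empty [J] counts on the
   left. *)
rewrite mulr_sumr (partition_big (fun om => om :\: F om)%SET xpredT) //=.
rewrite [leRHS](partition_big (fun om => om :\: F om)%SET xpredT) //=.
apply: ler_sum => om0 _.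
have C0 om : P om -> 0 <= C.
  by move=> /le_C; apply: le_trans; rewrite mulr_ge0// expR_ge0.
have [/andP[P0 dis]|n0] := boolP (P om0 && [disjoint om0 & F om0]); last first.
  rewrite big1; last first.
    move=> om /andP[/andP[Pom dom] /eqP e]; case/negP: n0.
    by rewrite -e (finset.setDidPl dom) Pom.
  by apply: sumr_ge0 => om /andP[Pom _]; rewrite mulr_ge0 ?fkw_ge0// (C0 _ Pom).
rewrite (big_pred1 om0); last first.
  move=> om; rewrite [RHS]/= ; apply/andP/eqP => [[/andP[Pom dom] /eqP <-]|->].
    by rewrite (finset.setDidPl dom).
  by rewrite P0 dis (finset.setDidPl dis).
have Fdiff om : (om :\: F om)%SET = om0 -> F om = F om0.
  move=> e; rewrite -FE -[RHS]FE -e; congr F; apply/setP => x; rewrite !inE.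
  by case: (boolP (x \in F om)) => // /(fintype.subsetP (FD om)) ->.
have Fadd (J : {set V * V}) : J \subset F om0 -> F (om0 :|: J)%SET = F om0 /\ P (om0 :|: J)%SET = P om0.
  move=> /fintype.subsetP JF.
  have e : ((om0 :|: J) :\: D = om0 :\: D)%SET.
    apply/setP => x; rewrite !inE; case: (boolP (x \in J)); rewrite ?orbF//.
    by move=> /JF/(fintype.subsetP (FD om0)) ->.
  by rewrite -FE -PE e FE PE.
rewrite (reindex_onto (fun J : {set V * V} => om0 :|: J)%SET
  (fun om : {set V * V} => om :&: F om0)%SET) /=; last first.
  move=> om /andP[Pom /eqP e]; rewrite -(Fdiff _ e) -{1}e.
  by rewrite finset.setUC finset.setID.
have h (J : {set V * V}) : (P (om0 :|: J) && ((om0 :|: J) :\: F (om0 :|: J) == om0) &&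
    ((om0 :|: J) :&: F om0 == J))%SET = (J \subset F om0).
  apply/idP/idP => [/andP[_ /eqP <-]|JF]; first exact: finset.subsetIr.
  have [-> ->] := Fadd _ JF; rewrite P0 finset.setDUl finset.setIUl.
  rewrite (finset.setDidPl dis) (disjoint_setI0 dis) finset.set0U (finset.setIidPl JF).
  have /eqP -> : (J :\: F om0 == finset.set0)%SET by rewrite finset.setD_eq0.
  by rewrite finset.setU0 !eqxx.
rewrite (eq_bigl _ _ h) -mulr_sumr.
have u0 e : 0 <= u e by rewrite subr_ge0 -expR0 ler_expR.
suff lb : expR (\sum_(e in F om0) k e) * fkw k om0 <=
    Q.+1%:R * \sum_(J : {set V * V} | J \subset F om0) fkw k (om0 :|: J)%SET.
  have S0 : 0 <= \sum_(J : {set V * V} | J \subset F om0) fkw k (om0 :|: J)%SET.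
    by apply: sumr_ge0 => J _; exact: fkw_ge0.
  apply: le_trans (ler_wpM2r S0 (le_C P0)).
  by rewrite mulrAC mulrC expRN ler_pdivlMl ?expR_gt0.
(* Expanding the product of the 1 + u over subsets [J] turns the closed configuration into the sum
   over all ways of opening edges of [F om0]. *)
have -> : expR (\sum_(e in F om0) k e) = \prod_(e in F om0) (1 + u e).
  by rewrite expR_sum; apply: eq_bigr => e _; rewrite /u addrC subrK.
rewrite prod1D_powerset mulr_suml mulr_sumr; apply: ler_sum => J JF.
have dJ : [disjoint om0 & J] by apply: disjointWr JF dis.
rewrite /fkw [X in _ <= _ * (X * _)](_ : _ =
  (\prod_(e in om0) u e) * \prod_(e in J) u e); last first.
  by rewrite -bigU //=; apply: eq_bigl => e; rewrite !inE.
have a0 : 0 <= \prod_(e in om0) u e by apply: prodr_ge0.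
have b0 : 0 <= \prod_(e in J) u e by apply: prodr_ge0.
rewrite -/(u _) [leRHS](_ : _ = (\prod_(e in J) u e) *
  ((\prod_(e in om0) u e) * (Q.+1%:R * (ncompat agree (om0 :|: J)%SET)%:R))); last by ring.
do 2!apply: ler_wpM2l => //.
rewrite -natrM ler_nat; apply: (@leq_ncompat_merge _ _ (a om0) (b om0)) => s cs e.
apply: compatS JF _; apply: merge => //.
by apply: compatS cs; exact: finset.subsetDl.
Qed.

End Merge.
End RandomCluster.

(** * Long-range interactions on intervals *)

Section LongRange.
Variables (R : realType) (beta lambda : R).
Hypotheses (beta0 : 0 < beta) (lambda0 : 0 < lambda).

Definition kap (n : nat) : R := if n == 1%N then lambda else beta / n%:R ^+ 2.

(** Total coupling of a site to a half-line that starts at distance [d]. *)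
Definition tail (d : nat) : R := fine (\sum_(d <= n <oo) (kap n)%:E)%E.

Lemma kap_ge0 n : 0 <= kap n.
Proof. by rewrite /kap; case: ifP => _; rewrite ?divr_ge0 ?exprn_ge0// ltW. Qed.

Let EFin_kap_ge0 n : (0%E <= (kap n)%:E)%E.
Proof. by rewrite lee_fin kap_ge0. Qed.

Lemma kapS_le n : (0 < n)%N -> kap n.+1 <= beta / n%:R - beta / n.+1%:R.
Proof.
move=> n0; rewrite /kap ifF; last by lia.
have m0 : 0 < n%:R :> R by rewrite ltr0n.
rewrite -natr1; set m := n%:R in m0 *.
have -> : beta / m - beta / (m + 1) = beta / (m * (m + 1)) by field; lra.
rewrite ler_pM2l// lef_pV2 ?posrE//; nra.
Qed.

Lemma sum_kap_le d e : (0 < d)%N -> \sum_(d.+1 <= n < e) kap n <= beta / d%:R.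
Proof.
move=> d0; have [ed|de] := leqP e d.+1; first by rewrite big_geq// divr_ge0// ltW.
have -> : e = e.-1.+1 by lia.
rewrite big_add1 /=; apply: (@le_trans _ _ (\sum_(d <= n < e.-1) - (beta / n.+1%:R - beta / n%:R))).
  rewrite big_seq [leRHS]big_seq; apply: ler_sum => n.
  by rewrite mem_index_iota opprB => /andP[? _]; apply: kapS_le; lia.
rewrite sumrN telescope_sumr; last by lia.
by rewrite opprB gerBl divr_ge0// ltW.
Qed.

Lemma tail_fin d : (\sum_(d <= n <oo) (kap n)%:E)%E = (tail d)%:E.
Proof.
rewrite /tail fineK// ge0_fin_numE; last by apply: nneseries_ge0.
rewrite (@nneseries_split _ _ d 2) //.
apply: lte_add_pinfty; first by rewrite sumEFin ltry.
apply: (@le_lt_trans _ _ (beta / (d.+1)%:R)%:E); last exact: ltry.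
apply: lime_le; first exact: is_cvg_nneseries.
by apply: nearW => n; rewrite addn2 sumEFin lee_fin sum_kap_le.
Qed.

Lemma tail_ge0 d : 0 <= tail d.
Proof. by rewrite -lee_fin -tail_fin; apply: nneseries_ge0. Qed.

Lemma tail_split d e : (d <= e)%N -> tail d = \sum_(d <= n < e) kap n + tail e.
Proof.
move=> de; apply: EFin_inj; rewrite EFinD -!tail_fin.
rewrite (@nneseries_split _ _ d (e - d)) //.
by rewrite subnKC// sumEFin.
Qed.

Lemma tail_le d : (0 < d)%N -> tail d.+1 <= beta / d%:R.
Proof.
move=> d0; rewrite -lee_fin -tail_fin; apply: lime_le; first exact: is_cvg_nneseries.
by apply: nearW => n; rewrite sumEFin lee_fin sum_kap_le.
Qed.

Lemma sum_kap_left a i : (a <= i)%N ->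
  \sum_(0 <= j < a) kap (i - j) + tail i.+1 = tail (i - a).+1.
Proof.
elim: a => [|a IH] ai; first by rewrite big_geq// add0r subn0.
rewrite big_nat_recr//= addrAC IH; last by rewrite ltnW.
have -> : (i - a.+1).+1 = (i - a)%N by lia.
rewrite (@tail_split (i - a) (i - a).+1)// big_nat1 addrC //.
Qed.

Lemma sum_kap_right b l i : (i < b)%N -> (b <= l)%N ->
  \sum_(b <= j < l) kap (j - i) + tail (l - i) = tail (b - i).
Proof.
move=> ib bl; rewrite (@tail_split (b - i) (l - i)); last by lia.
congr (_ + _); rewrite -{1}(subnK (ltnW ib)) -{1}(subnK (ltnW (leq_trans ib bl))).
by rewrite big_addn addnK; apply: eq_bigr => j _; rewrite addnK.
Qed.

Definition dist (i j : nat) : nat := (maxn i j - minn i j)%N.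

(** After contraction of the complement of [a, b), a site couples to the boundary exactly as in a
    wired interval [a, b) on its own. This makes the family [kint] consistent under restriction to
    subintervals. *)
Lemma sum_kap_outside a b l i : (a <= i)%N -> (i < b)%N -> (b <= l)%N ->
  \sum_(0 <= j < l | ~~ (a <= j < b)%N) kap (dist i j) + tail i.+1 + tail (l - i)
    = tail (i - a).+1 + tail (b - i).
Proof.
move=> ai ib bl.
rewrite (@big_cat_nat _ _ _ a) //=; last by lia.
rewrite (@big_cat_nat _ _ _ b a) //=; last by lia.
rewrite [X in (_ + (X + _))](_ : _ = 0) ?add0r; last first.
  by rewrite big_nat_cond big1// => j /andP[/andP[-> ->]].
rewrite -(@sum_kap_left a i)// -(@sum_kap_right b l i)// [RHS]addrACA addrA.
congr (_ + _ + _ + _).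
  rewrite big_nat_cond [RHS]big_nat_cond; apply: eq_big => j; first by lia.
  by move=> hj; congr kap; rewrite /dist; lia.
rewrite big_nat_cond [RHS]big_nat_cond; apply: eq_big => j; first by lia.
by move=> hj; congr kap; rewrite /dist; lia.
Qed.

(* Couplings of the sites [0, l) with each other and with the boundary, all
   other integers being contracted to [None]. *)
Definition kint (l : nat) (e : option 'I_l * option 'I_l) : R :=
  match e with
  | (Some i, Some j) => if (i < j)%N then kap (j - i) else 0
  | (Some i, None) => tail i.+1 + tail (l - i)
  | _ => 0
  end.

Lemma kint_ge0 l e : 0 <= @kint l e.
Proof.
case: e => [[i|] [j|]] //=; last by rewrite addr_ge0 ?tail_ge0.
by case: ifP => _; rewrite ?kap_ge0.
Qed.

Lemma kint_some l (i j : 'I_l) : i != j ->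
  kint (Some i, Some j) + kint (Some j, Some i) = kap (dist i j).
Proof.
rewrite neq_ltn /= => /orP[h|h]; rewrite h ?(ltnNge i j) ?(ltnNge j i) ltnW//= ?addr0 ?add0r.
  by congr kap; rewrite /dist; lia.
by congr kap; rewrite /dist; lia.
Qed.

End LongRange.

Arguments kap {R} beta lambda n.
Arguments tail {R} beta lambda d.
Arguments kint {R} beta lambda l e.

Lemma kapE (R : realType) (beta lambda : R) n :
  kap beta lambda n = if n == 1%N then lambda else beta / n%:R ^+ 2.
Proof. by []. Qed.

Lemma sum_option (R : nmodType) (X : finType) (F : option X -> R) :
  \sum_v F v = F None + \sum_x F (Some x).
Proof.
rewrite (bigD1 None) //=; congr (_ + _).
rewrite (reindex_omap Some id) /=; last by case.
by apply: eq_bigl => x; rewrite eqxx.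
Qed.

Lemma sum_pair (R : nmodType) (X Y : finType) (F : X * Y -> R) :
  \sum_e F e = \sum_x \sum_y F (x, y).
Proof. by rewrite pair_bigA; apply: eq_bigr => -[]. Qed.

Lemma esum_partition (R : realType) (T : choiceType) (I : finType) (B : set T)
    (c : T -> option I) (a : T -> \bar R) :
  (forall e, B e -> (0 <= a e)%E) -> (forall e, B e -> c e <> None) ->
  (\esum_(e in B) a e = \sum_(x : I) \esum_(e in [set e | B e /\ c e = Some x]%classic) a e)%E.
Proof.
move=> a0 cN; rewrite esum_mkcond.
transitivity (\esum_(e in [set: T]%classic)
    \sum_(x : I) (if e \in [set e | B e /\ c e = Some x]%classic then a e else 0))%E.
  apply: eq_esum => e _; case: ifPn => [|/negP eB]; last first.
    rewrite big1// => x _; case: ifPn => //; rewrite inE => -[Be _].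
    by case: eB; rewrite inE.
  rewrite inE => Be; case ce : (c e) => [x|]; last by have := cN _ Be.
  rewrite (bigD1 x) //= big1 ?adde0 => [|y yx].
    by rewrite ifT// inE.
  by rewrite ifF//; apply/negP; rewrite inE /= ce => -[_ [] /esym/eqP]; apply/negP.
rewrite esum_sum; last first.
  by move=> e x _ _; case: ifPn => //; rewrite inE => -[/a0].
by apply: eq_bigr => x _; rewrite -esum_mkcond.
Qed.

(** * The model of the statement as a pinned Potts measure on an interval *)

Section SpinModel.
Variables (R : realType) (beta lambda : R) (Q L : nat).
Hypotheses (beta0 : 0 < beta) (lambda0 : 0 < lambda).
Implicit Types (s : config Q.+1 L) (x y : 'I_(L.*2)) (i j : int).

Local Notation kap := (kap beta lambda).
Local Notation tail := (tail beta lambda).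

Lemma K_kap i j : K beta lambda i j = kap `|i - j|%N.
Proof.
rewrite /K /J kapE -abszE div1r pmulrn.
by have -> : (`|i - j|%N%:Z == 1) = (`|i - j|%N == 1%N) by [].
Qed.

Definition site_index j : option 'I_(L.*2) := [pick x | site x == j].

Lemma site_inj : injective (@site L).
Proof. by move=> x y; rewrite /site => /addIr[] /val_inj. Qed.

Lemma site_indexK x : site_index (site x) = Some x.
Proof.
rewrite /site_index; case: pickP => [y /eqP/site_inj -> //|/(_ x)].
by rewrite eqxx.
Qed.

Lemma site_indexP j x : site_index j = Some x -> site x = j.
Proof. by rewrite /site_index; case: pickP => // y /eqP <- [->]. Qed.

Lemma in_boxP j : in_box L j -> exists x, j = site x.
Proof.
rewrite /in_box /site => h; have jL : (absz (j + L%:Z)%R < L.*2)%N by lia.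
by exists (Ordinal jL) => /=; lia.
Qed.

Lemma in_box_site x : in_box L (site x).
Proof. by rewrite /in_box /site; have := ltn_ord x; lia. Qed.

Lemma spin_site s x : spin s (site x) = (s x).+1.
Proof. by rewrite /spin -/(site_index _) site_indexK. Qed.

Lemma spin_out s j : ~~ in_box L j -> spin s j = 1%N.
Proof.
move=> jL; rewrite /spin -/(site_index _).
case e : (site_index j) => [x|//]; move: jL.
by rewrite -(site_indexP e) in_box_site.
Qed.

Let a s (e : int * int) : \bar R :=
  (K beta lambda e.1 e.2 * (spin s e.1 == spin s e.2)%:R)%:E.

Let a_ge0 s e : (0 <= a s e)%E.
Proof. by rewrite lee_fin K_kap mulr_ge0// kap_ge0. Qed.

Let esum_ray s (b : bool) (f : nat -> int * int) (d : nat) :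
  injective f -> (forall n, a s (f n) = (kap (n + d) * b%:R)%:E) ->
  (\esum_(e in [set f n | n in [set: nat]]%classic) a s e = (tail d * b%:R)%:E)%E.
Proof.
move=> finj fE; rewrite esum_image; last by move=> m n _ _; exact: finj.
rewrite -nneseries_esumT; last by move=> n; exact: a_ge0.
case: b fE => fE; last first.
  by rewrite mulr0 eseries0// => n _ _; rewrite fE mulr0.
rewrite mulr1 -tail_fin// -(@nneseries_addn _ (fun n => (kap n)%:E)); last first.
  by move=> n; rewrite lee_fin kap_ge0.
by apply: eq_eseriesr => n _; rewrite fE mulr1.
Qed.

Lemma interactionE s : interaction beta lambda s = energy (kint beta lambda L.*2) s.
Proof.
suff h : (\esum_(e in bonds L) a s e)%E = (energy (kint beta lambda L.*2) s)%:E.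
  by rewrite /interaction -/(a s) h.
(* As [bonds] orders the endpoints, the bonds are either internal, or leave the box to the right, or
   leave it to the left. *)
rewrite (esumID [set e | in_box L e.1]%classic); last by move=> e _; exact: a_ge0.
rewrite (esumID [set e | in_box L e.2]%classic) /=; last by move=> e _; exact: a_ge0.
have -> : (energy (kint beta lambda L.*2) s)%:E =
   (\sum_(x : 'I_(L.*2)) \sum_(y : 'I_(L.*2)) ((if (x < y)%N then kap (y - x) else 0) * (s x == s y)%:R)%:E
   + \sum_(x : 'I_(L.*2)) (tail (L.*2 - x) * (s x == ord0)%:R)%:E
   + \sum_(x : 'I_(L.*2)) (tail x.+1 * (s x == ord0)%:R)%:E)%E.
  under eq_bigr do rewrite sumEFin.
  rewrite !sumEFin -!EFinD; congr EFin; rewrite /energy.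
  rewrite sum_pair.
  rewrite sum_option [X in X + _]big1 ?add0r; last by move=> v _; rewrite mul0r.
  rewrite -addrA -!big_split /=; apply: eq_bigr => x _.
  rewrite sum_option /= addrC; congr (_ + _).
  by rewrite /agree /= -mulrDl [X in X * _]addrC.
congr (_ + _ + _)%E.
- rewrite (@esum_partition _ _ _ _
    (fun e => obind (fun x => omap (pair x) (site_index e.2)) (site_index e.1)))//; last first.
    by move=> [i j] /= [[_ /in_boxP[x ->]] /in_boxP[y ->]]; rewrite !site_indexK.
  rewrite pair_big; apply: eq_bigr => -[x y] _ /=.
  case: ifPn => xy.
    rewrite [X in (\esum_(e in X) _)%E](_ : _ = [set (site x, site y)]%classic).
      rewrite esum_set1 ?a_ge0// /a /= K_kap !spin_site eqSS; congr (kap _ * _)%:E.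
      by rewrite /site; lia.
    apply/seteqP; split => [[i j] /= [[[_ /in_boxP[x' ->]] /in_boxP[y' ->]]]|[i j] /= [-> ->]].
      by rewrite !site_indexK => -[-> ->].
    rewrite !site_indexK /= /bonds /= !in_box_site; split => //; split => //; split => //.
    by rewrite andbT /site; lia.
  rewrite mul0r [X in (\esum_(e in X) _)%E](_ : _ = set0) ?esum_set0//.
  apply/seteqP; split => [[i j] /= [[[h /in_boxP[x' ix]] /in_boxP[y' jy]]]|//].
  move: h; rewrite ix jy !site_indexK /bonds /= => /andP[h _] [ex ey].
  by move: h; rewrite ex ey ltrD2r ltz_nat; exact/negP.
- rewrite (@esum_partition _ _ _ _ (fun e => site_index e.1))//; last first.
    by move=> [i j] /= [[_ /in_boxP[x ->]] _]; rewrite !site_indexK.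
  apply: eq_bigr => x _.
  rewrite -(@esum_ray s _ (fun n => (site x, L%:Z + n%:Z)))//.
  + congr (esum _ _); apply/seteqP; split => [[i j] /= [[[h /in_boxP[x' ix]] /negP jL]]|[i j] /= [n _ [<- <-]]].
      move: h; rewrite ix site_indexK /bonds /= => /andP[ij _] [e]; rewrite -e.
      exists (absz (j - L%:Z)) => //; congr pair.
      by move: ij jL; rewrite /site /in_box; lia.
    rewrite /bonds /= in_box_site site_indexK; split => //; split; last first.
      by apply/negP; rewrite /in_box; lia.
    by split => //; rewrite orTb andbT /site; have := ltn_ord x; lia.
  + by move=> m n [] h; lia.
  move=> n; rewrite /a /= K_kap spin_site (@spin_out s (L%:Z + n%:Z)); last first.
    by rewrite /in_box; lia.
  by rewrite eqSS; congr (kap _ * _)%:E; rewrite /site; have := ltn_ord x; lia.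
- rewrite (@esum_partition _ _ _ _ (fun e => site_index e.2))//; last first.
    move=> [i j] /= [/andP[_ /= h] /negP iL]; move: h; rewrite (negPf iL) => /in_boxP[y ->].
    by rewrite site_indexK.
  apply: eq_bigr => y _.
  rewrite -(@esum_ray s _ (fun n => (- L%:Z - 1 - n%:Z, site y)))//.
  + congr (esum _ _); apply/seteqP; split => [[i j] /= [[/andP[/= ij h] /negP iL]]|[i j] /= [n _ [<- <-]]].
      move: h; rewrite (negPf iL) => /in_boxP[y' jy]; rewrite jy site_indexK => -[e].
      rewrite -e; exists (absz (- L%:Z - 1 - i)%R) => //; congr pair.
      by move: ij iL; rewrite jy /site /in_box; have := ltn_ord y'; lia.
    rewrite /bonds /= in_box_site site_indexK; split => //; split; last first.
      by apply/negP; rewrite /in_box; lia.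
    by rewrite orbT andbT /site; lia.
  + by move=> m n [] h; lia.
  move=> n; rewrite /a /= K_kap spin_site (@spin_out s (- L%:Z - 1 - n%:Z)); last first.
    by rewrite /in_box; lia.
  rewrite eqSS eq_sym; congr (kap _ * _)%:E; rewrite /site; have := ltn_ord y; lia.
Qed.

Lemma weightE s : Defs.weight beta lambda s = wt (kint beta lambda L.*2) s.
Proof. by rewrite /Defs.weight interactionE. Qed.

End SpinModel.

Lemma finite_magnetizationE (R : realType) (beta lambda : R) (Q L : nat)
    (c : 'I_(L.*2)) : 0 < beta -> 0 < lambda -> c = L :> nat ->
  finite_magnetization Q.+1 beta lambda L =
    (Q.+1%:R * @prob R Q _ (kint beta lambda L.*2) [set (Some c, None)]%SET - 1)
      / (Q.+1%:R - 1).
Proof.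
move=> b0 l0 cL; rewrite /finite_magnetization; congr ((_ * _ - 1) / _).
rewrite /potts_prob /potts /prob /ev mulr_suml.
have <- : partition_function Q.+1 L beta lambda = pf Q (kint beta lambda L.*2).
  by apply: eq_bigr => s _; rewrite weightE.
rewrite big_mkcond; apply: eq_bigr => s _; rewrite compat1 weightE// /agree /=.
have -> : (0 : int) = site c by rewrite /site cL subrr.
by rewrite spin_site eqSS -val_eqE /=; case: ifP; rewrite ?mulr1 ?mulr0 ?mul0r.
Qed.

(** * Comparison of volumes *)

Section IntervalComparison.
Variables (R : realType) (beta lambda : R) (Q : nat).
Hypotheses (beta0 : 0 < beta) (lambda0 : 0 < lambda).
Local Notation kap := (kap beta lambda).
Local Notation tail := (tail beta lambda).
Local Notation kint := (kint beta lambda).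

Definition retract (X X' : finType) (io : X' -> X) (v : option X) : option X' :=
  obind (fun x => [pick x' | io x' == x]) v.

Lemma retractK (X X' : finType) (io : X' -> X) : injective io ->
  forall x', retract io (Some (io x')) = Some x'.
Proof.
move=> io_inj x' /=; case: pickP => [y /eqP/io_inj -> //|/(_ x')].
by rewrite eqxx.
Qed.

Lemma retract_Some (X X' : finType) (io : X' -> X) v x' : injective io ->
  (retract io v == Some x') = (v == Some (io x')).
Proof.
move=> io_inj; apply/eqP/eqP => [|->]; last exact: retractK.
by case: v => //= x; case: pickP => // y /eqP <- [->].
Qed.

Lemma retract_None (X X' : finType) (io : X' -> X) x :
  (retract io (Some x) == None) = (x \notin codom io).
Proof.
rewrite /=; case: pickP => [y /eqP <-|h]; first by rewrite codom_f.
by apply/esym/negP => /codomP[y e]; have := h y; rewrite e eqxx.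
Qed.

Lemma prob_kint_contract (l : nat) (X' : finType) (io : X' -> 'I_l)
    (k' : option X' * option X' -> R) F :
  injective io ->
  (forall x' y', x' != y' -> kap (dist (io x') (io y')) <=
    k' (Some x', Some y') + k' (Some y', Some x')) ->
  (forall x', \sum_(j | j \notin codom io) kap (dist (io x') j) +
    tail (io x').+1 + tail (l - io x') <= k' (Some x', None) + k' (None, Some x')) ->
  @prob R Q _ (kint l) F <=
    @prob R Q _ k' [set (retract io e.1, retract io e.2) | e in F]%SET.
Proof.
move=> io_inj h1 h2.
have None_case x' : \sum_(w | retract io w == None)
    (kint l (Some (io x'), w) + kint l (w, Some (io x'))) <=
      k' (Some x', None) + k' (None, Some x').
  apply: le_trans (h2 x'); rewrite big_mkcond /= sum_option /= addr0 -[leRHS]addrA addrC.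
  rewrite lerD2r [leRHS]big_mkcond /= le_eqVlt; apply/orP; left; apply/eqP.
  apply: eq_bigr => j _; rewrite -[X in if X then _ else _]/(retract io (Some j) == None) retract_None.
  case: ifPn => // jo; rewrite -(@kint_some R beta lambda beta0 lambda0 l)//.
  by apply: contraNneq jo => <-; exact: codom_f.
apply: (@prob_contract R Q _ _ (retract io) io) => //.
- exact: retractK.
- by move=> e; exact: kint_ge0.
move=> [x'|] [y'|] // xy.
- rewrite (big_pred1 (Some (io x'))); last by move=> v; rewrite retract_Some.
  rewrite (big_pred1 (Some (io y'))); last by move=> v; rewrite retract_Some.
  have xy' : x' != y' by apply: contraNneq xy => ->.
  by rewrite kint_some ?h1// inj_eq.
- rewrite (big_pred1 (Some (io x'))); last by move=> v; rewrite retract_Some.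
  exact: None_case.
- rewrite exchange_big (big_pred1 (Some (io y'))) /=; last first.
    by move=> v; rewrite retract_Some.
  rewrite [leRHS]addrC; apply: le_trans (None_case y').
  by rewrite le_eqVlt; apply/orP; left; apply/eqP; apply: eq_bigr => v _; rewrite addrC.
Qed.

Definition shift_ord (a m l : nat) (aml : (a + m <= l)%N) (i : 'I_m) : 'I_l :=
  Ordinal (leq_trans (etrans (ltn_add2l a i m) (ltn_ord i)) aml).

Lemma shift_ord_inj a m l (aml : (a + m <= l)%N) : injective (shift_ord aml).
Proof. by move=> i j [] /addnI /val_inj. Qed.

Lemma sum_kap_codom (X' : finType) l (io : X' -> 'I_l) a m (x' : X') :
  (a + m <= l)%N -> (a <= io x' < a + m)%N ->
  (forall j : 'I_l, (a <= j < a + m)%N -> j \in codom io) ->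
  \sum_(j | j \notin codom io) kap (dist (io x') j) + tail (io x').+1 + tail (l - io x')
   <= tail (io x' - a).+1 + tail (a + m - io x').
Proof.
move=> aml /andP[ax xm] cod.
rewrite -(@sum_kap_outside R beta lambda beta0 lambda0 a (a + m) l)// !lerD2r.
rewrite big_mkord big_mkcond [leRHS]big_mkcond; apply: ler_sum => j _.
case: ifPn => jo; last by case: ifP => // _; apply: kap_ge0.
by rewrite ifT//; apply: contra jo; exact: cod.
Qed.

(** Wiring everything outside a window leaves the wired interval of that window, by
    [sum_kap_outside]. All comparisons between boxes go through this. *)
Lemma prob_kint_shrink a m l (aml : (a + m <= l)%N) F :
  @prob R Q _ (kint l) F <= @prob R Q _ (kint m)
    [set (retract (shift_ord aml) e.1, retract (shift_ord aml) e.2) | e in F]%SET.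
Proof.
have inj := @shift_ord_inj a m l aml.
apply: prob_kint_contract => // [x' y' xy|x'].
  rewrite kint_some// le_eqVlt; apply/orP; left; apply/eqP; congr kap.
  by rewrite /dist /=; lia.
apply: le_trans (@sum_kap_codom _ l (shift_ord aml) a m x' aml _ _) _ => /=.
- by have := ltn_ord x'; lia.
- move=> j /andP[aj jm]; have jm' : (j - a < m)%N by lia.
  by apply/codomP; exists (Ordinal jm'); apply: val_inj => /=; lia.
by rewrite addr0 addKn; rewrite subnDl.
Qed.

(* Two wired blocks [a, a + m) and [b, b + m), interacting with each other. *)
Definition kblocks (a b m : nat) (e : option ('I_m + 'I_m) * option ('I_m + 'I_m)) : R :=
  match e with
  | (Some (inl i), Some (inl j)) | (Some (inr i), Some (inr j)) => kint m (Some i, Some j)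
  | (Some (inl i), Some (inr j)) => kap (b + j - (a + i))
  | (Some (inl i), None) | (Some (inr i), None) => kint m (Some i, None)
  | _ => 0
  end.

Definition block_site a b m l (am : (a + m <= l)%N) (bm : (b + m <= l)%N)
    (x : 'I_m + 'I_m) : 'I_l :=
  match x with inl i => shift_ord am i | inr i => shift_ord bm i end.

Lemma prob_kint_blocks a b m l (am : (a + m <= l)%N) (bm : (b + m <= l)%N) F :
  (a + m <= b)%N ->
  @prob R Q _ (kint l) F <= @prob R Q _ (@kblocks a b m)
    [set (retract (block_site am bm) e.1, retract (block_site am bm) e.2) | e in F]%SET.
Proof.
move=> amb.
have inj : injective (block_site am bm).
  move=> [i|i] [j|j] /= /(congr1 val) /=.
  - by move/addnI/val_inj ->.
  - by have := ltn_ord i; lia.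
  - by have := ltn_ord j; lia.
  - by move/addnI/val_inj ->.
apply: prob_kint_contract => // [x' y' xy|x'].
  case: x' y' xy => [i|i] [j|j] xy; rewrite [leRHS]/=.
  - rewrite (@kint_some R beta lambda beta0 lambda0)//; rewrite le_eqVlt; apply/orP; left; apply/eqP.
    by congr kap; rewrite /dist /=; lia.
  - rewrite addr0 le_eqVlt; apply/orP; left; apply/eqP; congr kap; rewrite /dist /=.
    by have := ltn_ord i; lia.
  - rewrite add0r le_eqVlt; apply/orP; left; apply/eqP; congr kap; rewrite /dist /=.
    by have := ltn_ord j; lia.
  - rewrite (@kint_some R beta lambda beta0 lambda0)//; rewrite le_eqVlt; apply/orP; left; apply/eqP.
    by congr kap; rewrite /dist /=; lia.
case: x' => i.
  apply: le_trans (@sum_kap_codom _ l (block_site am bm) a m (inl i) am _ _) _ => /=.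
  - by have := ltn_ord i; lia.
  - move=> j /andP[aj jm]; have jm' : (j - a < m)%N by lia.
    by apply/codomP; exists (inl (Ordinal jm')); apply: val_inj => /=; lia.
  by rewrite addr0 addKn subnDl.
apply: le_trans (@sum_kap_codom _ l (block_site am bm) b m (inr i) bm _ _) _ => /=.
- by have := ltn_ord i; lia.
- move=> j /andP[aj jm]; have jm' : (j - b < m)%N by lia.
  by apply/codomP; exists (inr (Ordinal jm')); apply: val_inj => /=; lia.
by rewrite addr0 addKn subnDl.
Qed.

End IntervalComparison.

(** * Near independence of two wired blocks *)

Definition swap (T : eqType) (a b x : T) : T := if x == a then b else if x == b then a else x.

Lemma swapK (T : eqType) (a b : T) : involutive (swap a b).
Proof.
move=> x; rewrite /swap; have [->|xa] := eqVneq x a.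
  by have [->|_] := eqVneq b a; rewrite ?eqxx.
have [->|xb] := eqVneq x b; first by rewrite eqxx.
by rewrite (negPf xa) (negPf xb).
Qed.

Lemma swapL (T : eqType) (a b : T) : swap a b a = b.
Proof. by rewrite /swap eqxx. Qed.

Lemma energy_None0 (R : realType) (Q : nat) (X : finType) (k : option X * option X -> R)
    (s : {ffun X -> 'I_Q.+1}) : (forall v, k (None, v) = 0) ->
  energy k s = \sum_x (k (Some x, None) * (s x == ord0)%:R +
    \sum_y k (Some x, Some y) * (s x == s y)%:R).
Proof.
move=> k0; rewrite /energy sum_pair sum_option [X in X + _]big1 ?add0r.
  by apply: eq_bigr => x _; rewrite sum_option.
by move=> v _; rewrite k0 mul0r.
Qed.

Section BlockDecoupling.
Variables (R : realType) (beta lambda : R) (Q m : nat) (c : 'I_m).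
Hypotheses (beta0 : 0 < beta) (lambda0 : 0 < lambda).
Local Notation kap := (kap beta lambda).
Local Notation kint := (kint beta lambda).
Local Notation G := {ffun 'I_m -> 'I_Q.+1}.
Local Notation p := (@prob R Q _ (kint m) [set (Some c, None)]%SET).

Let w (d : 'I_Q.+1) : R := \sum_(s : G | s c == d) wt (kint m) s.

Lemma wt_recolor (k : option 'I_m * option 'I_m -> R) (u : 'I_Q.+1 -> 'I_Q.+1) (s : G) :
  injective u -> u ord0 = ord0 -> wt k [ffun x => u (s x)] = wt k s.
Proof.
move=> uI u0; rewrite /wt /energy; congr expR; apply: eq_bigr => -[v v'] _.
have e x : ext [ffun x => u (s x)] x = u (ext s x).
  by case: x => [x|] /=; rewrite ?ffunE ?u0.
by rewrite /agree !e (inj_eq uI).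
Qed.

Let w_sym d d' : d != ord0 -> d' != ord0 -> w d = w d'.
Proof.
move=> d0 d0'; rewrite /w.
pose h (s : G) : G := [ffun x => swap d d' (s x)].
have hK : involutive h by move=> s; apply/ffunP => x; rewrite !ffunE swapK.
rewrite (reindex_inj (inv_inj hK)) /=; apply: eq_big => s.
  by rewrite ffunE (can2_eq (@swapK _ d d') (@swapK _ d d')) swapL.
move=> _; rewrite wt_recolor//; first exact: inv_inj (@swapK _ d d').
by rewrite /swap ![ord0 == _]eq_sym (negPf d0) (negPf d0').
Qed.

Let pf0 : 0 < pf Q (kint m). Proof. exact: pf_gt0. Qed.

Let sum_w : \sum_d w d = pf Q (kint m).
Proof. by rewrite /pf (partition_big (fun s : G => s c) xpredT). Qed.

Let w0E : w ord0 = p * pf Q (kint m).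
Proof.
rewrite /prob /ev mulfVK ?gt_eqF// /w big_mkcond; apply: eq_bigr => s _.
by rewrite compat1 /agree /=; case: eqP; rewrite ?mulr1 ?mulr0.
Qed.

Let wE d : (0 < Q)%N -> d != ord0 -> w d = (1 - p) / Q%:R * pf Q (kint m).
Proof.
move=> Q0 d0; have Qr0 : (0 : R) < Q%:R by rewrite ltr0n.
have e : \sum_(d' | d' != ord0) w d' = Q%:R * w d.
  rewrite (eq_bigr (fun=> w d)) => [|d' d'0]; last exact: w_sym.
  by rewrite sumr_const mulr_natl cardC1 card_ord.
have := sum_w; rewrite (bigD1 ord0) //= e w0E => e1.
have -> : w d = (Q%:R * w d) / Q%:R by rewrite mulrC mulKf// gt_eqF.
rewrite [X in X / _](_ : _ = (1 - p) * pf Q (kint m)); last by lra.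
by rewrite mulrAC.
Qed.

Variables (a b : nat).
Hypothesis amb : (a + m <= b)%N.
Local Notation kbl := (@kblocks R beta lambda a b m).
Local Notation G2 := {ffun ('I_m + 'I_m)%type -> 'I_Q.+1}.

Let cross : R := \sum_(i < m) \sum_(j < m) kap (b + j - (a + i)).
Let lft (s : G2) : G := [ffun i => s (inl i)].
Let rgt (s : G2) : G := [ffun i => s (inr i)].
Let join (t : G * G) : G2 := [ffun x => match x with inl i => t.1 i | inr i => t.2 i end].

Lemma sum_sumtype (F : 'I_m + 'I_m -> R) :
  \sum_x F x = \sum_i F (inl i) + \sum_i F (inr i).
Proof. by rewrite big_sumType. Qed.

Let energy_blocks s : energy kbl s = energy (kint m) (lft s) + energy (kint m) (rgt s)
  + \sum_(i < m) \sum_(j < m) kap (b + j - (a + i)) * (s (inl i) == s (inr j))%:R.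
Proof.
rewrite !energy_None0//.
rewrite sum_sumtype [RHS]addrAC; congr (_ + _).
  rewrite -big_split /=; apply: eq_bigr => i _.
  rewrite sum_sumtype /= addrA ffunE; congr (_ + _ + _).
  by apply: eq_bigr => j _; rewrite !ffunE.
apply: eq_bigr => i _; rewrite sum_sumtype /= [X in _ + (X + _)]big1 ?add0r; last first.
  by move=> j _; rewrite mul0r.
by rewrite ffunE; congr (_ + _); apply: eq_bigr => j _; rewrite !ffunE.
Qed.

(** The energy between the blocks lies in [0, cross], so the joint weight is between the product of
    the block weights and [expR cross] times it; the upper bound serves the numerator and the lower
    one the denominator. *)
Lemma ev_blocks_le (phi : 'I_Q.+1 -> 'I_Q.+1 -> R) : (forall x y, 0 <= phi x y) ->
  ev kbl (fun s : G2 => phi (s (inl c)) (s (inr c))) <=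
    expR cross * (\sum_x \sum_y phi x y * (w x * w y)) / pf Q (kint m) ^+ 2.
Proof.
move=> phi0.
have crossb (s : G2) : 0 <= \sum_(i < m) \sum_(j < m)
  kap (b + j - (a + i)) * (s (inl i) == s (inr j))%:R <= cross.
  apply/andP; split.
    by apply: sumr_ge0 => i _; apply: sumr_ge0 => j _; rewrite mulr_ge0// kap_ge0.
  apply: ler_sum => i _; apply: ler_sum => j _.
  by rewrite ler_piMr ?kap_ge0// lern1 leq_b1.
have joinK : cancel join (fun s => (lft s, rgt s)).
  by move=> [s t] /=; congr pair; apply/ffunP => i; rewrite !ffunE.
have splitK : cancel (fun s => (lft s, rgt s)) join.
  by move=> s; apply/ffunP => -[i|i]; rewrite !ffunE.
have bij : {on xpredT, bijective join}.
  by apply: onW_bij; exists (fun s => (lft s, rgt s)).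
have sumE (f : G2 -> R) : \sum_s f s = \sum_s1 \sum_s2 f (join (s1, s2)).
  by rewrite (reindex join bij) sum_pair.
have wtj t : wt (kint m) t.1 * wt (kint m) t.2 <= wt kbl (join t) <=
    expR cross * (wt (kint m) t.1 * wt (kint m) t.2).
  have [e1 e2] : lft (join t) = t.1 /\ rgt (join t) = t.2 by have := joinK t; case: t => ? ? [].
  rewrite /wt energy_blocks e1 e2 -!expRD !ler_expR; have := crossb (join t); lra.
have pf2 : pf Q (kint m) ^+ 2 <= pf Q kbl.
  rewrite /pf sumE expr2 mulr_suml; apply: ler_sum => s1 _; rewrite mulr_sumr.
  by apply: ler_sum => s2 _; have /andP[] := wtj (s1, s2).
have -> : \sum_x \sum_y phi x y * (w x * w y) =
    \sum_(s1 : G) \sum_(s2 : G) (wt (kint m) s1 * wt (kint m) s2) * phi (s1 c) (s2 c).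
  rewrite [RHS](partition_big (fun s : G => s c) xpredT) //=; apply: eq_bigr => x _.
  under [RHS]eq_bigr => s1 _ do rewrite (partition_big (fun s : G => s c) xpredT) //=.
  rewrite [RHS]exchange_big /=; apply: eq_bigr => y _.
  rewrite /w mulr_suml mulr_sumr; apply: eq_bigr => s1 /eqP <-.
  rewrite mulr_sumr mulr_sumr; apply: eq_bigr => s2 /eqP <-.
  by rewrite mulrC.
have N0 : 0 <= expR cross * \sum_(s1 : G) \sum_(s2 : G) (wt (kint m) s1 * wt (kint m) s2) * phi (s1 c) (s2 c).
  apply: mulr_ge0; rewrite ?expR_ge0//; apply: sumr_ge0 => s1 _; apply: sumr_ge0 => s2 _.
  by rewrite !mulr_ge0// ltW// wt_gt0.
apply: le_trans (_ : (expR cross * \sum_(s1 : G) \sum_(s2 : G)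
  (wt (kint m) s1 * wt (kint m) s2) * phi (s1 c) (s2 c)) / pf Q kbl <= _).
  rewrite /ev ler_pM2r ?invr_gt0 ?pf_gt0// sumE mulr_sumr; apply: ler_sum => s1 _.
  rewrite mulr_sumr; apply: ler_sum => s2 _; rewrite mulrA !ffunE /=.
  by apply: ler_wpM2r => //; have /andP[] := wtj (s1, s2).
by apply: ler_wpM2l => //; rewrite lef_pV2 ?posrE ?exprn_gt0 ?pf_gt0.
Qed.

Lemma prob_blocks_both_le :
  @prob R Q _ kbl [set (Some (inl c), None); (Some (inr c), None)]%SET <=
    expR cross * p ^+ 2.
Proof.
pose phi (x y : 'I_Q.+1) : R := ((x == ord0) && (y == ord0))%:R.
have := @ev_blocks_le phi (fun _ _ => ler0n _ _).
have -> : @prob R Q _ kbl [set (Some (inl c), None); (Some (inr c), None)]%SET =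
    ev kbl (fun s : G2 => phi (s (inl c)) (s (inr c))).
  rewrite /prob /ev; congr (_ / _); apply: eq_bigr => s _; congr (_ * _).
  by rewrite compatU !compat1.
move/le_trans; apply.
have -> : \sum_x \sum_y phi x y * (w x * w y) = w ord0 * w ord0.
  rewrite (bigD1 ord0) //= [X in _ + X]big1 ?addr0 => [|x /negPf x0]; last first.
    by rewrite big1// => y _; rewrite /phi x0 mul0r.
  rewrite (bigD1 ord0) //= big1 ?addr0 => [|x /negPf x0].
    by rewrite /phi eqxx mul1r.
  by rewrite /phi x0 andbF mul0r.
rewrite w0E -[leLHS]mulrA ler_pM2l ?expR_gt0//.
by rewrite mulrACA -!expr2 mulfK// expf_neq0// gt_eqF.
Qed.

(** The [Q] colours other than [ord0] share the mass 1 - p equally, hence the sum of squares p^2 + Q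
    ((1 - p) / Q)^2. *)
Lemma prob_blocks_agree_le : (0 < Q)%N ->
  @prob R Q _ kbl [set (Some (inl c), Some (inr c))]%SET <=
    expR cross * (p ^+ 2 + (1 - p) ^+ 2 / Q%:R).
Proof.
move=> Q0.
pose phi (x y : 'I_Q.+1) : R := (x == y)%:R.
have := @ev_blocks_le phi (fun _ _ => ler0n _ _).
have -> : @prob R Q _ kbl [set (Some (inl c), Some (inr c))]%SET =
    ev kbl (fun s : G2 => phi (s (inl c)) (s (inr c))).
  by rewrite /prob /ev; congr (_ / _); apply: eq_bigr => s _; rewrite compat1.
move/le_trans; apply.
have -> : \sum_x \sum_y phi x y * (w x * w y) = \sum_x w x ^+ 2.
  apply: eq_bigr => x _; rewrite (bigD1 x) //= big1 ?addr0 => [|y yx].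
    by rewrite /phi eqxx mul1r.
  by rewrite /phi eq_sym (negPf yx) mul0r.
rewrite -[leLHS]mulrA ler_pM2l ?expR_gt0// (bigD1 ord0) //= w0E.
rewrite (eq_bigr (fun=> ((1 - p) / Q%:R * pf Q (kint m)) ^+ 2)) => [|x x0]; last by rewrite wE.
rewrite sumr_const cardC1 card_ord /= -mulr_natl.
have Qr0 : Q%:R != 0 :> R by rewrite pnatr_eq0 -lt0n.
have pn0 : pf Q (kint m) != 0 by rewrite gt_eqF.
rewrite le_eqVlt; apply/orP; left; apply/eqP; field.
by rewrite pn0 Qr0.
Qed.

End BlockDecoupling.

(** * Finite-volume magnetization and its limit *)

Section Magnetization.
Variables (R : realType) (beta lambda : R) (Q : nat).
Hypotheses (beta0 : 0 < beta) (lambda0 : 0 < lambda) (Q0 : (0 < Q)%N).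
Local Notation kap := (kap beta lambda).
Local Notation kint := (kint beta lambda).
Local Notation prob_site l i := (@prob R Q 'I_l (kint l) [set (Some i, None)]%SET).

Lemma ltn_center L : (L.+1 < L.+1.*2)%N.
Proof. by rewrite -addnn -[X in (X < _)%N]addn0 ltn_add2l. Qed.

(** The origin has index [L.+1] in the box of half-width [L.+1]; the shift by one avoids the empty
    box. *)
Definition center L : 'I_(L.+1.*2) := Ordinal (ltn_center L).

Definition center_prob L : R := prob_site L.+1.*2 (center L).

Let Qr0 : 0 < Q%:R :> R. Proof. by rewrite ltr0n. Qed.

Lemma imset_pair (X X' : finType) (f : option X -> option X') v w :
  [set (f e.1, f e.2) | e in [set (v, w)]]%SET = [set (f v, f w)]%SET.
Proof. by rewrite imset_set1. Qed.

Lemma prob_site_le_center l (i : 'I_l) L : (L < i)%N -> (i + L < l)%N ->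
  prob_site l i <= center_prob L.
Proof.
move=> Li Ll; have h : (i - L.+1 + L.+1.*2 <= l)%N by lia.
apply: le_trans (@prob_kint_shrink R beta lambda Q beta0 lambda0 _ _ _ h _) _.
rewrite imset_pair (_ : Some i = Some (shift_ord h (center L))); last first.
  by congr Some; apply: val_inj => /=; lia.
by rewrite retractK//; exact: shift_ord_inj.
Qed.

Lemma center_le_prob_site l (i : 'I_l) L : (i <= L.+1)%N -> (l <= i + L.+1)%N ->
  center_prob L <= prob_site l i.
Proof.
move=> iL lL; have h : (L.+1 - i + l <= L.+1.*2)%N by have := ltn_ord i; lia.
apply: le_trans (@prob_kint_shrink R beta lambda Q beta0 lambda0 _ _ _ h _) _.
rewrite imset_pair (_ : Some (center L) = Some (shift_ord h i)); last first.
  by congr Some; apply: val_inj => /=; have := ltn_ord i; lia.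
by rewrite retractK//; exact: shift_ord_inj.
Qed.

Lemma center_prob_antitone L L' : (L <= L')%N -> center_prob L' <= center_prob L.
Proof. by move=> LL; apply: prob_site_le_center => /=; lia. Qed.

Lemma prob_le1 (X : finType) (k : option X * option X -> R) F : @prob R Q X k F <= 1.
Proof.
rewrite /prob /ev ler_pdivrMr ?pf_gt0// mul1r; apply: ler_sum => s _.
by rewrite ler_piMr ?(ltW (wt_gt0 _ _))// lern1 leq_b1.
Qed.

Lemma prob_ge0 (X : finType) (k : option X * option X -> R) F : 0 <= @prob R Q X k F.
Proof.
rewrite /prob /ev divr_ge0 ?(ltW (pf_gt0 _ _))//; apply: sumr_ge0 => s _.
by rewrite mulr_ge0// ltW// wt_gt0.
Qed.

Lemma probE1 (X : finType) (k : option X * option X -> R) e :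
  @prob R Q X k [set e]%SET = (\sum_(s : {ffun X -> 'I_Q.+1} | agree e s) wt k s) / pf Q k.
Proof.
rewrite /prob /ev; congr (_ / _); rewrite [RHS]big_mkcond; apply: eq_bigr => s _.
by rewrite compat1; case: ifP; rewrite ?mulr1 ?mulr0.
Qed.

Lemma prob1_ge (X : finType) (k : option X * option X -> R) e :
  (forall e, 0 <= k e) -> 1 <= Q.+1%:R * @prob R Q X k [set e]%SET.
Proof.
move=> k0; rewrite probE1 mulrA ler_pdivlMr ?pf_gt0// mul1r.
exact: pf_le_agree.
Qed.

Let fm := finite_magnetization Q.+1 beta lambda.
Local Notation mag := (magnetization Q.+1 beta lambda).

Let Qm1 : Q.+1%:R - 1 = Q%:R :> R.
Proof. by rewrite -natr1 addrK. Qed.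

Lemma finite_magnetization_center L :
  finite_magnetization Q.+1 beta lambda L.+1 = (Q.+1%:R * center_prob L - 1) / Q%:R.
Proof. by rewrite (@finite_magnetizationE _ _ _ _ _ (center L))// Qm1. Qed.

Let fm_ge0 L : 0 <= fm L.+1.
Proof.
rewrite /fm finite_magnetization_center; apply: divr_ge0; last exact: ltW.
rewrite subr_ge0; apply: prob1_ge => e.
exact: kint_ge0.
Qed.

Let fm_antitone L L' : (L <= L')%N -> fm L'.+1 <= fm L.+1.
Proof.
move=> LL; rewrite /fm !finite_magnetization_center ler_pM2r ?invr_gt0// lerD2r.
by rewrite ler_pM2l ?ltr0n//; exact: center_prob_antitone.
Qed.

Lemma finite_magnetization_cvg :
  (finite_magnetization Q.+1 beta lambda n @[n --> \oo] --> mag)%classic.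
Proof.
have : cvgn (fun n => fm n.+1).
  apply: nonincreasing_is_cvgn; first by move=> m n; exact: fm_antitone.
  by exists 0 => _ [n _ <-]; exact: fm_ge0.
by move=> /cvg_ex[l]; rewrite (cvg_shiftS fm) => h; apply/cvg_ex; exists l.
Qed.

Lemma magnetization_le L : mag <= finite_magnetization Q.+1 beta lambda L.+1.
Proof.
have h : ((fun n => fm n.+1) @ \oo --> mag)%classic.
  by rewrite (cvg_shiftS fm); exact: finite_magnetization_cvg.
rewrite -(cvg_lim _ h)//; apply: limr_le; first by apply/cvg_ex; exists mag.
by exists L => // n /= Ln; exact: fm_antitone.
Qed.

Lemma magnetization_ge (c : R) : (forall L, c <= finite_magnetization Q.+1 beta lambda L.+1) ->
  c <= mag.
Proof.
move=> hc.
have h : ((fun n => fm n.+1) @ \oo --> mag)%classic.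
  by rewrite (cvg_shiftS fm); exact: finite_magnetization_cvg.
rewrite -(cvg_lim _ h)//; apply: limr_ge; first by apply/cvg_ex; exists mag.
by apply: nearW.
Qed.

Lemma magnetization_near e : 0 < e ->
  exists L, finite_magnetization Q.+1 beta lambda L.+1 <= mag + e.
Proof.
move=> e0; have /cvgrPdist_le/(_ _ e0)[L _ hL] := finite_magnetization_cvg.
exists L; have := hL L.+1 (leqnSn L); rewrite distrC => /(le_trans (ler_norm _)).
lra.
Qed.

End Magnetization.

(** * Two-point functions at large distance *)

Section ExpectationTheory.
Variables (R : realType) (Q : nat) (X : finType).
Implicit Types (k : option X * option X -> R) (f g : {ffun X -> 'I_Q.+1} -> R).

Lemma eq_ev k f g : f =1 g -> ev k f = ev k g.
Proof. by move=> fg; rewrite /ev; congr (_ / _); apply: eq_bigr => s _; rewrite fg. Qed.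

Lemma evD k f g : ev k (fun s => f s + g s) = ev k f + ev k g.
Proof.
by rewrite /ev -mulrDl -big_split; congr (_ / _); apply: eq_bigr => s _; rewrite mulrDr.
Qed.

Lemma evZ k c f : ev k (fun s => c * f s) = c * ev k f.
Proof.
rewrite /ev mulrA mulr_sumr; congr (_ / _); apply: eq_bigr => s _.
by rewrite mulrCA.
Qed.

Lemma ev_cst k c : @ev R Q X k (fun=> c) = c.
Proof. by rewrite /ev -mulr_suml mulrAC divff ?mul1r// gt_eqF// pf_gt0. Qed.

Lemma le_ev k f g : (forall s, f s <= g s) -> ev k f <= ev k g.
Proof.
move=> fg; rewrite /ev ler_pM2r ?invr_gt0 ?pf_gt0//; apply: ler_sum => s _.
by rewrite ler_pM2l ?wt_gt0.
Qed.

Lemma ev_sum (I : Type) (r : seq I) (P : pred I) k (F : I -> {ffun X -> 'I_Q.+1} -> R) :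
  ev k (fun s => \sum_(i <- r | P i) F i s) = \sum_(i <- r | P i) ev k (F i).
Proof.
rewrite /ev -mulr_suml exchange_big /=; congr (_ / _); apply: eq_bigr => s _.
by rewrite mulr_sumr.
Qed.

End ExpectationTheory.

Section Correlation.
Variables (R : realType) (beta lambda : R) (Q : nat).
Hypotheses (beta0 : 0 < beta) (lambda0 : 0 < lambda) (Q0 : (0 < Q)%N).
Local Notation kap := (kap beta lambda).
Local Notation kint := (kint beta lambda).
Local Notation m := (magnetization Q.+1 beta lambda).

(** Changes sign under the exchange of [ord0] and [d]. Its sum over [d] is the numerator of the
    magnetization, which is why [mean] and [corr] average over the [Q] colours [d]. *)
Definition contrast (d x : 'I_Q.+1) : R := (x == ord0)%:R - (x == d)%:R.

Let sum_ne0 (x : 'I_Q.+1) : \sum_(d | d != ord0) (x == d)%:R = 1 - (x == ord0)%:R :> R.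
Proof.
have : \sum_d (x == d)%:R = 1 :> R.
  rewrite (bigD1 x) //= eqxx big1 ?addr0// => d dx.
  by rewrite eq_sym (negPf dx).
by rewrite (bigD1 ord0) //=; lra.
Qed.

Lemma sum_contrast x : \sum_(d | d != ord0) contrast d x = Q.+1%:R * (x == ord0)%:R - 1.
Proof.
rewrite sumrB sum_ne0 sumr_const cardC1 card_ord /= -mulr_natl (_ : Q.+1%:R = Q%:R + 1 :> R) ?natr1//; ring.
Qed.

Lemma sum_contrast2 x y : \sum_(d | d != ord0) contrast d x * contrast d y =
  Q.+1%:R * ((x == ord0) && (y == ord0))%:R + (x == y)%:R - (x == ord0)%:R - (y == ord0)%:R.
Proof.
have e d : contrast d x * contrast d y = (x == ord0)%:R * (y == ord0)%:R
    - (x == ord0)%:R * (y == d)%:R - (y == ord0)%:R * (x == d)%:R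
    + (x == y)%:R * (x == d)%:R.
  have -> : (x == y)%:R * (x == d)%:R = (x == d)%:R * (y == d)%:R :> R.
    by have [->|xd] := eqVneq x d; rewrite ?mulr0 ?mul0r// mulr1 mul1r eq_sym.
  by rewrite /contrast; ring.
rewrite (eq_bigr _ (fun d _ => e d)) big_split /= !sumrB -!mulr_sumr !sum_ne0.
rewrite sumr_const cardC1 card_ord /= -[in RHS]mulnb natrM.
rewrite -[(y == ord0)%:R *+ Q]mulr_natl (_ : Q.+1%:R = Q%:R + 1 :> R) ?natr1//.
have -> : (x == y)%:R * (1 - (x == ord0)%:R) = (x == y)%:R - (x == ord0)%:R * (y == ord0)%:R :> R.
  rewrite mulrBr mulr1; congr (_ - _).
  by have [->|xd] := eqVneq x ord0; rewrite ?mulr0 ?mul0r// mulr1 mul1r eq_sym.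
ring.
Qed.

Lemma contrast_le1 d x y : contrast d x * contrast d y <= 1.
Proof. by rewrite /contrast; do !case: eqP => _ /=; rewrite ?mulr0n ?mulr1n; lra. Qed.

Definition corr l (i j : 'I_l) : R := Q%:R^-1 *
  \sum_(d | d != ord0) ev (kint l) (fun s => contrast d (s i) * contrast d (s j)).

Definition mean l (i : 'I_l) : R := Q%:R^-1 *
  \sum_(d | d != ord0) ev (kint l) (fun s => contrast d (s i)).

Let Qr0 : 0 < Q%:R :> R. Proof. by rewrite ltr0n. Qed.

Lemma corr_sym l (i j : 'I_l) : corr i j = corr j i.
Proof.
rewrite /corr; congr (_ * _); apply: eq_bigr => d _.
by apply: eq_ev => s; rewrite mulrC.
Qed.

Lemma corr_le1 l (i j : 'I_l) : corr i j <= 1.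
Proof.
rewrite /corr ler_pdivrMl// mulr1.
apply: (@le_trans _ _ (\sum_(d : 'I_Q.+1 | d != ord0) 1)).
  apply: ler_sum => d _; rewrite -[leRHS](@ev_cst R Q _ (kint l) 1); apply: le_ev => s.
  exact: contrast_le1.
by rewrite sumr_const cardC1 card_ord.
Qed.

(** Only probabilities of agreement remain, for which comparison gives bounds of the right sign:
    upper ones for the two positive terms and lower ones for the subtracted terms. *)
Lemma corrE l (i j : 'I_l) : Q%:R * corr i j =
  Q.+1%:R * @prob R Q _ (kint l) [set (Some i, None); (Some j, None)]%SET
  + @prob R Q _ (kint l) [set (Some i, Some j)]%SET
  - @prob R Q _ (kint l) [set (Some i, None)]%SET
  - @prob R Q _ (kint l) [set (Some j, None)]%SET.
Proof.
rewrite /corr mulrA divff ?mul1r ?gt_eqF// -ev_sum.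
pose ind F (s : {ffun 'I_l -> 'I_Q.+1}) : R := (compat (@agree Q 'I_l) F s)%:R.
transitivity (ev (kint l) (fun s => Q.+1%:R * ind [set (Some i, None); (Some j, None)]%SET s
    + ind [set (Some i, Some j)]%SET s + -1 * ind [set (Some i, None)]%SET s
    + -1 * ind [set (Some j, None)]%SET s)).
  apply: eq_ev => s; rewrite sum_contrast2 /ind compatU !compat1 /agree /=.
  by rewrite !mulN1r.
by rewrite !evD !evZ !mulN1r.
Qed.

Lemma meanE l (i : 'I_l) :
  mean i = (Q.+1%:R * @prob R Q _ (kint l) [set (Some i, None)]%SET - 1) / Q%:R.
Proof.
rewrite /mean mulrC -ev_sum; congr (_ / _).
rewrite (eq_ev _ (fun s => sum_contrast (s i))) evD evZ ev_cst.
by congr (_ * _ - 1); apply: eq_ev => s; rewrite compat1.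
Qed.

Lemma mean_ge l (i : 'I_l) : m <= mean i.
Proof.
apply: le_trans (@magnetization_le R beta lambda Q beta0 lambda0 Q0 l) _.
rewrite meanE finite_magnetization_center// ler_pM2r ?invr_gt0// lerD2r.
by rewrite ler_pM2l ?ltr0n//; apply: center_le_prob_site => //; have := ltn_ord i; lia.
Qed.

Lemma fin_magnetization_le1 L : finite_magnetization Q.+1 beta lambda L.+1 <= 1.
Proof.
rewrite finite_magnetization_center// ler_pdivrMr// mul1r lerBlDr natr1.
by rewrite ler_piMr// prob_le1.
Qed.

Let fit (L N i j l : nat) : (L.+1.*2 + N <= i)%N -> (i + (L.+1.*2 + N) <= j)%N ->
    (j + (L.+1.*2 + N) <= l)%N ->
  [/\ (i - L.+1 + L.+1.*2 <= l)%N, (j - L.+1 + L.+1.*2 <= l)%N,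
      (i - L.+1 + L.+1.*2 <= j - L.+1)%N, (i - L.+1 + L.+1 = i)%N &
      (j - L.+1 + L.+1 = j)%N].
Proof. by move=> h1 h2 h3; split; lia. Qed.

Let fit_dist (L N i j u v : nat) : (L.+1.*2 + N <= i)%N -> (i + (L.+1.*2 + N) <= j)%N ->
  (u < L.+1.*2)%N -> (N < j - L.+1 + v - (i - L.+1 + u))%N.
Proof. lia. Qed.

(** Wiring blocks of half-width [L.+1] around both sites increases the positive terms of [corrE],
    and distant blocks almost decouple. [L] is such that the magnetization mL of a block is within e
    / 8 of m, while [mean_ge] controls the subtracted terms. *)
Lemma corr_far e : 0 <= m -> 0 < e -> exists r : nat, forall l (i j : 'I_l),
  (r <= i)%N -> (i + r <= j)%N -> (j + r <= l)%N -> corr i j <= m ^+ 2 + e.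
Proof.
move=> m0 e0.
have e8 : 0 < e / 8 by lra.
have [L hL] := @magnetization_near R beta lambda Q beta0 lambda0 Q0 _ e8.
have mL_ge := @magnetization_le R beta lambda Q beta0 lambda0 Q0 L.
have mL1 := fin_magnetization_le1 L.
have mLE := @finite_magnetization_center R beta lambda Q beta0 lambda0 L.
set mL := finite_magnetization _ _ _ _ in hL mL_ge mL1 mLE.
pose w := L.+1.*2; pose p := center_prob beta lambda Q L.
rewrite -/p in mLE.
have p0 : 0 <= p by exact: prob_ge0.
have p1 : p <= 1 by exact: prob_le1.
(* Replacing expR cross by 1 costs at most eta times [X], and [X] is at most Q + 2: the error stays
   within e / 2. *)
pose eta : R := e / (2 * (Q%:R + 3)).
have eta0 : 0 < eta by rewrite divr_gt0//; lra.
have ln0 : 0 < ln (1 + eta) by rewrite ln_gt0//; lra.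
have [N N0 SN] : exists2 N, (0 < N)%N & w%:R ^+ 2 * beta / N%:R <= ln (1 + eta).
  pose x := w%:R ^+ 2 * beta / ln (1 + eta).
  have x0 : 0 <= x by rewrite divr_ge0 ?mulr_ge0 ?sqr_ge0// ltW.
  have xN := archi_boundP x0; exists (Num.bound x).
    by rewrite -(ltr0n R) (le_lt_trans x0 xN).
  rewrite ler_pdivrMr ?(le_lt_trans x0 xN)// [leRHS]mulrC -ler_pdivrMr//.
  exact: ltW.
exists (w + N)%N => l i j ri ij jl.
have [ha hb hab iL jL] := fit ri ij jl.
have iE : Some i = Some (block_site ha hb (inl (center L))).
  by congr Some; apply: val_inj; exact: esym iL.
have jE : Some j = Some (block_site ha hb (inr (center L))).
  by congr Some; apply: val_inj; exact: esym jL.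
pose cross : R := \sum_(u < w) \sum_(v < w) kap (j - L.+1 + v - (i - L.+1 + u)).
have cross_le : cross <= ln (1 + eta).
  apply: le_trans SN; apply: (@le_trans _ _ (\sum_(u < w) \sum_(v < w) (beta / N%:R))).
    apply: ler_sum => u _; apply: ler_sum => v _.
    have d2 : (N.+1 <= j - L.+1 + v - (i - L.+1 + u))%N.
      exact: fit_dist ri ij (ltn_ord u).
    move: (_ - _)%N d2 => d d2; have d0 : (0 < d)%N by apply: leq_ltn_trans d2.
    rewrite kapE ifF; last by apply/negbTE; rewrite neq_ltn (leq_trans _ d2) ?orbT.
    rewrite ler_pM2l// lef_pV2 ?posrE ?exprn_gt0 ?ltr0n// -natrX ler_nat.
    by rewrite (leq_trans (ltnW d2))// -mulnn leq_pmulr.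
  rewrite !sumr_const !card_ord -mulrnA -[leLHS]mulr_natl natrM; lra.
have Ecross : expR cross <= 1 + eta.
  apply: (@le_trans _ _ (expR (ln (1 + eta)))); first by rewrite ler_expR.
  by rewrite lnK// posrE; lra.
have inj : injective (block_site ha hb).
  move=> [u|u] [v|v] /= /(congr1 val) /=.
  - by move/addnI/val_inj ->.
  - by move=> e1; have := leq_trans (leq_trans (etrans (ltn_add2l _ _ _) (ltn_ord u)) hab)
      (leq_addr v _); rewrite e1 ltnn.
  - by move=> e1; have := leq_trans (leq_trans (etrans (ltn_add2l _ _ _) (ltn_ord v)) hab)
      (leq_addr u _); rewrite e1 ltnn.
  - by move/addnI/val_inj ->.
have retr x : retract (block_site ha hb) (Some (block_site ha hb x)) = Some x.
  exact: retractK.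
have h1 : @prob R Q _ (kint l) [set (Some i, None); (Some j, None)]%SET <= expR cross * p ^+ 2.
  have hk := @prob_kint_blocks R beta lambda Q beta0 lambda0 _ _ _ _ ha hb
    [set (Some i, None); (Some j, None)]%SET hab.
  rewrite imsetU1 imset_set1 [Some i]iE [Some j]jE !retr in hk; rewrite iE jE.
  apply: le_trans hk _.
  exact: (@prob_blocks_both_le R beta lambda Q _ (center L) beta0 lambda0 _ _).
have h2 : @prob R Q _ (kint l) [set (Some i, Some j)]%SET <=
    expR cross * (p ^+ 2 + (1 - p) ^+ 2 / Q%:R).
  have hk := @prob_kint_blocks R beta lambda Q beta0 lambda0 _ _ _ _ ha hb
    [set (Some i, Some j)]%SET hab.
  rewrite imset_set1 [Some i]iE [Some j]jE !retr in hk; rewrite iE jE.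
  apply: le_trans hk _.
  exact: (@prob_blocks_agree_le R beta lambda Q _ (center L) beta0 lambda0 _ _).
have := mean_ge i; have := mean_ge j; rewrite !meanE !ler_pdivlMr// => h3 h4.
rewrite -(ler_pM2l Qr0) corrE.
set a := @prob _ _ _ _ _ in h1 *; set b := @prob _ _ _ _ _ in h2 *.
set pi := @prob _ _ _ _ _ in h4 *; set pj := @prob _ _ _ _ _ in h3 *.
have qE : Q.+1%:R = Q%:R + 1 :> R by rewrite natr1.
have Q1 : 1 <= Q%:R :> R by rewrite ler1n.
rewrite qE in h3 h4 mLE *; clearbody a b pi pj.
have pE : (Q%:R + 1) * p = Q%:R * mL + 1 by rewrite mLE [Q%:R * _]mulrC divfK ?gt_eqF//; lra.
pose X := (Q%:R + 1) * p ^+ 2 + (p ^+ 2 + (1 - p) ^+ 2 / Q%:R).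
have XE : X = Q%:R * mL ^+ 2 + 2 * p.
  by rewrite /X mLE; field; rewrite gt_eqF.
have p2 : 0 <= p ^+ 2 by exact: sqr_ge0.
have p3 : 0 <= (1 - p) ^+ 2 / Q%:R by rewrite divr_ge0// sqr_ge0.
have h5 : (Q%:R + 1) * a + b <= (1 + eta) * X.
  have : (Q%:R + 1) * a <= (Q%:R + 1) * ((1 + eta) * p ^+ 2).
    by rewrite ler_pM2l; [apply: le_trans h1 _; rewrite ler_wpM2r|lra].
  have : b <= (1 + eta) * (p ^+ 2 + (1 - p) ^+ 2 / Q%:R).
    by apply: le_trans h2 _; rewrite ler_wpM2r// addr_ge0.
  by rewrite /X; lra.
have mL2 : Q%:R * mL ^+ 2 <= Q%:R.
  by rewrite ler_piMr// exprn_ile1// (le_trans m0).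
have h6 : eta * X <= e / 2.
  apply: (@le_trans _ _ (eta * (Q%:R + 3))); first by rewrite ler_pM2l// XE; lra.
  by rewrite /eta le_eqVlt; apply/orP; left; apply/eqP; field; lra.
have h7 : 0 <= Q%:R * ((mL - m) * (2 - (mL + m))).
  by rewrite !mulr_ge0//; lra.
have h8 : 2 * p - pi - pj <= Q%:R * (2 * (mL - m)).
  have h : (Q%:R + 1) * (2 * p - pi - pj) <= Q%:R * (2 * (mL - m)) by lra.
  have [t0|t0] := lerP (2 * p - pi - pj) 0.
    by apply: le_trans t0 _; rewrite !mulr_ge0//; lra.
  by apply: le_trans h; rewrite ler_peMl//; lra.
have h9 : Q%:R * (mL - m) <= Q%:R * (e / 8) by rewrite ler_pM2l//; lra.
have h10 : e / 2 <= Q%:R * (e / 2) by rewrite ler_peMl//; lra.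
clearbody X eta; lra.
Qed.

End Correlation.

(** * Entropy of walls *)

Lemma sum_nat_double (R : nmodType) (f : nat -> R) n :
  \sum_(y < n.*2) f y = \sum_(y < n) (f y.*2 + f y.*2.+1).
Proof.
elim: n => [|n IH]; first by rewrite !big_ord0.
by rewrite doubleS !big_ord_recr /= IH addrA.
Qed.

(* A decision at every node of the binary tree of depth [D] singles out one
   leaf; [t] is raised to the number of levels at which a leaf disagrees. *)
Lemma sum_dyadic_disagreements (R : comNzRingType) (t : R) D (dec : nat -> nat -> bool) :
  \sum_(y < 2 ^ D) \prod_(k < D)
    (if odd (y %/ 2 ^ k)%N != dec k (y %/ 2 ^ k.+1)%N then t else 1) = (1 + t) ^+ D.
Proof.
elim: D dec => [|D IH] dec; first by rewrite expn0 big_ord1 big_ord0.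
rewrite expnSr muln2 (sum_nat_double (fun y => \prod_(k < D.+1)
  (if odd (y %/ 2 ^ k)%N != dec k (y %/ 2 ^ k.+1)%N then t else 1))).
rewrite exprSr -(IH (fun k => dec k.+1)) mulr_suml; apply: eq_bigr => y _.
rewrite !big_ord_recl /= !expn0 !divn1 expn1 /= odd_double.
have e b k : ((b + y.*2) %/ 2 ^ k.+1 = ((b + y.*2) %/ 2) %/ 2 ^ k)%N.
  by rewrite expnS divnMA.
have h0 : (y.*2 %/ 2 = y)%N by rewrite -muln2 mulnK.
have h1 : (y.*2.+1 %/ 2 = y)%N by rewrite divn2 /= uphalf_double.
have E0 : \prod_(i < D)
  (if odd (y.*2 %/ 2 ^ bump 0 i)%N != dec (bump 0 i) (y.*2 %/ 2 ^ (bump 0 i).+1)%N then t else 1)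
   = \prod_(i < D) (if odd (y %/ 2 ^ i)%N != dec i.+1 (y %/ 2 ^ i.+1)%N then t else 1).
  by apply: eq_bigr => i _; rewrite /bump /= add1n !(e 0) h0.
have E1 : \prod_(i < D)
  (if odd (y.*2.+1 %/ 2 ^ bump 0 i)%N != dec (bump 0 i) (y.*2.+1 %/ 2 ^ (bump 0 i).+1)%N then t else 1)
   = \prod_(i < D) (if odd (y %/ 2 ^ i)%N != dec i.+1 (y %/ 2 ^ i.+1)%N then t else 1).
  by apply: eq_bigr => i _; rewrite /bump /= add1n -add1n !(e 1%N) add1n h1.
rewrite E0 E1 h0 h1 -mulrDl mulrC; congr (_ * _).
by case: (dec 0 y) => /=; rewrite addrC.
Qed.

Lemma sum_nat_modn (R : pzSemiRingType) (h : nat -> R) a l : (0 < l)%N ->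
  \sum_(y < a * l) h (y %% l)%N = a%:R * \sum_(z < l) h z.
Proof.
move=> l0; elim: a => [|a IH]; first by rewrite mul0n big_ord0 mul0r.
rewrite mulSn addnC big_split_ord /= IH -natr1 mulrDl mul1r; congr (_ + _).
by apply: eq_bigr => z _; rewrite modnMDl modn_small.
Qed.

Lemma sum_nat_interval_le (N p p' : nat) :
  (\sum_(z < N) (p <= z < p') <= minn N p' - p)%N.
Proof.
elim: N => [|N IH]; first by rewrite big_ord0.
rewrite big_ord_recr /=; apply: leq_trans (leq_add IH (leqnn _)) _.
case: (boolP (p <= N < p')%N) => /=; lia.
Qed.

Lemma harmonic_le (R : realType) n : \sum_(k < n.+1) (k.+1%:R : R)^-1 <= 1 + ln n.+1%:R.
Proof.
elim: n => [|n IH]; first by rewrite big_ord1 ln1 addr0 invr1.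
rewrite big_ord_recr /=; apply: le_trans (lerD IH (lexx _)) _.
rewrite -addrA lerD2l -lerBrDl; set x : R := n.+2%:R^-1.
have x0 : 0 < x by rewrite invr_gt0 ltr0n.
have x1 : x < 1 by rewrite invf_lt1 ?ltr0n// ltr1n.
have e : n.+1%:R = n.+2%:R * (1 - x) :> R.
  by rewrite mulrBr mulr1 mulfV ?pnatr_eq0// -[n.+2%:R]natr1 addrK.
rewrite e lnM ?posrE ?ltr0n//; last by lra.
have := @le_ln1Dx R (- x); lra.
Qed.

(** * Domain walls *)

Section DomainWall.
Variables (R : realType) (beta lambda : R) (Q A : nat).
Hypotheses (beta0 : 0 < beta) (lambda0 : 0 < lambda).
Local Notation kap := (kap beta lambda).
Local Notation tail := (tail beta lambda).
Local Notation kint := (kint beta lambda).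
Local Notation G := {ffun 'I_A -> 'I_Q.+1}.
Local Notation contrast := (@contrast R Q).
Implicit Types (s : G) (d : 'I_Q.+1).

(* Energy with colour [ord0] on the left of the interval and [d] on the right. *)
Definition wall_energy d s : R :=
  \sum_(i : 'I_A) (tail i.+1 * (s i == ord0)%:R + tail (A - i) * (s i == d)%:R +
    \sum_(j : 'I_A) (if (i < j)%N then kap (j - i) else 0) * (s i == s j)%:R).

Lemma wall_energy0 s : wall_energy ord0 s = energy (kint A) s.
Proof.
rewrite energy_None0//; apply: eq_bigr => i _; congr (_ + _).
by rewrite mulrDl.
Qed.

(** The right half-line becomes a vertex [Some None] of its own, while the left one stays the pinned
    [None]; the colour [d] on the right is then the value of a spin. *)
Definition kwall (e : option (option 'I_A) * option (option 'I_A)) : R :=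
  match e with
  | (Some (Some i), Some (Some j)) => if (i < j)%N then kap (j - i) else 0
  | (Some (Some i), None) => tail i.+1
  | (Some (Some i), Some None) => tail (A - i)
  | _ => 0
  end.

Let extd d s : {ffun option 'I_A -> 'I_Q.+1} := [ffun v => if v is Some i then s i else d].

Let energy_extd d s : energy kwall (extd d s) = wall_energy d s.
Proof.
rewrite energy_None0// sum_option mul0r add0r big1 ?add0r => [|v _]; last by rewrite mul0r.
apply: eq_bigr => i _; rewrite sum_option /= addrA !ffunE; congr (_ + _).
by apply: eq_bigr => j _; rewrite !ffunE.
Qed.

(** Among the possible differences of colour between the two half-lines, 0 carries the largest
    weight, by [le_sum_wt_fiber]. *)
Lemma sum_wall_le d : \sum_s expR (wall_energy d s) <= pf Q (kint A).
Proof.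
have k0 e : 0 <= kwall e.
  case: e => [[[i|]|] [[j|]|]] //=; rewrite ?tail_ge0//.
  by case: ifP => // _; exact: kap_ge0.
have E c : \sum_s expR (wall_energy c s) =
    \sum_(s2 : {ffun option 'I_A -> 'I_Q.+1} | s2 None == c) wt kwall s2.
  pose res (s2 : {ffun option 'I_A -> 'I_Q.+1}) : G := [ffun i => s2 (Some i)].
  rewrite (reindex_onto (extd c) res) /=; last first.
    by move=> s2 /eqP e; apply/ffunP => -[i|]; rewrite !ffunE// e.
  apply: eq_big => [s|s _]; last by rewrite /wt energy_extd.
  rewrite ffunE eqxx /=; apply/esym/eqP/ffunP => i; rewrite !ffunE.
  by [].
have -> : pf Q (kint A) = \sum_s expR (wall_energy ord0 s).
  by apply: eq_bigr => s _; rewrite wall_energy0.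
rewrite !E; have := @le_sum_wt_fiber R Q _ kwall (Some None) None d k0.
by under eq_bigl => s2 do rewrite /= subr0.
Qed.

Definition flip (x : nat) d s : G := [ffun i : 'I_A => if (i < x)%N then s i else swap ord0 d (s i)].

Lemma flipK x d : involutive (flip x d).
Proof. by move=> s; apply/ffunP => i; rewrite !ffunE; case: (i < x)%N => //; rewrite swapK. Qed.

(** Energy lost when colours are exchanged to the right of [x], boundary included. A pair across the
    wall loses 1{a = b} - 1{a = swap b}, the product of its contrasts; the last two sums are the
    pairs with one endpoint in a half-line of the boundary, where the contrast is 1. *)
Definition wall_cost x d s : R :=
  \sum_(i : 'I_A | (i < x)%N) \sum_(j : 'I_A | (x <= j)%N)
    kap (j - i) * (contrast d (s i) * contrast d (s j))
  + \sum_(i : 'I_A | (i < x)%N) tail (A - i) * contrast d (s i)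
  + \sum_(j : 'I_A | (x <= j)%N) tail j.+1 * contrast d (s j).

Lemma eq_swap_contrast d (a b : 'I_Q.+1) : d != ord0 ->
  (a == swap ord0 d b)%:R = (a == b)%:R - contrast d a * contrast d b.
Proof.
move=> d0; rewrite /contrast /swap.
have [->|b0] := eqVneq b ord0.
  by rewrite [ord0 == d]eq_sym (negPf d0) /= subr0 mulr1 opprB addrC subrK.
have [->|bd] := eqVneq b d; first by rewrite sub0r mulrN1 opprK addrC subrK.
by rewrite subr0 mulr0 subr0.
Qed.

Lemma contrast_swap d a : d != ord0 -> contrast d (swap ord0 d a) = - contrast d a.
Proof.
move=> d0; have d0' : (ord0 == d) = false by rewrite eq_sym (negPf d0).
rewrite /contrast /swap.
have [/eqP ->|a0] := boolP (a == ord0).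
  by rewrite !eqxx (negPf d0) d0'; lra.
have [_|ad] := boolP (a == d); first by rewrite ?eqxx ?d0' /=; lra.
by rewrite ?(negPf a0) ?(negPf ad) /=; lra.
Qed.

Lemma wall_energy_flip x d s : d != ord0 ->
  wall_energy d (flip x d s) = wall_energy ord0 s - wall_cost x d s.
Proof.
move=> d0.
suff : wall_energy ord0 s - wall_energy d (flip x d s) = wall_cost x d s by lra.
rewrite /wall_energy -sumrB /wall_cost.
rewrite [X in _ = X + _ + _]big_mkcond [X in _ = _ + X + _]big_mkcond [X in _ = _ + _ + X]big_mkcond.
rewrite -!big_split /=; apply: eq_bigr => i _.
rewrite -[RHS]addrA [RHS]addrC opprD addrACA -sumrB; congr (_ + _); last first.
  case: ifPn => ix.
    rewrite [RHS]big_mkcond; apply: eq_bigr => j _; rewrite !ffunE ix.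
    case: (leqP x j) => xj; last by rewrite subrr.
    have -> : (i < j)%N by exact: leq_trans ix xj.
    by rewrite eq_swap_contrast// -mulrBr opprB addrC subrK.
  rewrite big1// => j _; rewrite !ffunE (negPf ix).
  case: ifPn => ij; last by rewrite !mul0r subrr.
  have -> : (j < x)%N = false by apply/negbTE; rewrite -leqNgt (leq_trans _ (ltnW ij))// leqNgt.
  by rewrite (inj_eq (inv_inj (@swapK _ ord0 d))) subrr.
rewrite ffunE; case: ifPn => ix.
  by rewrite leqNgt ix /= addr0 /contrast; lra.
rewrite leqNgt ix /= add0r /contrast.
rewrite (_ : (swap ord0 d (s i) == ord0) = (s i == d)); last first.
  by rewrite (can2_eq (@swapK _ ord0 d) (@swapK _ ord0 d)) swapL.
rewrite (_ : (swap ord0 d (s i) == d) = (s i == ord0)); last first.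
  by rewrite -(inj_eq (inv_inj (@swapK _ ord0 d)) (s i)) swapL.
lra.
Qed.

End DomainWall.

(** * Mean energy of a wall *)

Section WallCost.
Variables (R : realType) (beta lambda : R) (Q : nat).
Hypotheses (beta0 : 0 < beta) (lambda0 : 0 < lambda) (Q0 : (0 < Q)%N).
Local Notation kap := (kap beta lambda).
Local Notation tail := (tail beta lambda).
Local Notation kint := (kint beta lambda).
Local Notation m := (magnetization Q.+1 beta lambda).
Local Notation corr := (@corr R beta lambda Q _).
Local Notation mean := (@mean R beta lambda Q _).

Definition avg_cost A x : R :=
  Q%:R^-1 * \sum_(d : 'I_Q.+1 | d != ord0) ev (kint A) (wall_cost beta lambda x d).

Let Qr0 : 0 < Q%:R :> R. Proof. by rewrite ltr0n. Qed.

Lemma avg_costE A x : avg_cost A x =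
  \sum_(i : 'I_A | (i < x)%N) \sum_(j : 'I_A | (x <= j)%N) kap (j - i) * corr i j
  + \sum_(i : 'I_A | (i < x)%N) tail (A - i) * mean i
  + \sum_(j : 'I_A | (x <= j)%N) tail j.+1 * mean j.
Proof.
rewrite /avg_cost.
have e (d : 'I_Q.+1) : ev (kint A) (wall_cost beta lambda x d) =
    \sum_(i : 'I_A | (i < x)%N) \sum_(j : 'I_A | (x <= j)%N)
      kap (j - i) * ev (kint A) (fun s => contrast R d (s i) * contrast R d (s j))
    + \sum_(i : 'I_A | (i < x)%N) tail (A - i) * ev (kint A) (fun s => contrast R d (s i))
    + \sum_(j : 'I_A | (x <= j)%N) tail j.+1 * ev (kint A) (fun s => contrast R d (s j)).
  rewrite /wall_cost !evD !ev_sum; congr (_ + _ + _).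
  - by apply: eq_bigr => i _; rewrite ev_sum; apply: eq_bigr => j _; rewrite evZ.
  - by apply: eq_bigr => i _; rewrite evZ.
  - by apply: eq_bigr => i _; rewrite evZ.
rewrite (eq_bigr _ (fun d _ => e d)) !big_split /= !mulrDr; congr (_ + _ + _).
- rewrite exchange_big mulr_sumr; apply: eq_bigr => i _.
  rewrite exchange_big mulr_sumr; apply: eq_bigr => j _.
  by rewrite -mulr_sumr mulrCA.
- by rewrite exchange_big mulr_sumr; apply: eq_bigr => i _; rewrite -mulr_sumr mulrCA.
- by rewrite exchange_big mulr_sumr; apply: eq_bigr => i _; rewrite -mulr_sumr mulrCA.
Qed.

Lemma mean_le1 A (i : 'I_A) : mean i <= 1.
Proof.
rewrite meanE// ler_pdivrMr// mul1r lerBlDr natr1.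
by rewrite ler_piMr// prob_le1.
Qed.

Lemma tail_le1 k : (0 < k)%N -> tail k <= tail 1.
Proof.
move=> k0; rewrite (@tail_split R beta lambda beta0 lambda0 1 k)// lerDr.
by apply: sumr_ge0 => n _; exact: kap_ge0.
Qed.

Lemma row_sum_le A x (i : nat) : (i < x)%N ->
  \sum_(j : 'I_A | (x <= j)%N) kap (j - i) <= tail (x - i).
Proof.
move=> ix; rewrite -(big_mkord (fun j => (x <= j)%N) (fun j => kap (j - i))).
have [xA|Ax] := leqP x A; last first.
  rewrite big_nat_cond big1 ?tail_ge0// => j /andP[/andP[_ jA]].
  by rewrite leqNgt (ltn_trans jA Ax).
rewrite (@big_cat_nat _ _ _ x) //= big_nat_cond big1 ?add0r; last first.
  by move=> j /andP[/andP[_ jx]]; rewrite leqNgt jx.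
rewrite -(@sum_kap_right R beta lambda beta0 lambda0 x A)// big_nat_cond [X in _ <= X + _]big_nat_cond.
rewrite [leLHS](eq_bigl (fun j => (x <= j < A)%N && true)); last first.
  by move=> j; rewrite andbT; case: (x <= j)%N; rewrite ?andbT.
by rewrite lerDl tail_ge0.
Qed.

Lemma sum_ord_lt_le A x (f : nat -> R) : (forall i, 0 <= f i) ->
  \sum_(i : 'I_A | (i < x)%N) f i <= \sum_(0 <= i < x) f i.
Proof.
move=> f0; rewrite big_mkord; have [xA|Ax] := leqP x A.
  by rewrite (big_ord_widen A f).
rewrite (eq_bigl xpredT) => [|i]; last by rewrite (ltn_trans (ltn_ord i)).
rewrite -(subnKC (ltnW Ax)) big_split_ord /= lerDl; exact: sumr_ge0.
Qed.

Lemma column_sum_le A x (j : nat) : (x <= j)%N ->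
  \sum_(i : 'I_A | (i < x)%N) kap (j - i) <= tail 1.
Proof.
move=> xj; apply: le_trans (@sum_ord_lt_le A x (fun i => kap (j - i)) _) _.
  by move=> i; exact: kap_ge0.
apply: (@le_trans _ _ (tail (j - x).+1)); last exact: tail_le1.
by rewrite -(@sum_kap_left R beta lambda beta0 lambda0 x j)// lerDl tail_ge0.
Qed.

(** Bounds the total coupling across a wall: the tail from distance k + 1 is at most beta / k, and
    the harmonic sum is the origin of the beta ln n in the energy. *)
Lemma sum_tail_le x : (0 < x)%N ->
  \sum_(0 <= i < x) tail (x - i) <= tail 1 + beta * (1 + ln x%:R).
Proof.
move=> x0; have -> : \sum_(0 <= i < x) tail (x - i) = \sum_(0 <= i < x) tail i.+1.
  rewrite big_nat_rev /= !big_mkord; apply: eq_bigr => i _.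
  by rewrite add0n subKn// ltn_ord.
case: x x0 => // -[|x] _.
  by rewrite big_nat1 lerDl ln1 addr0 mulr1 ltW.
rewrite big_nat_recl//= lerD2l; apply: (@le_trans _ _ (\sum_(0 <= i < x.+1) beta / i.+1%:R)).
  by apply: ler_sum => i _; exact: tail_le.
rewrite -mulr_sumr ler_pM2l// big_mkord; apply: le_trans (harmonic_le R x) _.
by rewrite lerD2l ler_ln ?posrE ?ltr0n// ler_nat.
Qed.

Lemma count_ord_le A (C : pred 'I_A) (P : pred nat) p p' :
  (forall z, P z -> (p <= z < p')%N) ->
  \sum_(i | C i) (P i)%:R <= (p' - p)%:R :> R.
Proof.
move=> PP; apply: (@le_trans _ _ (\sum_(i < A) (p <= i < p')%N%:R)).
  rewrite big_mkcond; apply: ler_sum => i _; case: ifP => // _.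
  by case: (boolP (P i)) => [/PP ->|_].
rewrite -natr_sum ler_nat; apply: leq_trans (sum_nat_interval_le _ _ _) _.
by rewrite leq_sub2r// geq_minr.
Qed.

Let three_mul n : (n + n.*2 = 3 * n)%N. Proof. lia. Qed.

Let near_window x z r : (z < x)%N -> (x < z + r)%N -> (x - r <= z < x - r + r)%N.
Proof. lia. Qed.

Let right_margin n x i : (i < x)%N -> (x < n.*2)%N -> (n < n + n.*2 - i)%N.
Proof. lia. Qed.

Section CostBound.
Variables (e : R) (r : nat).
Hypothesis e0 : 0 <= m ^+ 2 + e.
Hypothesis far : forall l (i j : 'I_l),
  (r <= i)%N -> (i + r <= j)%N -> (j + r <= l)%N -> corr i j <= m ^+ 2 + e.

(** Distant pairs across the wall are weighted by m^2 + e, which gives the leading logarithm. The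
    bound 1 is used only when the left site is within [r] of the wall or of the left end, or the
    right site within [r] of the right end: three strips of at most [r] sites, each of coupling at
    most tail 1. Boundary terms involve 3 n sites and tails of at most beta / n, as the wall is far
    from both ends. *)
Lemma avg_cost_le n x : (0 < n)%N -> (n <= x < n.*2)%N ->
  avg_cost (n + n.*2) x <= (m ^+ 2 + e) * (beta * ln n%:R) +
    ((m ^+ 2 + e) * (tail 1 + beta * (1 + ln 2)) + 3 * (r%:R * tail 1) + 6 * beta).
Proof.
move=> n0 /andP[nx xn]; set A := (n + n.*2)%N.
have T0 : 0 <= tail 1 by exact: tail_ge0.
have x0 : (0 < x)%N by exact: leq_trans n0 nx.
pose far_ (i j : nat) : R := m ^+ 2 + e + ((x < i + r)%N)%:R + ((i < r)%N)%:R + ((A < j + r)%N)%:R.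
have corr_le (i j : 'I_A) : (i < x)%N -> (x <= j)%N -> corr i j <= far_ i j.
  move=> ix xj; rewrite /far_.
  have c1 := corr_le1 beta lambda Q0 i j.
  have p1 := ler0n R (i < r)%N; have p2 := ler0n R (A < j + r)%N.
  have [_|h1] := ltnP x (i + r).
    by apply: le_trans c1 _; do 2!apply: ler_wpDr => //; rewrite lerDr.
  have [_|h2] := ltnP i r.
    by apply: le_trans c1 _; apply: ler_wpDr => //; rewrite lerDr; apply: addr_ge0.
  have [_|h3] := ltnP A (j + r).
    by apply: le_trans c1 _; rewrite lerDr; do 2!apply: addr_ge0 => //.
  by rewrite !addr0; apply: far => //; apply: leq_trans h1 _.
have rows : \sum_(i : 'I_A | (i < x)%N) \sum_(j : 'I_A | (x <= j)%N) kap (j - i) <=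
    tail 1 + beta * (1 + ln x%:R).
  apply: le_trans (sum_tail_le x0).
  apply: (@le_trans _ _ (\sum_(i : 'I_A | (i < x)%N) tail (x - i))).
    by apply: ler_sum => i ix; exact: row_sum_le.
  by apply: sum_ord_lt_le => i; exact: tail_ge0.
have lnx : ln x%:R <= ln 2 + ln n%:R :> R.
  rewrite -lnM ?posrE ?ltr0n// ler_ln ?posrE ?mulr_gt0 ?ltr0n//.
  by rewrite -natrM ler_nat mul2n ltnW.
have b1 : \sum_(i : 'I_A | (i < x)%N) \sum_(j : 'I_A | (x <= j)%N) kap (j - i) * (m ^+ 2 + e) <=
    (m ^+ 2 + e) * (tail 1 + beta * (1 + (ln 2 + ln n%:R))).
  under eq_bigr do rewrite -mulr_suml; rewrite -mulr_suml mulrC ler_wpM2l//.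
  by apply: le_trans rows _; rewrite lerD2l ler_pM2l// lerD2l.
have row_count (P : pred nat) p : (forall z, (z < x)%N -> P z -> (p <= z < p + r)%N) ->
    \sum_(i : 'I_A | (i < x)%N) \sum_(j : 'I_A | (x <= j)%N) kap (j - i) * (P i)%:R <= r%:R * tail 1.
  move=> PP; apply: (@le_trans _ _ (\sum_(i : 'I_A | (i < x)%N) ((i < x)%N && P i)%:R * tail 1)).
    apply: ler_sum => i ix; rewrite -mulr_suml ix mulrC ler_wpM2l//.
    by apply: le_trans (row_sum_le A ix) _; apply: tail_le1; rewrite subn_gt0.
  rewrite -mulr_suml ler_wpM2r//.
  apply: le_trans (@count_ord_le A _ (fun i => (i < x)%N && P i) p (p + r) _) _.
    by move=> z /andP[zx Pz]; exact: PP.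
  by rewrite addKn.
have b2 : \sum_(i : 'I_A | (i < x)%N) \sum_(j : 'I_A | (x <= j)%N) kap (j - i) * ((x < i + r)%N)%:R <=
    r%:R * tail 1.
  by apply: (row_count (fun i => (x < i + r)%N) (x - r)%N) => z zx zr; exact: near_window.
have b3 : \sum_(i : 'I_A | (i < x)%N) \sum_(j : 'I_A | (x <= j)%N) kap (j - i) * ((i < r)%N)%:R <=
    r%:R * tail 1.
  by apply: (row_count (fun i => (i < r)%N) 0) => z _ zr.
have b4 : \sum_(i : 'I_A | (i < x)%N) \sum_(j : 'I_A | (x <= j)%N) kap (j - i) * ((A < j + r)%N)%:R <=
    r%:R * tail 1.
  rewrite exchange_big /=.
  apply: (@le_trans _ _ (\sum_(j : 'I_A | (x <= j)%N) ((j < A)%N && (A < j + r)%N)%:R * tail 1)).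
    apply: ler_sum => j xj; rewrite -mulr_suml ltn_ord mulrC ler_wpM2l//.
    exact: column_sum_le.
  rewrite -mulr_suml ler_wpM2r//.
  apply: le_trans (@count_ord_le A _ (fun j => (j < A)%N && (A < j + r)%N) (A - r) A _) _.
    by move=> z /andP[zA zr]; rewrite zA andbT leq_subLR addnC ltnW.
  by rewrite ler_nat leq_subLR addnC -leq_subLR.
have c1 : \sum_(i : 'I_A | (i < x)%N) \sum_(j : 'I_A | (x <= j)%N) kap (j - i) * corr i j <=
    (m ^+ 2 + e) * (tail 1 + beta * (1 + (ln 2 + ln n%:R))) + r%:R * tail 1 + r%:R * tail 1 + r%:R * tail 1.
  apply: le_trans (lerD (lerD (lerD b1 b2) b3) b4).
  rewrite -!big_split /=; apply: ler_sum => i ix.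
  rewrite -!big_split /=; apply: ler_sum => j xj.
  by rewrite -!mulrDr ler_wpM2l ?kap_ge0//; exact: corr_le.
have tn (P : pred 'I_A) (f : 'I_A -> nat) : (forall i, P i -> (n < f i)%N) ->
    \sum_(i | P i) tail (f i) * mean i <= 3 * beta.
  move=> fP; apply: (@le_trans _ _ (\sum_(i < A) beta / n%:R)).
    rewrite big_mkcond; apply: ler_sum => i _; case: ifPn => Pi; last by rewrite divr_ge0// ltW.
    apply: (@le_trans _ _ (tail (f i))); first by rewrite ler_piMr ?tail_ge0// mean_le1.
    have := fP _ Pi; case: (f i) => // k; rewrite ltnS => nk.
    apply: le_trans (@tail_le R beta lambda beta0 lambda0 k (leq_trans n0 nk)) _.
    by rewrite ler_pM2l// lef_pV2 ?posrE ?ltr0n ?ler_nat//; exact: leq_trans n0 nk.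
  rewrite sumr_const card_ord -[leLHS]mulr_natl [X in X * _](_ : _ = 3 * n%:R); last first.
    by rewrite -natrM -(three_mul n).
  by rewrite -mulrA [n%:R * _]mulrC divfK// pnatr_eq0 -lt0n.
have c2 : \sum_(i : 'I_A | (i < x)%N) tail (A - i) * mean i <= 3 * beta.
  by apply: tn => i ix; exact: right_margin ix xn.
have c3 : \sum_(j : 'I_A | (x <= j)%N) tail j.+1 * mean j <= 3 * beta.
  by apply: tn => i xi; rewrite ltnS (leq_trans nx).
rewrite avg_costE; apply: le_trans (lerD (lerD c1 c2) c3) _.
rewrite le_eqVlt; apply/orP; left; apply/eqP; ring.
Qed.

End CostBound.
End WallCost.

Lemma big_ord_window (R : nmodType) A p p' (f : nat -> R) : (p <= p')%N -> (p' <= A)%N ->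
  \sum_(i : 'I_A | (p <= i < p')%N) f i = \sum_(p <= i < p') f i.
Proof.
move=> pp pA; rewrite -(big_mkord (fun i => (p <= i < p')%N) f).
rewrite (@big_cat_nat _ _ _ p') //= (@big_cat_nat _ _ _ p 0 p') //=.
rewrite [X in X + _ + _]big_nat_cond [X in X + _ + _]big1 ?add0r; last first.
  by move=> i /andP[/andP[_ ip]]; rewrite leqNgt ip.
rewrite [X in _ + X]big_nat_cond [X in _ + X]big1 ?addr0; last first.
  by move=> i /andP[/andP[pi _]]; rewrite [(i < p')%N]ltnNge pi andbF.
rewrite big_nat_cond [RHS]big_nat_cond; apply: eq_bigl => i.
by case: (p <= i < p')%N.
Qed.

(** * Recovery of the wall from the spins *)

Section TreeDecisions.
Let window_width i r : (i + r - (i - r) <= 2 * r)%N.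
Proof. lia. Qed.

Variables (R : realType) (beta lambda : R) (Q : nat).
Hypotheses (beta0 : 0 < beta) (lambda0 : 0 < lambda) (Q0 : (0 < Q)%N).
Local Notation kint := (kint beta lambda).
Local Notation m := (magnetization Q.+1 beta lambda).
Local Notation corr := (@corr R beta lambda Q _).
Local Notation mean := (@mean R beta lambda Q _).
Local Notation contrast := (@contrast R Q).

Let Qr0 : 0 < Q%:R :> R. Proof. by rewrite ltr0n. Qed.

Variables (e : R) (r : nat).
Hypothesis m0 : 0 < m.
Hypothesis e0 : 0 < e.
Hypothesis far : forall l (i j : 'I_l),
  (r <= i)%N -> (i + r <= j)%N -> (j + r <= l)%N -> corr i j <= m ^+ 2 + e.

Definition avg A (f : 'I_Q.+1 -> {ffun 'I_A -> 'I_Q.+1} -> R) : R :=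
  Q%:R^-1 * \sum_(d | d != ord0) ev (kint A) (f d).

Lemma le_avg A (f g : 'I_Q.+1 -> {ffun 'I_A -> 'I_Q.+1} -> R) :
  (forall d s, d != ord0 -> f d s <= g d s) -> avg f <= avg g.
Proof.
move=> fg; rewrite /avg ler_pM2l ?invr_gt0//; apply: ler_sum => d d0.
by apply: le_ev => s; exact: fg.
Qed.

Lemma avgD A (f g : 'I_Q.+1 -> {ffun 'I_A -> 'I_Q.+1} -> R) :
  avg (fun d s => f d s + g d s) = avg f + avg g.
Proof. by rewrite /avg (eq_bigr _ (fun d _ => evD (kint A) (f d) (g d))) big_split mulrDr. Qed.

Lemma avgZ A c (f : 'I_Q.+1 -> {ffun 'I_A -> 'I_Q.+1} -> R) :
  avg (fun d s => c * f d s) = c * avg f.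
Proof. by rewrite /avg (eq_bigr _ (fun d _ => evZ (kint A) c (f d))) -mulr_sumr mulrCA. Qed.

Lemma avg_cst A c : avg (A := A) (fun _ _ => c) = c.
Proof.
rewrite /avg; under eq_bigr do rewrite ev_cst.
by rewrite sumr_const cardC1 card_ord -[c *+ _]mulr_natl mulKf// gt_eqF.
Qed.

Lemma avg_sum A (I : Type) (l : seq I) (P : pred I)
    (F : I -> 'I_Q.+1 -> {ffun 'I_A -> 'I_Q.+1} -> R) :
  avg (fun d s => \sum_(i <- l | P i) F i d s) = \sum_(i <- l | P i) avg (F i).
Proof.
rewrite /avg; under eq_bigr do rewrite ev_sum.
by rewrite exchange_big mulr_sumr.
Qed.

(** By [mean_ge] a pair contributes at most corr - m^2, hence at most e if its sites are far apart;
    each site has at most 2 r near ones, for which corr is at most 1. *)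
Lemma avg_variance_le n l (P : pred 'I_(n + n.*2)) : (r <= n)%N ->
  (forall i, P i -> (n <= i < n.*2)%N) -> \sum_(i | P i) 1 <= l%:R :> R ->
  avg (fun d s => (\sum_(i | P i) (contrast d (s i) - m)) ^+ 2) <=
    e * l%:R ^+ 2 + 2 * r%:R * l%:R.
Proof.
move=> rn Pn Pl.
have -> : avg (fun d s => (\sum_(i | P i) (contrast d (s i) - m)) ^+ 2) =
    \sum_(i | P i) \sum_(j | P j) (corr i j + ((- m) * mean i + ((- m) * mean j + m ^+ 2))).
  transitivity (avg (fun d (s : {ffun 'I_(n + n.*2) -> 'I_Q.+1}) =>
    \sum_(i | P i) \sum_(j | P j) (contrast d (s i) * contrast d (s j) +
      ((- m) * contrast d (s i) + ((- m) * contrast d (s j) + m ^+ 2))))).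
    rewrite /avg; congr (_ * _); apply: eq_bigr => d _; apply: eq_ev => s.
    rewrite expr2 mulr_suml; apply: eq_bigr => i _; rewrite mulr_sumr.
    by apply: eq_bigr => j _; ring.
  rewrite avg_sum; apply: eq_bigr => i _; rewrite avg_sum; apply: eq_bigr => j _.
  by rewrite !avgD !avgZ avg_cst.
apply: (@le_trans _ _ (\sum_(i | P i) \sum_(j | P j) (e + ((i < j + r) && (j < i + r))%N%:R))).
  apply: ler_sum => i Pi; apply: ler_sum => j Pj.
  have /andP[ni i2n] := Pn _ Pi; have /andP[nj j2n] := Pn _ Pj.
  have h : corr i j <= m ^+ 2 + (e + ((i < j + r) && (j < i + r))%N%:R).
    have rl k : (k < n.*2)%N -> (k + r <= n + n.*2)%N by move=> k2n; rewrite addnC leq_add// ltnW.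
    have [ij|ji] /= := ltnP i (j + r); last first.
      by rewrite addr0 corr_sym; apply: far => //; [exact: leq_trans nj|exact: rl].
    have [ij'|ji] /= := ltnP j (i + r); last first.
      by rewrite addr0; apply: far => //; [exact: leq_trans ni|exact: rl].
    by apply: le_trans (corr_le1 beta lambda Q0 i j) _; rewrite addrA lerDr addr_ge0 ?sqr_ge0// ltW.
  have mi := @mean_ge R beta lambda Q beta0 lambda0 Q0 _ i.
  have mj := @mean_ge R beta lambda Q beta0 lambda0 Q0 _ j.
  have := ler_wpM2l (ltW m0) mi; have := ler_wpM2l (ltW m0) mj.
  rewrite -expr2 => h1 h2; lra.
under eq_bigr => i _ do rewrite big_split /=.
have S0 : 0 <= \sum_(i | P i) 1 :> R by exact: sumr_ge0.
rewrite big_split /=; apply: lerD.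
  have -> : \sum_(i | P i) \sum_(j | P j) e = e * (\sum_(i | P i) 1) ^+ 2.
    rewrite expr2 mulrA mulr_sumr; apply: eq_bigr => i _.
    by rewrite mulr1 mulr_sumr; apply: eq_bigr => j _; rewrite mulr1.
  by rewrite ler_pM2l// lerXn2r ?nnegrE.
apply: (@le_trans _ _ (\sum_(i | P i) 2 * r%:R)).
  apply: ler_sum => i _.
  apply: le_trans (@count_ord_le R _ _ (fun j => (i < j + r)%N && (j < i + r)%N) (i - r)%N (i + r)%N _) _.
    by move=> z /andP[z1 ->]; rewrite andbT leq_subLR [(r + z)%N]addnC ltnW.
  by rewrite -natrM ler_nat; exact: window_width.
have -> : \sum_(i | P i) 2 * r%:R = 2 * r%:R * \sum_(i | P i) 1 :> R.
  by rewrite mulr_sumr; apply: eq_bigr => i _; rewrite mulr1.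
by apply: ler_wpM2l => //; exact: mulr_ge0.
Qed.

(** A node of the binary tree over the wall positions [n, 2 n). The wall at n + y belongs to node y
    / 2^(k+1) of level [k], and to its right half exactly when bit [k] of y is 1. *)
Definition node n k a (i : nat) : bool :=
  (n + a * 2 ^ k.+1 <= i < n + a * 2 ^ k.+1 + 2 ^ k.+1)%N.

(* Majority contrast on a dyadic interval: is the wall in its right half? *)
Definition decide A n k a d (s : {ffun 'I_A -> 'I_Q.+1}) : bool :=
  0 < \sum_(i : 'I_A | node n k a i) contrast d (s i).

Definition bad A n k y d (s : {ffun 'I_A -> 'I_Q.+1}) : bool :=
  odd (y %/ 2 ^ k)%N != decide n k (y %/ 2 ^ k.+1)%N d s.

Definition avg_bad n k y : R :=
  avg (A := n + n.*2) (fun d s => (bad n k y d (flip (n + y) d s))%:R).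

Lemma avg_bad_le1 n k y : avg_bad n k y <= 1.
Proof.
rewrite /avg_bad -[leRHS](@avg_cst (n + n.*2) 1); apply: le_avg => d s _.
by rewrite lern1 leq_b1.
Qed.

Lemma odd_divn_expn y k : odd (y %/ 2 ^ k)%N = (2 ^ k <= y %% 2 ^ k.+1)%N.
Proof.
have k0 : (0 < 2 ^ k)%N by rewrite expn_gt0.
rewrite {1}(divn_eq y (2 ^ k.+1)) expnS mulnA divnMDl// oddD oddM andbF /=.
have : (y %% (2 * 2 ^ k) < 2 * 2 ^ k)%N by rewrite ltn_mod muln_gt0.
move: (y %% _)%N => z z2; have [kz|zk] := leqP (2 ^ k)%N z; last by rewrite divn_small.
have -> : (z %/ 2 ^ k = 1)%N by apply/eqP; rewrite eqn_leq -ltnS ltn_divLR// z2 leq_divRL// mul1n.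
by [].
Qed.

Lemma node_bounds n k y : (y < n)%N -> (2 ^ k.+1 %| n)%N ->
  let a := (n + y %/ 2 ^ k.+1 * 2 ^ k.+1)%N in
  [/\ (a <= n + y)%N, (n + y <= a + 2 ^ k.+1)%N, (a + 2 ^ k.+1 <= n + n.*2)%N,
      (n + y - a = y %% 2 ^ k.+1)%N & (a + 2 ^ k.+1 <= n.*2)%N].
Proof.
move=> yn /dvdnP[c nE]; set l := (2 ^ k.+1)%N in nE *.
have l0 : (0 < l)%N by rewrite expn_gt0.
have zl : (y %% l < l)%N by rewrite ltn_mod.
have yE := divn_eq y l; set q := (y %/ l)%N in yE *; set z := (y %% l)%N in yE zl *.
have qc : (q.+1 * l <= c * l)%N.
  rewrite leq_mul2r; apply/orP; right.
  by rewrite /q ltn_divLR// -nE.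
rewrite mulSn -nE in qc; move: (q * l)%N yE qc => ql yE qc /=.
by clearbody z l; split; lia.
Qed.

Lemma sum_node_left n k y : (y < n)%N -> (2 ^ k.+1 %| n)%N ->
  \sum_(i : 'I_(n + n.*2) | node n k (y %/ 2 ^ k.+1)%N i && (i < n + y)%N) 1 = (y %% 2 ^ k.+1)%:R :> R.
Proof.
move=> yn kn; have [h1 h2 h3 h4 _] := node_bounds yn kn.
rewrite (eq_bigl (fun i : 'I_(n + n.*2) => (n + y %/ 2 ^ k.+1 * 2 ^ k.+1 <= i < n + y)%N)).
  rewrite (@big_ord_window R _ _ _ (fun=> 1))//; last exact: leq_trans h2 h3.
  by rewrite sumr_const_nat h4.
move=> i; rewrite /node; apply/idP/idP => [/andP[/andP[-> _] ->]//|/andP[h5 h6]].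
by rewrite h5 h6 (leq_trans h6 h2).
Qed.

Lemma sum_node_right n k y : (y < n)%N -> (2 ^ k.+1 %| n)%N ->
  \sum_(i : 'I_(n + n.*2) | node n k (y %/ 2 ^ k.+1)%N i && (n + y <= i)%N) 1 =
    (2 ^ k.+1)%:R - (y %% 2 ^ k.+1)%:R :> R.
Proof.
move=> yn kn; have [h1 h2 h3 h4 _] := node_bounds yn kn.
rewrite (eq_bigl (fun i : 'I_(n + n.*2) => (n + y <= i < n + y %/ 2 ^ k.+1 * 2 ^ k.+1 + 2 ^ k.+1)%N)).
  rewrite (@big_ord_window R _ _ _ (fun=> 1))// sumr_const_nat -natrB; last first.
    by rewrite ltnW// ltn_mod expn_gt0.
  congr (_%:R); rewrite -h4; move: h1 h2; move: (n + _ * _)%N => a; lia.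
move=> i; rewrite /node; apply/idP/idP => [/andP[/andP[_ ->] ->]//|/andP[h5 h6]].
by rewrite h5 h6 (leq_trans h1 h5).
Qed.

(** For a wall at offset z in a node of length l, the majority sum is m (2 z - l) plus the deviation
    to the left of the wall minus that to the right. A wrong decision forces the difference of the
    deviations to be at least m |2 z - l|: this is Chebyshev's inequality before taking
    expectations. *)
Lemma bad_le n k y d s : (y < n)%N -> (2 ^ k.+1 %| n)%N -> d != ord0 ->
  (bad n k y d (flip (n + y) d s))%:R *
    (m ^+ 2 * (2 * (y %% 2 ^ k.+1)%:R - (2 ^ k.+1)%:R) ^+ 2) <=
  2 * (\sum_(i : 'I_(n + n.*2) | node n k (y %/ 2 ^ k.+1)%N i && (i < n + y)%N) (contrast d (s i) - m)) ^+ 2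
  + 2 * (\sum_(i : 'I_(n + n.*2) | node n k (y %/ 2 ^ k.+1)%N i && (n + y <= i)%N)
      (contrast d (s i) - m)) ^+ 2.
Proof.
move=> yn kn d0.
pose Pl (i : 'I_(n + n.*2)) := node n k (y %/ 2 ^ k.+1)%N i && (i < n + y)%N.
pose Pr (i : 'I_(n + n.*2)) := node n k (y %/ 2 ^ k.+1)%N i && (n + y <= i)%N.
rewrite -/Pl -/Pr.
have U : \sum_(i | Pl i) contrast d (s i) = \sum_(i | Pl i) (contrast d (s i) - m) + m * (y %% 2 ^ k.+1)%:R.
  rewrite (_ : m * (y %% 2 ^ k.+1)%:R = \sum_(i | Pl i) m).
    by rewrite -big_split; apply: eq_bigr => i _; rewrite /= subrK.
  by rewrite -(sum_node_left yn kn) mulr_sumr; apply: eq_bigr => i _; rewrite mulr1.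
have W : \sum_(i | Pr i) contrast d (s i) = \sum_(i | Pr i) (contrast d (s i) - m) +
    m * ((2 ^ k.+1)%:R - (y %% 2 ^ k.+1)%:R).
  rewrite (_ : m * ((2 ^ k.+1)%:R - (y %% 2 ^ k.+1)%:R) = \sum_(i | Pr i) m).
    by rewrite -big_split; apply: eq_bigr => i _; rewrite /= subrK.
  by rewrite -(sum_node_right yn kn) mulr_sumr; apply: eq_bigr => i _; rewrite mulr1.
have S : \sum_(i : 'I_(n + n.*2) | node n k (y %/ 2 ^ k.+1)%N i) contrast d (flip (n + y) d s i) =
    \sum_(i | Pl i) contrast d (s i) - \sum_(i | Pr i) contrast d (s i).
  rewrite (bigID (fun i : 'I_(n + n.*2) => (i < n + y)%N)) /=; congr (_ + _).
    by apply: eq_bigr => i /andP[_ iy]; rewrite ffunE iy.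
  rewrite -sumrN; apply: eq_big => [i|i /andP[_ /negPf iy]]; first by rewrite /Pr /= -leqNgt.
  by rewrite ffunE iy contrast_swap.
rewrite /bad /decide odd_divn_expn S U W.
set a := \sum_(i | Pl i) _; set b := \sum_(i | Pr i) _.
have expE : (2 ^ k.+1)%:R = 2 * (2 ^ k)%:R :> R by rewrite -natrM expnS.
have sq : 2 * a ^+ 2 + 2 * b ^+ 2 = (a - b) ^+ 2 + (a + b) ^+ 2 by ring.
have sq0 := sqr_ge0 (a + b); have sq1 := sqr_ge0 (a - b).
set l : R := (2 ^ k.+1)%:R in expE *; set z : R := (_ %% _)%:R.
have lk : (2 ^ k.+1 = 2 * 2 ^ k)%N by rewrite expnS.
case: (boolP (_ != _)) => [h|_]; last by rewrite mul0r sq addr_ge0.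
rewrite mul1r sq; apply: ler_wpDr => //; rewrite -exprMn -subr_ge0 subr_sqr.
have [kz|zk] := leqP (2 ^ k)%N (y %% 2 ^ k.+1)%N; rewrite ?kz in h.
  have u0 : 0 <= 2 * z - l by rewrite expE -mulrBr mulr_ge0// subr_ge0 ler_nat.
  have mu : 0 <= m * (2 * z - l) by rewrite mulr_ge0// ltW.
  have ab : a - b <= - (m * (2 * z - l)).
    by move: h; case: ltP => //; lra.
  by apply: mulr_le0; lra.
have u0 : 2 * z - l <= 0 by rewrite expE -mulrBr mulr_ge0_le0// subr_le0 ler_nat ltnW.
have mu : 0 <= m * (l - 2 * z) by apply: mulr_ge0; [exact: ltW|lra].
have ab : m * (l - 2 * z) <= a - b.
  by move: h; rewrite leqNgt zk; case: ltP => //; lra.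
by apply: mulr_ge0; lra.
Qed.

Lemma avg_bad_le n k y : (y < n)%N -> (2 ^ k.+1 %| n)%N -> (r <= n)%N ->
  avg_bad n k y * (m ^+ 2 * (2 * (y %% 2 ^ k.+1)%:R - (2 ^ k.+1)%:R) ^+ 2) <=
    4 * (e * (2 ^ k.+1)%:R ^+ 2 + 2 * r%:R * (2 ^ k.+1)%:R).
Proof.
move=> yn kn rn; have [h1 h2 h3 h4 h5] := node_bounds yn kn.
rewrite mulrC -avgZ.
pose Pl (i : 'I_(n + n.*2)) := node n k (y %/ 2 ^ k.+1)%N i && (i < n + y)%N.
pose Pr (i : 'I_(n + n.*2)) := node n k (y %/ 2 ^ k.+1)%N i && (n + y <= i)%N.
apply: (@le_trans _ _ (avg (fun d (s : {ffun 'I_(n + n.*2) -> 'I_Q.+1}) =>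
    2 * (\sum_(i | Pl i) (contrast d (s i) - m)) ^+ 2
    + 2 * (\sum_(i | Pr i) (contrast d (s i) - m)) ^+ 2))).
  by apply: le_avg => d s d0; rewrite mulrC; exact: bad_le.
have nodeP (i : 'I_(n + n.*2)) : node n k (y %/ 2 ^ k.+1)%N i -> (n <= i < n.*2)%N.
  by move=> /andP[g1 g2]; rewrite (leq_trans (leq_addr _ _) g1) (leq_trans g2 h5).
have zl : (y %% 2 ^ k.+1)%:R <= (2 ^ k.+1)%:R :> R by rewrite ler_nat ltnW// ltn_mod expn_gt0.
have v1 : avg (fun d s => (\sum_(i | Pl i) (contrast d (s i) - m)) ^+ 2) <=
    e * (2 ^ k.+1)%:R ^+ 2 + 2 * r%:R * (2 ^ k.+1)%:R.
  apply: avg_variance_le => // [i /andP[/nodeP]//|].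
  by rewrite (sum_node_left yn kn).
have v2 : avg (fun d s => (\sum_(i | Pr i) (contrast d (s i) - m)) ^+ 2) <=
    e * (2 ^ k.+1)%:R ^+ 2 + 2 * r%:R * (2 ^ k.+1)%:R.
  apply: avg_variance_le => // [i /andP[/nodeP]//|].
  by rewrite (sum_node_right yn kn) gerBl.
rewrite avgD !avgZ; lra.
Qed.

Lemma avg_bad_ge0 n k y : 0 <= avg_bad n k y.
Proof.
rewrite /avg_bad -(@avg_cst (n + n.*2) 0); apply: le_avg => d s _.
exact: ler0n.
Qed.

Let midpoint_far (b z t l : nat) : l = (2 * (b * t))%N ->
  ~~ ((b * t - t <= z) && (z < b * t + t))%N -> (2 * z + 2 * t <= l \/ l + 2 * t <= 2 * z)%N.
Proof. by rewrite negb_and -ltnNge -leqNgt => -> /orP[h|h]; [left|right]; nia. Qed.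

(** Walls within 2^(k-b) of the middle of their node may be misjudged, but they are a fraction
    2^(-b) of all walls. For the others |2 z - l| is at least l / 2^b, and [avg_bad_le] gives the
    second term, the hypothesis on [r] absorbing the near pairs into a factor 2. *)
Lemma sum_avg_bad_le D k b : (b <= k)%N -> (k < D)%N -> (r <= 2 ^ D)%N ->
  2 * r%:R <= e * (2 ^ k.+1)%:R ->
  \sum_(y < 2 ^ D) avg_bad (2 ^ D) k y <=
    (2 ^ D)%:R * ((2 ^ b)%:R^-1 + 8 * e * (2 ^ b)%:R ^+ 2 / m ^+ 2).
Proof.
move=> bk kD rD re.
set c := 8 * e * _ / _; pose B := (2 ^ b)%N; pose t := (2 ^ (k - b))%N.
have Bt : (B * t = 2 ^ k)%N by rewrite -expnD subnKC.
have lE : (2 ^ k.+1 = 2 * (B * t))%N by rewrite Bt expnS.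
have B0 : 0 < B%:R :> R by rewrite ltr0n expn_gt0.
have t0 : 0 < t%:R :> R by rewrite ltr0n expn_gt0.
have c0 : 0 <= c by rewrite divr_ge0 ?sqr_ge0// !mulr_ge0// ?sqr_ge0// ltW.
pose amb z : bool := (B * t - t <= z < B * t + t)%N.
have each (y : 'I_(2 ^ D)) : avg_bad (2 ^ D) k y <= (amb (y %% 2 ^ k.+1)%N)%:R + c.
  have [_|na] := boolP (amb _).
    by apply: le_trans (avg_bad_le1 _ _ _) _; rewrite lerDl.
  rewrite add0r; have kn : (2 ^ k.+1 %| 2 ^ D)%N by rewrite dvdn_exp2l.
  have h := avg_bad_le (ltn_ord y) kn rD.
  have := midpoint_far lE na; move: h; set z := (_ %% _)%N; set a := avg_bad _ _ _.
  have lR : (2 ^ k.+1)%:R = 2 * (B%:R * t%:R) :> R by rewrite lE !natrM.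
  set l := (2 ^ k.+1)%:R in re lR *; move=> h zt.
  have sq : (2 * t%:R) ^+ 2 <= (2 * z%:R - l) ^+ 2.
    case: zt => zt.
      have : 2 * z%:R + 2 * t%:R <= l by rewrite /l -!natrM -natrD ler_nat.
      move=> g; rewrite -[leRHS]sqrrN lerXn2r// ?nnegrE; lra.
    have : l + 2 * t%:R <= 2 * z%:R by rewrite /l -!natrM -natrD ler_nat.
    move=> g; rewrite lerXn2r// ?nnegrE; lra.
  have a0 : 0 <= a by exact: avg_bad_ge0.
  have m2 : 0 < m ^+ 2 by rewrite exprn_gt0.
  rewrite /c ler_pdivlMr// -(ler_pM2r (_ : 0 < (2 * t%:R) ^+ 2)); last by rewrite exprn_gt0// mulr_gt0.
  rewrite -[leLHS]mulrA; apply: (@le_trans _ _ (a * (m ^+ 2 * (2 * z%:R - l) ^+ 2))).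
    by apply: ler_wpM2l => //; apply: ler_wpM2l => //; exact: ltW.
  apply: le_trans h _.
  have : l * (2 * r%:R) <= l * (e * l) by rewrite ler_wpM2l.
  rewrite lR -/B; lra.
apply: le_trans (ler_sum _ (fun y _ => each y)) _.
rewrite big_split /= sumr_const card_ord -[c *+ _]mulr_natl mulrDr lerD2r.
have nE : (2 ^ D = 2 ^ (D - k.+1) * 2 ^ k.+1)%N by rewrite -expnD subnK.
rewrite -(big_mkord xpredT (fun y => (amb (y %% 2 ^ k.+1)%N)%:R)) nE big_mkord.
rewrite (@sum_nat_modn R (fun z => (amb z)%:R)) ?expn_gt0//.
rewrite ler_pdivlMr// -natr_sum -!natrM ler_nat -mulnA leq_mul2l; apply/orP; right.
apply: leq_trans (leq_mul (sum_nat_interval_le _ _ _) (leqnn _)) _.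
rewrite lE mulnC -/B [X in (_ <= X)%N]mulnCA leq_mul2l; apply/orP; right.
apply: leq_trans (leq_sub2r _ (geq_minr _ _)) _.
by rewrite leq_subLR; lia.
Qed.

End TreeDecisions.

(** * Entropy against energy of walls *)

Section WallEntropy.
Variables (R : realType) (beta lambda : R) (Q : nat).
Hypotheses (beta0 : 0 < beta) (lambda0 : 0 < lambda) (Q0 : (0 < Q)%N).
Local Notation kint := (kint beta lambda).
Local Notation m := (magnetization Q.+1 beta lambda).
Local Notation avg := (@avg R beta lambda Q _).

Let Qr0 : 0 < Q%:R :> R. Proof. by rewrite ltr0n. Qed.

Variables (D : nat) (c : R).
Local Notation n := (2 ^ D)%N.
Local Notation A := (n + n.*2)%N.

Let disagreements y d (s : {ffun 'I_A -> 'I_Q.+1}) : R :=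
  \sum_(k < D) (bad R n k y d s)%:R.

(** Each disagreement is charged [c], so that all walls leading to the same configuration have total
    weight (1 + expR (- c))^D, a small power of n when [c] is large. *)
Let cost y d (s : {ffun 'I_A -> 'I_Q.+1}) : R :=
  wall_cost beta lambda (n + y) d s + c * disagreements y d (flip (n + y) d s).

Let expR_disagreements y d s : expR (- (c * disagreements y d s)) =
  \prod_(k < D) (if odd (y %/ 2 ^ k)%N != decide R n k (y %/ 2 ^ k.+1)%N d s then expR (- c) else 1).
Proof.
rewrite /disagreements mulr_sumr -sumrN expR_sum; apply: eq_bigr => k _.
rewrite /bad; case: ifP => _; rewrite ?mulr1 ?mulr0 ?oppr0 ?expR0//.
Qed.

(** Flipping is a bijection that turns the energy minus the wall cost into the energy with boundary
    condition 1/d. The flipped configuration being fixed, only the penalties still depend on the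
    wall. *)
Let sum_exp_cost_le d : d != ord0 ->
  \sum_(y < n) ev (kint A) (fun s => expR (- cost y d s)) <= (1 + expR (- c)) ^+ D.
Proof.
move=> d0; rewrite /ev -mulr_suml ler_pdivrMr ?pf_gt0//.
have -> : \sum_(y < n) \sum_s wt (kint A) s * expR (- cost y d s) =
    \sum_s expR (wall_energy beta lambda d s) * \sum_(y < n) expR (- (c * disagreements y d s)).
  under [RHS]eq_bigr do rewrite mulr_sumr.
  rewrite [RHS]exchange_big; apply: eq_bigr => y _ /=.
  rewrite [RHS](reindex_inj (inv_inj (@flipK Q A (n + y) d))) /=.
  apply: eq_bigr => s _; rewrite wall_energy_flip// wall_energy0 /wt /cost -!expRD.
  by congr expR; rewrite opprD addrA.
rewrite (eq_bigr (fun s => expR (wall_energy beta lambda d s) * (1 + expR (- c)) ^+ D)); last first.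
  move=> s _; congr (_ * _).
  rewrite -(sum_dyadic_disagreements (expR (- c)) D (fun k a => decide R n k a d s)).
  by apply: eq_bigr => y _; rewrite expR_disagreements.
rewrite -mulr_suml mulrC ler_wpM2l ?exprn_ge0 ?addr_ge0 ?expR_ge0//.
exact: sum_wall_le.
Qed.

(* Jensen's inequality, averaging over the wall, the colour and the spins. *)
Lemma wall_entropy_le :
  n%:R * expR (- (n%:R^-1 * \sum_(y < n) (avg_cost beta lambda Q A (n + y) +
     c * \sum_(k < D) avg_bad beta lambda Q n k y))) <= (1 + expR (- c)) ^+ D.
Proof.
have n0 : 0 < n%:R :> R by rewrite ltr0n expn_gt0.
have costE (y : 'I_n) : avg_cost beta lambda Q A (n + y) + c * \sum_(k < D) avg_bad beta lambda Q n k y =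
    avg (cost y).
  rewrite /cost avgD avgZ; congr (_ + c * _).
  by rewrite /disagreements avg_sum.
under eq_bigr do rewrite costE.
set Y := n%:R^-1 * _.
have h1 : \sum_(y < n) avg (fun d s => expR (- cost y d s)) <= (1 + expR (- c)) ^+ D.
  rewrite /avg -mulr_sumr exchange_big /= ler_pdivrMl//.
  apply: le_trans (ler_sum _ (fun d d0 => sum_exp_cost_le d0)) _.
  by rewrite sumr_const cardC1 card_ord mulr_natl.
apply: le_trans h1.
(* The convex function exp(- x) lies above its tangent at the overall mean [Y]. *)
have h2 (y : 'I_n) : expR (- Y) * (1 + Y) - expR (- Y) * avg (cost y) <= avg (fun d s => expR (- cost y d s)).
  have -> : expR (- Y) * (1 + Y) - expR (- Y) * avg (cost y) =
      avg (fun d s => expR (- Y) * (1 + Y) + (- expR (- Y)) * cost y d s).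
    by rewrite (@avgD R beta lambda Q A (fun _ _ => expR (- Y) * (1 + Y))) avg_cst// avgZ mulNr.
  apply: le_avg => // d s _.
  have -> : - cost y d s = - Y + (Y - cost y d s) by rewrite addrA addNr add0r.
  rewrite expRD mulNr -mulrBr ler_pM2l ?expR_gt0//.
  by rewrite -addrA expR_ge1Dx.
apply: le_trans (ler_sum _ (fun y _ => h2 y)).
rewrite sumrB -[X in _ <= X - _]mulr_sumr -[X in _ <= _ - X]mulr_sumr.
rewrite sumr_const card_ord -[(1 + Y) *+ n]mulr_natl.
have -> : \sum_(y < n) avg (cost y) = n%:R * Y by rewrite /Y mulrA divff ?mul1r// gt_eqF.
rewrite le_eqVlt; apply/orP; left; apply/eqP; ring.
Qed.

End WallEntropy.

(** * The gap in the magnetization *)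

Section Thouless.
Variables (R : realType) (beta lambda : R) (Q : nat).
Hypotheses (beta0 : 0 < beta) (lambda0 : 0 < lambda) (Q0 : (0 < Q)%N).
Local Notation m := (magnetization Q.+1 beta lambda).

Lemma magnetization_gap : 0 < m -> 1 <= beta * m ^+ 2.
Proof.
move=> m0; rewrite leNgt; apply/negP => bm1.
have m2 : 0 < m ^+ 2 by rewrite exprn_gt0.
pose g := 1 - beta * m ^+ 2.
have g0 : 0 < g by rewrite /g; lra.
have g1 : g < 1 by rewrite /g ltrBlDr ltrDl mulr_gt0.
have L0 : 0 < ln 2 :> R by rewrite ln_gt0// ltr1n.
have L1 : ln 2 <= 1 :> R by have := @le_ln1Dx R 1; lra.
set L := ln 2 in L0 L1.
(* Error budget against a gain of D g L: overcounting of walls takes D t = D g L / 8, the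
   correlation error D beta e L at most D g L / 4, and wrong decisions 2 c w D = D g L / 8. Half of
   the gain is left against constants. *)
pose t := g * L / 8.
have t0 : 0 < t by rewrite /t divr_gt0 ?mulr_gt0.
have t1 : t < 1.
  rewrite /t ltr_pdivrMr// mul1r (@le_lt_trans _ _ (1 * 1))//; last by lra.
  by rewrite ler_pM// ltW.
pose c := - ln t.
have c0 : 0 < c by rewrite /c oppr_gt0 ln_lt0// t0.
have tE : expR (- c) = t by rewrite /c opprK lnK.
pose w := g * L / (16 * c).
have w0 : 0 < w by rewrite /w divr_gt0 ?mulr_gt0.
have [b bw] : exists b : nat, (2 ^ b)%:R^-1 <= w.
  exists (Num.bound w^-1); rewrite -[leRHS]invrK lef_pV2 ?posrE ?invr_gt0 ?ltr0n ?expn_gt0//.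
  apply: (@le_trans _ _ (Num.bound w^-1)%:R); last by rewrite ler_nat ltnW// ltn_expl.
  by rewrite ltW// archi_boundP// invr_ge0 ltW.
pose B : R := (2 ^ b)%:R.
have B0 : 0 < B by rewrite ltr0n expn_gt0.
pose e := Num.min (g / (4 * beta)) (w * m ^+ 2 / (8 * B ^+ 2)).
have B2 : 0 < 8 * B ^+ 2 by rewrite mulr_gt0// exprn_gt0.
have e0 : 0 < e by rewrite lt_min !divr_gt0// mulr_gt0.
have e1 : beta * e <= g / 4.
  have : e <= g / (4 * beta) by rewrite ge_min lexx.
  by rewrite ler_pdivlMr ?mulr_gt0//; lra.
have e2 : 8 * e * B ^+ 2 / m ^+ 2 <= w.
  have : e <= w * m ^+ 2 / (8 * B ^+ 2) by rewrite ge_min lexx orbT.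
  by rewrite ler_pdivlMr// ler_pdivrMr//; lra.
have [r far] := @corr_far R beta lambda Q beta0 lambda0 Q0 e (ltW m0) e0.
(* Below level [k0] the nodes are too short for the variance bound; these levels are counted as
   always wrong, at a cost independent of [D]. *)
pose k0 := (b + Num.bound (2 * r%:R / e))%N.
have k0P k : (k0 <= k)%N -> 2 * r%:R <= e * (2 ^ k.+1)%:R.
  move=> kk; rewrite [leRHS]mulrC -ler_pdivrMr//.
  apply: (@le_trans _ _ (Num.bound (2 * r%:R / e))%:R).
    by rewrite ltW// archi_boundP// divr_ge0 ?mulr_ge0// ltW.
  rewrite ler_nat; apply: leq_trans (ltnW (ltn_expl k.+1 (ltnSn 1))).
  by rewrite (leq_trans _ (leqW kk))// leq_addl.
pose C1 := (m ^+ 2 + e) * (tail beta lambda 1 + beta * (1 + ln 2))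
  + 3 * (r%:R * tail beta lambda 1) + 6 * beta.
have me0 : 0 <= m ^+ 2 + e by rewrite addr_ge0// ltW.
have main D : (r <= D)%N -> D%:R * L <=
    D%:R * t + (m ^+ 2 + e) * (beta * (D%:R * L)) + C1 + c * (D%:R * (2 * w) + k0%:R).
  move=> rD; pose n := (2 ^ D)%N.
  have n0 : 0 < n%:R :> R by rewrite ltr0n expn_gt0.
  have lnn : ln n%:R = D%:R * L :> R by rewrite natrX lnXn// mulr_natl.
  have rn : (r <= n)%N by rewrite (leq_trans rD)// ltnW// ltn_expl.
  have h := @wall_entropy_le R beta lambda Q beta0 lambda0 Q0 D c.
  set Y := _^-1 * _ in h.
  have YC : Y <= (m ^+ 2 + e) * (beta * (D%:R * L)) + C1 + c * (D%:R * (2 * w) + k0%:R).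
    rewrite /Y ler_pdivrMl//; rewrite big_split /= -[X in _ + X <= _]mulr_sumr.
    have cost_le : \sum_(y < n) avg_cost beta lambda Q (n + n.*2) (n + y) <=
        n%:R * ((m ^+ 2 + e) * (beta * (D%:R * L)) + C1).
      rewrite mulr_natl -[n in _ *+ n]card_ord -sumr_const; apply: ler_sum => y _.
      rewrite -lnn; apply: (@avg_cost_le R beta lambda Q beta0 lambda0 Q0 e r) => //.
        by rewrite expn_gt0.
      by rewrite leq_addr -addnn ltn_add2l ltn_ord.
    have bad_le : \sum_(y < n) \sum_(k < D) avg_bad beta lambda Q n k y <=
        n%:R * (D%:R * (2 * w) + k0%:R).
      rewrite exchange_big /=.
      apply: (@le_trans _ _ (\sum_(k < D) n%:R * (2 * w + (0 <= k < k0)%N%:R))).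
        apply: ler_sum => k _ /=; have [kk|kk] := ltnP k k0.
          apply: (@le_trans _ _ (\sum_(y < n) 1)).
            by apply: ler_sum => y _; exact: avg_bad_le1.
          by rewrite sumr_const card_ord ler_peMr// lerDr mulr_ge0// ltW.
        apply: le_trans (@sum_avg_bad_le R beta lambda Q beta0 lambda0 Q0
          e r m0 e0 far D k b _ _ rn (k0P k kk)) _ => //.
          by rewrite (leq_trans _ kk)// leq_addr.
        rewrite addr0; apply: ler_wpM2l; first exact: ltW.
        have -> : 2 * w = w + w by ring.
        exact: lerD.
      rewrite -mulr_sumr ler_pM2l// big_split /= sumr_const card_ord -[(2 * w) *+ D]mulr_natl lerD2l.
      rewrite -natr_sum ler_nat; apply: leq_trans (sum_nat_interval_le D 0 k0) _.
      by rewrite subn0 geq_minr.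
    apply: le_trans (lerD cost_le (ler_wpM2l (ltW c0) bad_le)) _.
    rewrite le_eqVlt; apply/orP; left; apply/eqP; ring.
  rewrite tE in h.
  have h2 : ln (n%:R * expR (- Y)) <= ln ((1 + t) ^+ D).
    by rewrite ler_ln ?posrE ?mulr_gt0 ?expR_gt0 ?exprn_gt0//; lra.
  move: h2; rewrite lnM ?posrE ?expR_gt0// expRK lnXn; last by lra.
  rewrite lnn -mulr_natl => h2.
  have h3 : D%:R * ln (1 + t) <= D%:R * t by rewrite ler_wpM2l//; apply: le_ln1Dx; lra.
  lra.
have D0 (D : nat) : (r <= D)%N -> D%:R * (g * L / 2) <= C1 + c * k0%:R.
  move=> rD; have := main D rD.
  have h1 : D%:R * (beta * e * L) <= D%:R * (g / 4 * L) by rewrite ler_wpM2l// ler_pM2r.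
  have h2 : c * (D%:R * (2 * w)) = D%:R * (g * L / 8).
    by rewrite /w; field; rewrite gt_eqF.
  rewrite mulrDr h2 /t /g in h1 *; lra.
have gL : 0 < g * L / 2 by rewrite divr_gt0 ?mulr_gt0.
pose D := (r + Num.bound ((C1 + c * k0%:R) / (g * L / 2)))%N.
have := D0 D (leq_addr _ _); rewrite -ler_pdivlMr// leNgt => /negP; apply.
apply: (@lt_le_trans _ _ (Num.bound ((C1 + c * k0%:R) / (g * L / 2)))%:R); last first.
  by rewrite ler_nat leq_addl.
apply: archi_boundP; rewrite divr_ge0 ?(ltW gL)//.
by apply: le_trans (D0 r (leqnn r)); rewrite mulr_ge0// ltW.
Qed.

End Thouless.

(** * Renormalization of clusters *)

Section Clusters.
Variable M : nat.
Local Notation V := (option 'I_M).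
Implicit Types (om D : {set V * V}) (a b : nat) (x y : 'I_M).

Definition itv a b : {set 'I_M} := [set y : 'I_M | (a <= y < b)%N]%SET.

Lemma card_itv a b : (a <= b)%N -> (b <= M)%N -> #|itv a b| = (b - a)%N.
Proof.
move=> ab bM; rewrite -sum1_card (eq_bigl (fun y : 'I_M => (a <= y < b)%N)).
  by rewrite (@big_ord_window nat M a b (fun=> 1%N))// sum_nat_const_nat muln1.
by move=> y; rewrite inE.
Qed.

(** Both orientations of an edge count, and paths are confined to [a, b), so that the clusters of a
    block depend only on its internal edges. *)
Definition adj a b om : rel 'I_M := fun u v =>
  [&& u \in itv a b, v \in itv a b & ((Some u, Some v) \in om) || ((Some v, Some u) \in om)].

Definition clus a b om x : {set 'I_M} := [set y in itv a b | connect (adj a b om) x y]%SET.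

Definition internal a b : {set V * V} := [set e : V * V |
  match e with (Some i, Some j) => (i \in itv a b) && (j \in itv a b) | _ => false end]%SET.

Lemma adj_sym a b om : symmetric (adj a b om).
Proof. by move=> u v; rewrite /adj andbCA orbC. Qed.

Lemma itvS a b a' b' : (a' <= a)%N -> (b <= b')%N -> itv a b \subset itv a' b'.
Proof.
move=> aa bb; apply/fintype.subsetP => y; rewrite !inE => /andP[ay yb].
by rewrite (leq_trans aa ay) (leq_trans yb bb).
Qed.

Lemma internalS a b a' b' : (a' <= a)%N -> (b <= b')%N -> internal a b \subset internal a' b'.
Proof.
move=> aa bb; apply/fintype.subsetP => -[[i|] [j|]]; rewrite !inE //.
move=> /andP[/andP[i1 i2] /andP[j1 j2]].
by rewrite (leq_trans aa i1) (leq_trans i2 bb) (leq_trans aa j1) (leq_trans j2 bb).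
Qed.

Lemma connectS a b a' b' om x y : (a' <= a)%N -> (b <= b')%N ->
  connect (adj a b om) x y -> connect (adj a' b' om) x y.
Proof.
move=> aa bb; apply: connect_sub => u v /and3P[ui vi uv]; apply: connect1.
have /fintype.subsetP h := itvS aa bb.
by rewrite /adj (h _ ui) (h _ vi).
Qed.

Lemma clus_sub a b om x : clus a b om x \subset itv a b.
Proof. by apply/fintype.subsetP => z; rewrite inE => /andP[]. Qed.

Lemma clus_setD a b om D x : [disjoint D & internal a b] ->
  clus a b (om :\: D)%SET x = clus a b om x.
Proof.
move=> dis; apply/setP => y; rewrite !inE; congr (_ && _); apply: eq_connect => u v.
rewrite /adj; case: (boolP (u \in itv a b)) => //= ui; case: (boolP (v \in itv a b)) => //= vi.
have nD i j : i \in itv a b -> j \in itv a b -> ((Some i, Some j) : V * V) \notin D.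
  move=> ii jj; apply/negP => ijD; move/pred0P: dis => /(_ (Some i, Some j)) /=.
  by rewrite ijD inE ii jj.
by rewrite !inE !nD.
Qed.

Lemma connect_agree Q a b om x y (s : {ffun 'I_M -> 'I_Q.+1}) :
  compat (@agree Q _) om s -> connect (adj a b om) x y -> s x = s y.
Proof.
move=> /forall_inP cs /connectP[l + ->]; elim: l x => //= z l IH x /andP[/and3P[_ _ xz] /IH <-].
by case/orP: xz => /cs /eqP.
Qed.

Variable R : realType.
Implicit Types (t : R).

Definition good a b om t := [exists x in itv a b, t <= (#|clus a b om x|)%:R].

Lemma good_setD a b om D t : [disjoint D & internal a b] ->
  good a b (om :\: D)%SET t = good a b om t.
Proof. by move=> dis; apply: eq_existsb => x; rewrite clus_setD. Qed.

Definition run_good a h r om t := [forall j : 'I_r,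
  good (a + j * h) (a + j * h + h.*2) om t].

(** Density is asked in every block of the run: the size of the cluster alone would not control its
    distances to another one, hence not their coupling. *)
Definition spread a h r om t x := (x \in itv a (a + r.+1 * h)) &&
  [forall j : 'I_r, t <= (#|clus a (a + r.+1 * h) om x :&: itv (a + j * h) (a + j * h + h.*2)|)%:R].

Lemma run_goodP a h r om t : reflect
  (forall j, (j < r)%N -> exists2 x, x \in itv (a + j * h) (a + j * h + h.*2) &
     t <= (#|clus (a + j * h) (a + j * h + h.*2) om x|)%:R) (run_good a h r om t).
Proof.
apply: (iffP forallP) => [H j jr|H j]; last first.
  by have [x xi xt] := H j (ltn_ord j); apply/existsP; exists x; rewrite xi.
by have /existsP[x /andP[xi xt]] := H (Ordinal jr); exists x.
Qed.

(** Two consecutive blocks cover 3 h sites and each contains a cluster of more than 3 h / 2 sites,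
    so these clusters meet and can be chained. This is the origin of the density 3/4. *)
Lemma run_spread a h r om t : (0 < r)%N -> (a + r.+1 * h <= M)%N -> 3 / 2 * h%:R < t ->
  run_good a h r om t -> exists x, spread a h r om t x.
Proof.
move=> r0 rM ht /run_goodP H.
have sub j : (j < r)%N -> (a <= a + j * h)%N /\ (a + j * h + h.*2 <= a + r.+1 * h)%N.
  move=> jr; split; first exact: leq_addr.
  rewrite -addnA leq_add2l -mul2n -mulnDl leq_mul2r; apply/orP; right; lia.
have [x0 x0i x0t] := H 0 r0.
have chain j : (j < r)%N -> exists2 x, connect (adj a (a + r.+1 * h) om) x0 x &
    x \in itv (a + j * h) (a + j * h + h.*2) /\
    t <= (#|clus (a + j * h) (a + j * h + h.*2) om x|)%:R.
  elim: j => [_|j IH jr]; first by exists x0 => //; exact: connect0.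
  have [x cx [xi xt]] := IH (ltnW jr).
  have [x' x'i x't] := H _ jr.
  have [y /finset.setIP[y1 y2]] : exists y, y \in clus (a + j * h) (a + j * h + h.*2) om x :&:
      clus (a + j.+1 * h) (a + j.+1 * h + h.*2) om x'.
    apply/set0Pn; apply: contraTneq isT => dis; move: ht; rewrite ltNge => /negP[].
    have := cardsUI (clus (a + j * h) (a + j * h + h.*2) om x)
      (clus (a + j.+1 * h) (a + j.+1 * h + h.*2) om x').
    rewrite dis cards0 addn0 => cU.
    have : (#|clus (a + j * h) (a + j * h + h.*2) om x :|:
      clus (a + j.+1 * h) (a + j.+1 * h + h.*2) om x'| <= #|itv (a + j * h) (a + j * h + 3 * h)|)%N.
      apply: subset_leq_card; rewrite finset.subUset; apply/andP; split.
        apply: fintype.subset_trans (clus_sub _ _ _ _) _.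
        by apply: itvS => //; rewrite leq_add2l; lia.
      apply: fintype.subset_trans (clus_sub _ _ _ _) _.
      by apply: itvS; lia.
    have [_ s2] := sub _ jr.
    rewrite card_itv ?leq_addr//; last by apply: leq_trans rM; apply: leq_trans s2; lia.
    rewrite cU addKn => c3.
    have : (#|clus (a + j * h) (a + j * h + h.*2) om x|)%:R +
       (#|clus (a + j.+1 * h) (a + j.+1 * h + h.*2) om x'|)%:R <= 3 * h%:R :> R.
      by rewrite -natrD -natrM ler_nat.
    lra.
  exists x' => //; apply: (connect_trans cx).
  move: y1 y2; rewrite !inE => /andP[_ c1] /andP[_ c2].
  have [s1 s1'] := sub _ (ltnW jr); have [s2 s2'] := sub _ jr.
  apply: connect_trans (connectS s1 s1' c1) _.
  by rewrite (sym_connect_sym (@adj_sym _ _ _)); exact: connectS s2 s2' c2.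
exists x0; apply/andP; split.
  by apply: fintype.subsetP x0i; have [s1 s2] := sub _ r0; exact: itvS.
apply/forallP => j; have [x cx [xi xt]] := chain j (ltn_ord j).
apply: le_trans xt _; rewrite ler_nat; apply: subset_leq_card.
have [s1 s2] := sub _ (ltn_ord j).
apply/fintype.subsetP => y; rewrite inE => /andP[yi cy]; rewrite inE yi andbT inE.
rewrite (fintype.subsetP (itvS s1 s2) _ yi) /=.
exact: connect_trans cx (connectS s1 s2 cy).
Qed.

(** Every second block of the run is disjoint from the previous ones, and [r.+1./2] blocks are
    obtained in this way. *)
Lemma spread_card a h r om t x : 0 <= t -> spread a h r om t x ->
  (r.+1./2)%:R * t <= (#|clus a (a + r.+1 * h) om x|)%:R.
Proof.
move=> t0 /andP[xi /forallP sp].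
set C := clus _ _ _ _ in sp *.
suff H u : (u <= r.+1./2)%N -> u%:R * t <= (#|C :&: itv a (a + u.*2 * h)|)%:R.
  apply: le_trans (H _ (leqnn _)) _; rewrite ler_nat subset_leq_card//.
  exact: finset.subsetIl.
elim: u => [_|u IH ur]; first by rewrite mul0r.
have ur' : (u.*2 < r)%N by lia.
have := IH (ltnW ur); have := sp (Ordinal ur') => /= h1 h2.
rewrite -natr1 mulrDl mul1r; apply: le_trans (lerD h2 h1) _.
rewrite -natrD ler_nat.
have -> : (a + u.+1.*2 * h = a + u.*2 * h + h.*2)%N by rewrite doubleS !mulSn; lia.
rewrite -cardsUI (_ : (_ :&: _ :&: (_ :&: _))%SET = finset.set0) ?cards0 ?addn0; last first.
  apply/setP => y; rewrite finset.in_setI [in RHS]inE; apply/negbTE/negP.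
  move=> /andP[/finset.setIP[_ +] /finset.setIP[_ +]]; rewrite !inE => /andP[_ p2] /andP[p1 _].
  by have := leq_trans p2 p1; rewrite ltnn.
apply: subset_leq_card; rewrite -finset.setIUr; apply: finset.setIS.
by rewrite finset.subUset !itvS// ?leq_addr// -addnA leq_addr.
Qed.

End Clusters.

(** * Coupling between two dense clusters *)

Section ClusterCoupling.
Variables (R : realType) (beta lambda : R).
Hypotheses (beta0 : 0 < beta) (lambda0 : 0 < lambda).
Local Notation kap := (kap beta lambda).

Lemma invr_telescope_le (x : R) : 0 < x -> x^-1 - (x + 1)^-1 <= (x ^+ 2)^-1.
Proof.
move=> x0; have -> : x^-1 - (x + 1)^-1 = (x * (x + 1))^-1 by field; lra.
rewrite lef_pV2 ?posrE ?mulr_gt0 ?exprn_gt0//; last lra.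
by rewrite expr2 ler_pM2l//; lra.
Qed.

Lemma harmonic_ge n (a : R) : 0 < a -> ln (a + n%:R) - ln a <= \sum_(u < n) (a + u%:R)^-1.
Proof.
move=> a0; elim: n => [|n IH]; first by rewrite big_ord0 addr0 subrr.
rewrite big_ord_recr /=; apply: le_trans (lerD IH (lexx _)).
have an0 : 0 < a + n%:R by rewrite ltr_wpDr.
have e : a + n.+1%:R = (a + n%:R) * (1 + (a + n%:R)^-1).
  by rewrite mulrDr mulr1 divff ?gt_eqF// -natr1 addrA.
rewrite e lnM ?posrE//; last by rewrite addr_gt0// invr_gt0.
have : ln (1 + (a + n%:R)^-1) <= (a + n%:R)^-1.
  by apply: le_ln1Dx; rewrite (lt_trans (ltrN10 _))// invr_gt0.
lra.
Qed.

(** The sum over v telescopes to at least 1 / (u + 3) - 1 / S. Summing over u gives at least ln (S +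
    3) - ln 3 - 1, and ln 3 is at most 2. *)
Lemma double_sum_ge S : (0 < S)%N ->
  ln S%:R - 3 <= \sum_(u < S) \sum_(v < S) ((u + v + 3)%:R ^+ 2)^-1 :> R.
Proof.
move=> S0; have Sr : 0 < S%:R :> R by rewrite ltr0n.
apply: (@le_trans _ _ (\sum_(u < S) ((3 + u%:R)^-1 - S%:R^-1))); last first.
  apply: ler_sum => u _.
  apply: (@le_trans _ _ (\sum_(0 <= v < S) - (((u + v.+1 + 3)%:R)^-1 - ((u + v + 3)%:R)^-1))).
    rewrite sumrN (@telescope_sumr _ 0 S (fun v => (u + v + 3)%:R^-1))// opprB.
    rewrite [in leRHS]addn0 [(u + 3)%N]addnC natrD lerD2l lerN2 lef_pV2 ?posrE ?ltr0n ?addn_gt0 ?orbT//.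
    by rewrite ler_nat; lia.
  rewrite big_mkord; apply: ler_sum => v _; rewrite opprB.
  have -> : (u + v.+1 + 3)%:R = (u + v + 3)%:R + 1 :> R by rewrite natr1; congr (_%:R); lia.
  by apply: invr_telescope_le; rewrite ltr0n addn_gt0 orbT.
rewrite sumrB sumr_const card_ord -[S%:R^-1 *+ S]mulr_natl divff ?gt_eqF//.
have h3 : 0 < 3 :> R by [].
have := harmonic_ge S h3.
have : ln S%:R <= ln (3 + S%:R) :> R by rewrite ler_ln ?posrE ?addr_gt0// lerDr.
have := @le_ln1Dx R 2; have -> : 1 + 2 = 3 :> R by ring.
lra.
Qed.

Lemma disjoint_count_le1 (S : nat) (P : pred 'I_S) :
  (forall u v, P u -> P v -> u = v) -> \sum_u (P u)%:R <= 1 :> R.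
Proof.
move=> PP; have [u Pu|P0] := pickP P; last by rewrite big1// => u _; rewrite P0.
rewrite (bigD1 u) //= big1 ?addr0 ?Pu// => v vu.
by case: (boolP (P v)) => // Pv; rewrite (PP _ _ Pv Pu) eqxx in vu.
Qed.

Variable M : nat.
Implicit Types A B : {set 'I_M}.

Lemma sum_blocks_le A S (J : 'I_S -> {set 'I_M}) (f : 'I_M -> R) :
  (forall i, 0 <= f i) -> (forall u v i, i \in J u -> i \in J v -> u = v) ->
  \sum_u \sum_(i in A :&: J u) f i <= \sum_(i in A) f i.
Proof.
move=> f0 dis.
have -> : \sum_u \sum_(i in A :&: J u) f i = \sum_(i in A) \sum_u (i \in J u)%:R * f i.
  rewrite [RHS]exchange_big; apply: eq_bigr => u _ /=.
  rewrite big_mkcond [RHS]big_mkcond; apply: eq_bigr => i _; rewrite finset.in_setI.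
  by case: (i \in A); case: (i \in J u) => //=; rewrite ?mul1r ?mul0r.
apply: ler_sum => i _; rewrite -mulr_suml ler_piMl//.
by apply: disjoint_count_le1 => u v; exact: dis.
Qed.

Lemma kap_far_ge n d : (2 <= n)%N -> (n <= d)%N -> beta / d%:R ^+ 2 <= kap n.
Proof.
move=> n2 nd; rewrite kapE ifF; last by apply/negbTE; rewrite neq_ltn n2 orbT.
have n0 : (0 < n)%N by exact: ltnW.
rewrite ler_pM2l// lef_pV2 ?posrE ?exprn_gt0 ?ltr0n//; last exact: leq_trans nd.
by rewrite lerXn2r ?nnegrE// ler_nat.
Qed.

Let block_lt h a i p q : (a + p * h <= i)%N -> (i < a + q * h + h.*2)%N -> (p < q.+2)%N.
Proof.
move=> h1 h2; have : (p * h < q.+2 * h)%N by move: h1 h2; rewrite !mulSn; lia.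
by rewrite ltn_mul2r => /andP[].
Qed.

Let sub_inj S k u v : (u < S)%N -> (v < S)%N -> (S.*2 <= k)%N ->
  (k - u.*2.+1 < (k - v.*2.+1).+2)%N -> (k - v.*2.+1 < (k - u.*2.+1).+2)%N -> u = v.
Proof. lia. Qed.

Let double_inj u v : (u.*2 < v.*2.+2)%N -> (v.*2 < u.*2.+2)%N -> u = v.
Proof. lia. Qed.

Let block_dist a h k S u v i j : (0 < h)%N -> (S.*2 <= k)%N -> (u < S)%N ->
  (a + (k - u.*2.+1) * h <= i < a + (k - u.*2.+1) * h + h.*2)%N ->
  (a + k.+2 * h + v.*2 * h <= j < a + k.+2 * h + v.*2 * h + h.*2)%N ->
  (2 <= j - i <= 2 * (u + v + 3) * h)%N.
Proof.
move=> h0 Sk uS; have -> : k = (k - u.*2.+1 + u.*2.+1)%N by lia.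
rewrite addnK; move: (k - _)%N => p.
have -> : ((p + u.*2.+1).+2 * h = p * h + (u * h).*2 + 3 * h)%N.
  by rewrite -addnS -addnS mulnDl -addnA !mulSn -doubleMl; lia.
have -> : (v.*2 * h = (v * h).*2)%N by rewrite -doubleMl.
have -> : (2 * (u + v + 3) * h = (u * h).*2 + (v * h).*2 + 6 * h)%N.
  by rewrite mul2n -doubleMl !mulnDl; lia.
move: (p * h)%N (u * h)%N (v * h)%N => ph uh vh; lia.
Qed.

Let left_index S k u : (u < S)%N -> (S.*2 <= k)%N -> (k - u.*2.+1 < k)%N.
Proof. lia. Qed.

Let right_index S r u : (u < S)%N -> (S.*2 <= r.+1)%N -> (u.*2 < r)%N.
Proof. lia. Qed.

(** On either side [S] disjoint blocks are numbered by their distance to the gap. Blocks u and v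
    contain at least 2 h th sites of their clusters, at distances at most 2 (u + v + 3) h, and
    contribute beta th^2 / (u + v + 3)^2: [h] cancels because the interaction decays as the inverse
    square. *)
Lemma cluster_coupling_ge a h k r S th om om' (x y : 'I_M) :
  (0 < h)%N -> 0 <= th -> (0 < S)%N -> (S.*2 <= k)%N -> (S.*2 <= r.+1)%N ->
  spread a h k om (th * h.*2%:R) x ->
  spread (a + k.+2 * h) h r om' (th * h.*2%:R) y ->
  beta * th ^+ 2 * (ln S%:R - 3) <=
    \sum_(i in clus a (a + k.+1 * h) om x)
      \sum_(j in clus (a + k.+2 * h) (a + k.+2 * h + r.+1 * h) om' y) kap (j - i).
Proof.
move=> h0 th0 S0 Sk Sr /andP[_ /forallP spx] /andP[_ /forallP spy].
set A := clus _ _ _ _ in spx *; set B := clus _ _ _ _ in spy *.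
pose I (u : 'I_S) := @itv M (a + (k - u.*2.+1) * h) (a + (k - u.*2.+1) * h + h.*2).
pose J (v : 'I_S) := @itv M (a + k.+2 * h + v.*2 * h) (a + k.+2 * h + v.*2 * h + h.*2).
have Idis u v i : i \in I u -> i \in I v -> u = v.
  rewrite !inE => /andP[h1 h2] /andP[h3 h4]; apply: val_inj.
  exact: sub_inj (ltn_ord u) (ltn_ord v) Sk (block_lt h1 h4) (block_lt h3 h2).
have Jdis u v i : i \in J u -> i \in J v -> u = v.
  rewrite !inE => /andP[h1 h2] /andP[h3 h4]; apply: val_inj.
  exact: double_inj (block_lt h1 h4) (block_lt h3 h2).
(* The gap of [h] sites keeps all distances at 2 or more, where [kap] follows the power law. *)
have IJ u v (i j : 'I_M) : i \in I u -> j \in J v -> (2 <= j - i <= 2 * (u + v + 3) * h)%N.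
  by rewrite !inE => h1 h2; exact: block_dist h0 Sk (ltn_ord u) h1 h2.
have cI u : th * h.*2%:R <= (#|A :&: I u|)%:R.
  have ku := left_index (ltn_ord u) Sk.
  exact: spx (Ordinal ku).
have cJ v : th * h.*2%:R <= (#|B :&: J v|)%:R.
  have vr := right_index (ltn_ord v) Sr.
  exact: spy (Ordinal vr).
have kap0 n : 0 <= kap n by exact: kap_ge0.
apply: le_trans (@sum_blocks_le A S I _ _ _) => //; last by move=> i; exact: sumr_ge0.
apply: (@le_trans _ _ (\sum_u \sum_(i in A :&: I u) \sum_v \sum_(j in B :&: J v) kap (j - i))); last first.
  by apply: ler_sum => u _; apply: ler_sum => i _; exact: sum_blocks_le.
apply: (@le_trans _ _ (\sum_(u < S) \sum_(v < S) (beta * th ^+ 2 * ((u + v + 3)%:R ^+ 2)^-1))).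
  under eq_bigr do rewrite -mulr_sumr.
  by rewrite -mulr_sumr ler_wpM2l ?double_sum_ge// mulr_ge0 ?exprn_ge0// ltW.
apply: ler_sum => u _; rewrite exchange_big; apply: ler_sum => v _ /=.
set d := (2 * (u + v + 3) * h)%N.
apply: (@le_trans _ _ (\sum_(i in A :&: I u) \sum_(j in B :&: J v) beta / d%:R ^+ 2)); last first.
  apply: ler_sum => i /finset.setIP[_ iI]; apply: ler_sum => j /finset.setIP[_ jJ].
  by have /andP[] := IJ _ _ _ _ iI jJ; exact: kap_far_ge.
have -> : \sum_(i in A :&: I u) \sum_(j in B :&: J v) beta / d%:R ^+ 2 =
    (#|A :&: I u|)%:R * ((#|B :&: J v|)%:R * (beta / d%:R ^+ 2)).
  by rewrite !sumr_const -[LHS]mulr_natl; congr (_ * _); rewrite -[LHS]mulr_natl.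
have hr : 0 < h%:R :> R by rewrite ltr0n.
apply: (@le_trans _ _ ((th * h.*2%:R) * ((th * h.*2%:R) * (beta / d%:R ^+ 2)))).
  have u0 : (u + v + 3)%:R != 0 :> R by rewrite pnatr_eq0 addn3.
  rewrite /d natrM natrM -mul2n natrM; move: u0; move: (_ + _)%:R => w w0.
  by rewrite le_eqVlt; apply/orP; left; apply/eqP; field; rewrite w0 gt_eqF.
have b0 : 0 <= beta / d%:R ^+ 2 by rewrite divr_ge0 ?exprn_ge0// ltW.
have t0 : 0 <= th * h.*2%:R by exact: mulr_ge0.
apply: ler_pM => //; first exact: mulr_ge0.
exact: ler_wpM2r.
Qed.

End ClusterCoupling.

(** * Random-cluster bounds uniform in the surroundings *)

Section Renormalization.
Variables (R : realType) (beta lambda : R) (Q M : nat).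
Hypotheses (beta0 : 0 < beta) (lambda0 : 0 < lambda).
Local Notation kap := (kap beta lambda).
Local Notation V := (option 'I_M).
Implicit Types (om X : {set V * V}) (D P : pred {set V * V}).

Definition kfree (e : V * V) : R :=
  match e with
  | (Some i, Some j) => if (i < j)%N then kap (j - i) else 0
  | _ => 0
  end.

Lemma kfree_ge0 e : 0 <= kfree e.
Proof. by case: e => [[i|] [j|]] //=; case: ifP => // _; exact: kap_ge0. Qed.

Definition fk_mass P : R := \sum_(om | P om) @fkw R Q 'I_M kfree om.

Let w0 om : 0 <= @fkw R Q 'I_M kfree om. Proof. by apply: fkw_ge0; exact: kfree_ge0. Qed.

Lemma fk_mass_ge0 P : 0 <= fk_mass P.
Proof. exact: sumr_ge0. Qed.

Lemma le_fk_mass P P' : (forall om, P om -> P' om) -> fk_mass P <= fk_mass P'.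
Proof.
move=> PP; rewrite /fk_mass [leRHS](bigID P) /= -[leLHS]addr0; apply: lerD; last exact: sumr_ge0.
rewrite le_eqVlt; apply/orP; left; apply/eqP; apply: eq_bigl => om.
by case: (boolP (P om)) => [/PP ->|]; rewrite ?andbF.
Qed.

Lemma fk_mass_union (I : finType) (C : pred I) P (F : I -> pred {set V * V}) :
  (forall om, P om -> exists2 i, C i & F i om) -> fk_mass P <= \sum_(i | C i) fk_mass (F i).
Proof.
move=> PF; rewrite /fk_mass.
under [leRHS]eq_bigr do rewrite big_mkcond; rewrite exchange_big big_mkcond /=.
apply: ler_sum => om _; case: ifPn => [/PF[i Ci Fi]|_]; last first.
  by apply: sumr_ge0 => i _; case: ifP.
by rewrite (bigD1 i) //= Fi lerDl; apply: sumr_ge0 => j _; case: ifP.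
Qed.

Definition indep X P := forall om, P (om :\: X)%SET = P om.

Lemma indepS X X' P : X \subset X' -> indep X' P -> indep X P.
Proof.
move=> /finset.setUidPr XX h om.
by rewrite -h finset.setDDl XX h.
Qed.

Lemma indep_and X P P' : indep X P -> indep X P' -> indep X (fun om => P om && P' om).
Proof. by move=> h h' om; rewrite h h'. Qed.

Lemma indep_not X P : indep X P -> indep X (fun om => ~~ P om).
Proof. by move=> h om; rewrite h. Qed.

Lemma indep_good X a b (t : R) : [disjoint X & internal M a b] -> indep X (fun om => good a b om t).
Proof. by move=> dis om; rewrite (@good_setD M R). Qed.

Lemma internal_disjoint a b c d : (b <= c)%N -> [disjoint internal M c d & internal M a b].
Proof.
move=> bc; apply/pred0P => -[[i|] [j|]]; rewrite /= ?inE ?andbF//.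
apply/negP => /andP[/andP[/andP[ci _] _] /andP[/andP[_ ib] _]].
by have := leq_trans (leq_trans ib bc) ci; rewrite ltnn.
Qed.

Definition cross a b c d : {set V * V} := [set e : V * V |
  match e with (Some i, Some j) => (i \in itv M a b) && (j \in itv M c d) | _ => false end]%SET.

Lemma cross_disjoint_left a b c d a' b' : (b' <= c)%N -> [disjoint cross a b c d & internal M a' b'].
Proof.
move=> bc; apply/pred0P => -[[i|] [j|]]; rewrite /= ?inE ?andbF//.
apply/negP => /andP[/andP[_ /andP[cj _]] /andP[_ /andP[_ jb]]].
by have := leq_trans (leq_trans jb bc) cj; rewrite ltnn.
Qed.

Lemma cross_disjoint_right a b c d a' b' : (b <= a')%N -> [disjoint cross a b c d & internal M a' b'].
Proof.
move=> bc; apply/pred0P => -[[i|] [j|]]; rewrite /= ?inE ?andbF//.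
apply/negP => /andP[/andP[/andP[_ ib] _] /andP[/andP[ai _] _]].
by have := leq_trans (leq_trans ib bc) ai; rewrite ltnn.
Qed.

Lemma cross_sub_internal a b c d a' b' : (a' <= a)%N -> (b <= b')%N -> (a' <= c)%N -> (d <= b')%N ->
  cross a b c d \subset internal M a' b'.
Proof.
move=> aa bb cc dd; apply/fintype.subsetP => -[[i|] [j|]]; rewrite !inE //.
move=> /andP[/andP[i1 i2] /andP[j1 j2]].
by rewrite (leq_trans aa i1) (leq_trans i2 bb) (leq_trans cc j1) (leq_trans j2 dd).
Qed.

(* Uniformly over what happens outside a block of [h.*2] sites, the block fails
   to have a cluster of density [th] with conditional probability at most [p]. *)
Definition block_bound h (th p : R) := forall a D, (a + h.*2 <= M)%N ->
  indep (internal M a (a + h.*2)) D ->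
  fk_mass (fun om => D om && ~~ good a (a + h.*2) om (th * h.*2%:R)) <= p * fk_mass D.

Section OneBadBlock.
Variables (h a k r S : nat) (th : R).
Hypotheses (h0 : (0 < h)%N) (th1 : 3 / 4 < th) (S0 : (0 < S)%N).
Hypotheses (Sk : (S.*2 <= k)%N) (Sr : (S.*2 <= r.+1)%N) (r0 : (0 < r)%N).
Hypothesis aM : (a + k.+2 * h + r.+1 * h <= M)%N.
Local Notation t := (th * h.*2%:R).
Local Notation c := (a + k.+2 * h)%N.

(** The choice made by [pick] reads only edges inside the left run. The cluster, and with it
    [cut_edges], thus ignores the edges between the runs, as [fk_closed_le] requires. *)
Let left_cluster om : {set 'I_M} :=
  if [pick x | spread a h k om t x] is Some x then clus a (a + k.+1 * h) om x else finset.set0.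

Let right_cluster om : {set 'I_M} :=
  if [pick x | spread c h r om t x] is Some x then clus c (c + r.+1 * h) om x else finset.set0.

Let crossing := cross a (a + k.+1 * h) c (c + r.+1 * h).

Definition cut_edges om : {set V * V} := [set e : V * V |
  match e with (Some i, Some j) => (i \in left_cluster om) && (j \in right_cluster om) | _ => false end]%SET.

Definition both_runs_good om := run_good a h k om t && run_good c h r om t.

Let dis_left : [disjoint crossing & internal M a (a + k.+1 * h)].
Proof. by apply: cross_disjoint_left; rewrite leq_add2l leq_mul2r leqnSn orbT. Qed.

Let dis_right : [disjoint crossing & internal M c (c + r.+1 * h)].
Proof. by apply: cross_disjoint_right; rewrite leq_add2l leq_mul2r leqnSn orbT. Qed.

Let spread_setD a' r' X om x : [disjoint X & internal M a' (a' + r'.+1 * h)] ->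
  spread a' h r' (om :\: X)%SET t x = spread a' h r' om t x.
Proof.
by move=> dis; congr (_ && _); apply: eq_forallb => j; rewrite clus_setD.
Qed.

Let left_setD om : left_cluster (om :\: crossing)%SET = left_cluster om.
Proof.
rewrite /left_cluster (eq_pick (fun x => spread_setD om x dis_left)).
by case: pickP => // x _; rewrite clus_setD.
Qed.

Let right_setD om : right_cluster (om :\: crossing)%SET = right_cluster om.
Proof.
rewrite /right_cluster (eq_pick (fun x => spread_setD om x dis_right)).
by case: pickP => // x _; rewrite clus_setD.
Qed.

Let run_good_setD a' r' om : [disjoint crossing & internal M a' (a' + r'.+1 * h)] ->
  run_good a' h r' (om :\: crossing)%SET t = run_good a' h r' om t.
Proof.
move=> dis; apply: eq_forallb => j; apply: (@good_setD M R).
apply: disjointWr dis; apply: internalS; first exact: leq_addr.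
rewrite -addnA leq_add2l -mul2n -mulnDl leq_mul2r addn2 ltnS; apply/orP; right.
by have := ltn_ord j.
Qed.

Let lt0 : 3 / 2 * h%:R < t.
Proof.
have -> : h.*2%:R = 2 * h%:R :> R by rewrite -mul2n natrM.
by rewrite [ltRHS]mulrA ltr_pM2r ?ltr0n//; move: th1; lra.
Qed.

(** All [cut_edges] join the same two clusters: [fk_closed_le] pays [Q.+1] only once and gains the
    exponential of their total coupling, bounded below by [cluster_coupling_ge]. *)
Lemma fk_mass_cut_le D : indep crossing D ->
  fk_mass (fun om => [&& D om, both_runs_good om & [disjoint om & cut_edges om]]) <=
    Q.+1%:R * expR (- (beta * th ^+ 2 * (ln S%:R - 3))) * fk_mass D.
Proof.
move=> iD; set K := _ * expR _.
pose P om := D om && both_runs_good om.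
pose lpt om : V := [pick x | spread a h k om t x].
pose rpt om : V := [pick x | spread c h r om t x].
apply: (@le_trans _ _ (K * fk_mass P)); last first.
  apply: ler_wpM2l; first by rewrite mulr_ge0// expR_ge0.
  by apply: le_fk_mass => om /andP[].
rewrite /fk_mass (eq_bigl (fun om => P om && [disjoint om & cut_edges om])); last first.
  by move=> om; rewrite /P -andbA.
apply: (@fk_closed_le R Q 'I_M kfree P crossing cut_edges lpt rpt K).
- exact: kfree_ge0.
- move=> om; apply/fintype.subsetP => -[[i|] [j|]]; rewrite !inE // => /andP[].
  rewrite /left_cluster /right_cluster.
  case: pickP => [x _|_]; last by rewrite inE.
  case: pickP => [y _|_]; last by move=> _; rewrite inE.
  by rewrite !inE => /andP[-> _] /andP[-> _].
- by move=> om; apply/setP => -[[i|] [j|]]; rewrite !inE // left_setD right_setD.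
- move=> om; rewrite /P iD; congr (_ && _).
  by rewrite /both_runs_good !run_good_setD.
- move=> om s /andP[_ _] cs; rewrite /lpt /rpt => e.
  apply/forall_inP => -[[i|] [j|]]; rewrite !inE // -left_setD -right_setD => /andP[].
  move: e; rewrite /left_cluster /right_cluster.
  rewrite (eq_pick (fun x => spread_setD om x dis_left)) (eq_pick (fun x => spread_setD om x dis_right)).
  case: pickP => [x _|_]; last by rewrite inE.
  case: pickP => [y _|_]; last by move=> _ _; rewrite inE.
  move=> /= sxy; rewrite !inE => /andP[_ xi] /andP[_ yj].
  by rewrite /agree /= -(connect_agree cs xi) -(connect_agree cs yj) sxy.
move=> om /andP[_ /andP[gl gr]]; rewrite /K ler_pM2l ?ltr0n// ler_expR lerN2.
have kM : (a + k.+1 * h <= M)%N.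
  apply: leq_trans aM; apply: leq_trans (leq_addr (r.+1 * h) c).
  by rewrite leq_add2l leq_mul2r leqnSn orbT.
have k0 : (0 < k)%N by apply: leq_trans Sk; rewrite double_gt0.
have [x0 x0P] := run_spread k0 kM lt0 gl; have [y0 y0P] := run_spread r0 aM lt0 gr.
have -> : \sum_(e in cut_edges om) kfree e =
    \sum_(i in left_cluster om) \sum_(j in right_cluster om) kap (j - i).
  rewrite big_mkcond sum_pair sum_option big1 ?add0r => [|v _]; last by rewrite inE.
  rewrite [RHS]big_mkcond; apply: eq_bigr => i _; rewrite sum_option inE add0r.
  case: ifPn => il; last by rewrite big1// => j _; rewrite inE (negPf il).
  rewrite [RHS]big_mkcond; apply: eq_bigr => j _; rewrite inE il /=.
  case: ifPn => // jr; rewrite ifT//; move: il jr; rewrite /left_cluster /right_cluster.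
  case: pickP => [x _|_]; last by rewrite inE.
  case: pickP => [y _|_]; last by move=> _; rewrite inE.
  rewrite !inE => /andP[/andP[_ ik] _] /andP[/andP[cj _] _].
  by apply: leq_trans ik _; apply: leq_trans cj; rewrite leq_add2l leq_mul2r leqnSn orbT.
rewrite /left_cluster /right_cluster.
case: pickP => [x xP|/(_ x0)]; last by rewrite x0P.
case: pickP => [y yP|/(_ y0)]; last by rewrite y0P.
by apply: (@cluster_coupling_ge R beta lambda beta0 lambda0 M a h k r S th om om) => //; move: th1; lra.
Qed.

End OneBadBlock.
End Renormalization.

(** * Anatomy of a bad block *)

Section Trichotomy.
Variables (R : realType) (M : nat).
Local Notation V := (option 'I_M).
Variables (h a C S : nat) (th th' : R) (om : {set V * V}).
Hypotheses (h0 : (0 < h)%N) (th1 : 3 / 4 < th) (S0 : (0 < S)%N) (SC : (S.+2 <= C)%N).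
Hypothesis aM : (a + (C * h).*2 <= M)%N.
Hypothesis thC : th' * C%:R <= th * (C - S.+1)%:R.
Local Notation t := (th * h.*2%:R).
Local Notation t' := (th' * (C * h).*2%:R).
Local Notation b := (a + (C * h).*2)%N.

Let bad k := ~~ good (a + k * h) (a + k * h + h.*2) om t.

Let t0 : 0 <= t. Proof. by rewrite mulr_ge0//; move: th1; lra. Qed.

Let bE : b = (a + C.*2 * h)%N.
Proof. by rewrite doubleMl. Qed.

Let tt' : t' <= (C - S.+1)%:R * t.
Proof.
have -> : (C * h).*2%:R = C%:R * h.*2%:R :> R by rewrite -natrM -doubleMr.
by rewrite mulrA mulrCA mulrA ler_wpM2r// [leRHS]mulrC.
Qed.

Let lt0 : 3 / 2 * h%:R < t.
Proof.
have -> : h.*2%:R = 2 * h%:R :> R by rewrite -mul2n natrM.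
by rewrite [ltRHS]mulrA ltr_pM2r ?ltr0n//; move: th1; lra.
Qed.

Let good_card x n (T : {set 'I_M}) : x \in itv M a b -> T \subset clus a b om x ->
  (C - S.+1 <= n)%N -> n%:R * t <= (#|T|)%:R -> good a b om t'.
Proof.
move=> xi Tx Cn nT; apply/existsP; exists x; rewrite xi /=.
apply: (le_trans tt'); apply: le_trans (_ : n%:R * t <= _); first by rewrite ler_wpM2r// ler_nat.
by apply: le_trans nT _; rewrite ler_nat subset_leq_card.
Qed.

Let clusS x a1 b1 : (a <= a1)%N -> (b1 <= b)%N -> clus a1 b1 om x \subset clus a b om x.
Proof.
move=> aa bb; apply/fintype.subsetP => y; rewrite !inE => /andP[/andP[y1 y2] c].
by rewrite (leq_trans aa y1) (leq_trans y2 bb) /=; exact: connectS aa bb c.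
Qed.

Let run_good_card c r : (0 < r)%N -> (a <= c)%N -> (c + r.+1 * h <= b)%N ->
  (C - S.+1 <= r.+1./2)%N -> run_good c h r om t -> good a b om t'.
Proof.
move=> r0 ac cb Cr rg; have [x sx] := run_spread r0 (leq_trans cb aM) lt0 rg.
have /andP[xi _] := sx.
have /fintype.subsetP sub := @itvS M _ _ _ _ ac cb.
by apply: (good_card (sub _ xi) _ Cr (spread_card t0 sx)); exact: clusS.
Qed.

Let nat_left k : (k < C.*2.-1)%N -> (C.*2 <= k + S.*2 + 3)%N ->
  [/\ (0 < k)%N, (k.+1 <= C.*2)%N & (C - S.+1 <= k.+1./2)%N].
Proof. move: SC; split; lia. Qed.

Let nat_right k : (k < S.*2)%N ->
  [/\ (0 < C.*2 - 3 - k)%N, (k.+2 + (C.*2 - 3 - k).+1 = C.*2)%N &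
      (C - S.+1 <= (C.*2 - 3 - k).+1./2)%N].
Proof. move: SC; split; lia. Qed.

Let nat_mid k : (S.*2 <= k)%N -> (k + S.*2 + 3 < C.*2)%N ->
  [/\ (0 < C.*2 - 3 - k)%N, (k.+2 + (C.*2 - 3 - k).+1 = C.*2)%N, (0 < k)%N &
      (C - S.+1 <= k.+1./2 + (C.*2 - 3 - k).+1./2)%N].
Proof. move: SC S0; split; lia. Qed.

Let full : (0 < C.*2.-1)%N /\ (C.*2.-1.+1 = C.*2)%N.
Proof. move: SC; split; lia. Qed.

(** Let k be the first bad sub-block. If none is bad from k + 2 on, the runs before k and from k + 2
    are good. When k is near an end, the longer run alone has enough sites; otherwise the two
    clusters do together once an edge joins them. In all cases at least C - S - 1 disjoint
    sub-blocks are dense, which is the loss that [thC] allows. *)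
Lemma block_trichotomy : ~~ good a b om t' ->
  (exists p : 'I_(C.*2) * 'I_(C.*2), [/\ (p.1 + 2 <= p.2)%N, (p.2 < C.*2.-1)%N, bad p.1 & bad p.2])
  \/ (exists k : 'I_(C.*2), [/\ (S.*2 <= k)%N, (k + S.*2 + 3 < C.*2)%N, bad k &
      both_runs_good h a k (C.*2 - 3 - k) th om &&
      [disjoint om & cut_edges h a k (C.*2 - 3 - k) th om]]).
Proof.
move=> ng; have [B0 BE] := full.
have [/existsP ex|/existsPn nex] := boolP [exists k : 'I_(C.*2.-1), bad k]; last first.
  case/negP: ng; apply: (@run_good_card a C.*2.-1) => //; rewrite ?BE -?bE//.
    by rewrite doubleK leq_subr.
  by apply/forallP => k; have := nex k; rewrite negbK.
have ex' : exists k, (k < C.*2.-1)%N && bad k.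
  by case: ex => k bk; exists k; rewrite ltn_ord.
have [k /andP[kB bk] kmin] := ex_minnP ex'.
have kN : (k < C.*2)%N by rewrite -BE ltnW.
have [/existsP[l /andP[kl bl]]|/existsPn far] :=
    boolP [exists l : 'I_(C.*2.-1), (k + 2 <= l)%N && bad l].
  have lN : (l < C.*2)%N by exact: leq_trans (ltn_ord l) (leq_pred _).
  by left; exists (Ordinal kN, Ordinal lN); split => //=; exact: ltn_ord.
have left_good : run_good a h k om t.
  apply/forallP => j; apply: contraT => bj.
  have : (k <= j)%N by apply: kmin; apply/andP; split; [exact: ltn_trans (ltn_ord j) kB|exact: bj].
  by rewrite leqNgt ltn_ord.
have right_good r : (k.+2 + r < C.*2)%N -> run_good (a + k.+2 * h) h r om t.
  move=> kr; apply/forallP => j.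
  have jB : (k.+2 + j < C.*2.-1)%N.
    by rewrite -ltnS BE; apply: leq_ltn_trans kr; rewrite -addnS leq_add2l ltn_ord.
  have := far (Ordinal jB); rewrite /= addn2 leq_addr /= negbK.
  by rewrite mulnDl addnA.
right.
have [kS|Sk] := ltnP k S.*2.
  have [r0 rE rC] := nat_right kS.
  case/negP: ng; apply: (@run_good_card (a + k.+2 * h) (C.*2 - 3 - k)) => //.
  - exact: leq_addr.
  - by rewrite -addnA -mulnDl rE bE.
  by apply: right_good; rewrite -addnS; exact: eq_leq rE.
have [kR|kR] := leqP C.*2 (k + S.*2 + 3).
  have [k0 kE kC] := nat_left kB kR.
  case/negP: ng; apply: (@run_good_card a k) => //.
  by rewrite bE leq_add2l leq_mul2r kE orbT.
have [r0 rE k0 rC] := nat_mid Sk kR.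
exists (Ordinal kN); split => //=.
have rg : run_good (a + k.+2 * h) h (C.*2 - 3 - k) om t.
  by apply: right_good; rewrite -addnS; exact: eq_leq rE.
rewrite /both_runs_good left_good rg /=; apply/negPn/negP => /pred0Pn[e /= /andP[eo]].
have cb : (a + k.+2 * h + (C.*2 - 3 - k).+1 * h = b)%N by rewrite -addnA -mulnDl rE bE.
have kb : (a + k.+1 * h <= b)%N.
  by rewrite bE leq_add2l leq_mul2r kN orbT.
case: e eo => [[i|] [j|]] eo; rewrite inE //.
case: pickP => [x sx|_]; last by rewrite inE.
case: pickP => [y sy|_]; last by rewrite [j \in _]inE andbF.
move=> /andP[ix jy]; case/negP: ng.
have /andP[xi _] := sx.
have xb : x \in itv M a b by have /fintype.subsetP := @itvS M _ _ _ _ (leqnn a) kb; apply.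
have T1 := @clusS x a (a + k.+1 * h) (leqnn a) kb.
have T2 := @clusS y (a + k.+2 * h) _ (leq_addr _ _) (eq_leq cb).
have xy : connect (adj a b om) x y.
  have /andP[ib xib] : (i \in itv M a b) && connect (adj a b om) x i.
    by have := fintype.subsetP T1 _ ix; rewrite inE.
  have /andP[jb yjb] : (j \in itv M a b) && connect (adj a b om) y j.
    by have := fintype.subsetP T2 _ jy; rewrite inE.
  apply: connect_trans xib _; apply: (@connect_trans _ _ j).
    by apply: connect1; rewrite /adj ib jb eo.
  by rewrite (sym_connect_sym (@adj_sym _ _ _ _)).
pose T := (clus a (a + k.+1 * h) om x :|: clus (a + k.+2 * h) (a + k.+2 * h + (C.*2 - 3 - k).+1 * h) om y)%SET.
apply: (@good_card x _ T xb _ rC).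
  rewrite finset.subUset T1 /=; apply: fintype.subset_trans T2 _.
  apply/fintype.subsetP => z; rewrite !inE => /andP[-> c].
  exact: connect_trans xy c.
rewrite /T cardsU (_ : (_ :&: _)%SET = finset.set0) ?cards0 ?subn0.
  by rewrite !natrD mulrDl lerD// spread_card.
apply/setP => z; rewrite finset.in_setI [in RHS]inE; apply/negbTE/negP.
rewrite !inE => /andP[/andP[/andP[_ z1] _] /andP[/andP[z2 _] _]].
have ak : (a + k.+1 * h <= a + k.+2 * h)%N by rewrite leq_add2l leq_mul2r leqnSn orbT.
by have := leq_trans z1 (leq_trans ak z2); rewrite ltnn.
Qed.

End Trichotomy.

(** * The induction step *)

Section RenormalizationStep.
Variables (R : realType) (beta lambda : R) (Q M : nat).
Hypotheses (beta0 : 0 < beta) (lambda0 : 0 < lambda).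
Local Notation V := (option 'I_M).
Local Notation mass := (@fk_mass R beta lambda Q M).
Local Notation block_bound := (@block_bound R beta lambda Q M).

(** Union bound over the outcomes of [block_trichotomy]. For two bad sub-blocks the hypothesis is
    used twice, since the edges of one lie outside the other. For a single one, the cut costs the
    exponential factor, the event that sub-block k is bad being independent of the edges between the
    runs, and that event costs a further p. *)
Lemma block_bound_step h C S (th th' p : R) :
  (0 < h)%N -> 3 / 4 < th -> (0 < S)%N -> (S.+2 <= C)%N -> 0 <= p ->
  th' * C%:R <= th * (C - S.+1)%:R ->
  block_bound h th p ->
  block_bound (C * h) th' ((C.*2)%:R ^+ 2 * p ^+ 2 +
    (C.*2)%:R * (Q.+1%:R * expR (- (beta * th ^+ 2 * (ln S%:R - 3)))) * p).
Proof.
move=> h0 th1 S0 SC p0 thC H a D aM iD.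
set K := Q.+1%:R * expR _.
have K0 : 0 <= K by rewrite mulr_ge0// expR_ge0.
pose bad k (om : {set V * V}) := ~~ good (a + k * h) (a + k * h + h.*2) om (th * h.*2%:R).
have bE : (a + (C * h).*2 = a + C.*2 * h)%N by rewrite doubleMl.
have hM k : (k.+2 <= C.*2)%N -> (a + k * h + h.*2 <= a + (C * h).*2)%N.
  move=> kC; rewrite bE -addnA leq_add2l -mul2n -mulnDl leq_mul2r; apply/orP; right.
  by rewrite addn2.
have iDk k : (k.+2 <= C.*2)%N -> indep (internal M (a + k * h) (a + k * h + h.*2)) D.
  move=> kC; apply: indepS iD; apply: internalS; [exact: leq_addr|exact: hM].
have Hk k P : (k.+2 <= C.*2)%N -> indep (internal M (a + k * h) (a + k * h + h.*2)) P ->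
    mass (fun om => P om && bad k om) <= p * mass P.
  by move=> kC iP; apply: H => //; exact: leq_trans (hM k kC) aM.
pose far2 (q : 'I_(C.*2) * 'I_(C.*2)) := (q.1 + 2 <= q.2)%N && (q.2 < C.*2.-1)%N.
pose mid (k : 'I_(C.*2)) := (S.*2 <= k)%N && (k + S.*2 + 3 < C.*2)%N.
pose F1 (q : 'I_(C.*2) * 'I_(C.*2)) : pred {set V * V} := fun om => D om && bad q.1 om && bad q.2 om.
pose F2 (k : 'I_(C.*2)) : pred {set V * V} := fun om => [&& D om && bad k om,
  both_runs_good h a k (C.*2 - 3 - k) th om & [disjoint om & cut_edges h a k (C.*2 - 3 - k) th om]].
have Z0 P : 0 <= mass P by exact: fk_mass_ge0.
have u1 q : far2 q -> mass (F1 q) <= p ^+ 2 * mass D.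
  move=> /andP[q12 q2].
  have q2C : (q.2.+2 <= C.*2)%N by rewrite -ltn_predRL.
  have q1C : (q.1.+2 <= C.*2)%N by apply: leq_trans (ltnW q2C); rewrite -addn2 (leq_trans q12).
  apply: (@le_trans _ _ (p * mass (fun om => D om && bad q.1 om))).
    apply: Hk => //; apply: indep_and; first exact: iDk.
    apply: indep_not; apply: indep_good; apply: internal_disjoint.
    rewrite -addnA leq_add2l -[h.*2]mul2n -mulnDl leq_mul2r; apply/orP; right.
    exact: q12.
  rewrite expr2 -mulrA ler_wpM2l//; apply: Hk => //; exact: iDk.
have u2 k : mid k -> mass (F2 k) <= K * p * mass D.
  move=> /andP[k1 k2].
  have [r0 rE rS kC] : [/\ (0 < C.*2 - 3 - k)%N, (k.+2 + (C.*2 - 3 - k).+1 = C.*2)%N,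
      (S.*2 <= (C.*2 - 3 - k).+1)%N & (k.+2 <= C.*2)%N] by move: S0 k1 k2; clear; split; lia.
  have cb : (a + k.+2 * h + (C.*2 - 3 - k).+1 * h = a + (C * h).*2)%N.
    by rewrite -addnA -mulnDl rE bE.
  have cM : (a + k.+2 * h + (C.*2 - 3 - k).+1 * h <= M)%N by rewrite cb.
  rewrite -mulrA; apply: (@le_trans _ _ (K * mass (fun om => D om && bad k om))); last first.
    by rewrite ler_wpM2l//; apply: Hk => //; exact: iDk.
  apply: fk_mass_cut_le => //; apply: indep_and.
    apply: indepS iD; apply: cross_sub_internal => //.
    - by rewrite bE leq_add2l leq_mul2r (ltn_ord k) orbT.
    - exact: leq_addr.
    - by rewrite cb.
  apply: indep_not; apply: indep_good; apply: cross_disjoint_left.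
  by rewrite -addnA leq_add2l -[h.*2]mul2n -mulnDl addn2.
have u3 : mass (fun om => D om && ~~ good a (a + (C * h).*2) om (th' * (C * h).*2%:R)) <=
    \sum_(q | far2 q) mass (F1 q) + \sum_(k | mid k) mass (F2 k).
  apply: (@le_trans _ _ (mass (fun om => [exists q, far2 q && F1 q om]) +
    mass (fun om => [exists k, mid k && F2 k om]))).
    have := @fk_mass_union R beta lambda Q M beta0 lambda0 bool xpredT
      (fun om => D om && ~~ good a (a + (C * h).*2) om (th' * (C * h).*2%:R))
      (fun b om => if b then [exists q, far2 q && F1 q om] else [exists k, mid k && F2 k om]).
    rewrite big_bool; apply => om /andP[Dom ng].
    have [[q [q1 q2 b1 b2]]|[k [k1 k2 bk br]]] := block_trichotomy h0 th1 S0 SC aM thC ng.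
      by exists true => //; apply/existsP; exists q; rewrite /far2 /F1 q1 q2 Dom /bad b1 b2.
    by exists false => //; apply/existsP; exists k; rewrite /mid /F2 k1 k2 Dom /bad bk br.
  apply: lerD; apply: fk_mass_union => // om /existsP[i /andP[]]; by exists i.
apply: le_trans u3 _; rewrite mulrDl; apply: lerD.
  apply: (@le_trans _ _ (\sum_(q : 'I_(C.*2) * 'I_(C.*2)) p ^+ 2 * mass D)).
    rewrite big_mkcond; apply: ler_sum => q _; case: ifP => [/u1//|_].
    by rewrite mulr_ge0 ?sqr_ge0.
  by rewrite sumr_const card_prod card_ord -[leLHS]mulr_natl natrM -expr2 mulrA.
apply: (@le_trans _ _ (\sum_(k : 'I_(C.*2)) K * p * mass D)).
  rewrite big_mkcond; apply: ler_sum => k _; case: ifP => [/u2//|_].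
  by rewrite !mulr_ge0.
by rewrite sumr_const card_ord -[leLHS]mulr_natl !mulrA.
Qed.

End RenormalizationStep.

(** * The initial scale *)

Section BaseScale.
Variables (R : realType) (beta lambda : R) (Q M : nat).
Hypotheses (beta0 : 0 < beta) (lambda0 : 0 < lambda).
Local Notation V := (option 'I_M).
Local Notation mass := (@fk_mass R beta lambda Q M).
Local Notation kfree := (@kfree R beta lambda M).

Lemma fk_mass_edge_closed_le (i j : 'I_M) (D : pred {set V * V}) :
  indep [set (Some i, Some j)]%SET D -> j = i.+1 :> nat ->
  mass (fun om => D om && ((Some i, Some j) \notin om)) <= Q.+1%:R * expR (- lambda) * mass D.
Proof.
move=> iD ij; rewrite /fk_mass.
rewrite (eq_bigl (fun om => D om && [disjoint om & [set (Some i, Some j)]%SET])); last first.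
  by move=> om; rewrite disjoint_sym disjoints1.
apply: (@fk_closed_le R Q 'I_M kfree D [set (Some i, Some j)]%SET
  (fun=> [set (Some i, Some j)]%SET) (fun=> Some i) (fun=> Some j)) => //.
- exact: kfree_ge0.
- by move=> om s _ _ e; rewrite compat1 /agree e.
move=> om _; rewrite big_set1 /= ij ltnSn subSnn.
by rewrite kapE eqxx.
Qed.

Lemma connect_path a n (om : {set V * V}) (x y : 'I_M) : x = a :> nat ->
  (forall i j : 'I_M, (a <= i)%N -> j = i.+1 :> nat -> (j < a + n)%N -> (Some i, Some j) \in om) ->
  (a <= y < a + n)%N -> connect (adj a (a + n) om) x y.
Proof.
move=> xa edges; case: y => y yM /= /andP[]; elim: y yM => [|y IH] yM ay yn.
  have -> : x = Ordinal yM by apply: val_inj => /=; rewrite xa; move: ay; rewrite leqn0 => /eqP.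
  exact: connect0.
move: ay; rewrite leq_eqVlt => /orP[/eqP ay|ay].
  by have -> : x = Ordinal yM by apply: val_inj; rewrite /= xa.
rewrite ltnS in ay; have yM' : (y < M)%N by exact: ltnW.
apply: connect_trans (IH yM' ay (ltnW yn)) _; apply: connect1.
rewrite /adj !inE /= ay (ltnW yn) yn (leq_trans ay (leqnSn y)) /=.
by rewrite (edges (Ordinal yM') (Ordinal yM)).
Qed.

(** A block whose nearest-neighbour edges are all open is a single cluster, of density 1; the rest
    is a union bound over these edges. *)
Lemma block_bound_base h : (0 < h)%N ->
  block_bound beta lambda Q M h 1 (h.*2%:R * (Q.+1%:R * expR (- lambda))).
Proof.
move=> h0 a D aM iD; set n := h.*2 in aM iD *.
have n0 : (0 < n)%N by rewrite double_gt0.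
pose F (u : 'I_n) : pred {set V * V} := fun om => D om &&
  [exists i : 'I_M, exists j : 'I_M, [&& i == (a + u)%N :> nat, j == (a + u).+1 :> nat,
    (j < a + n)%N & (Some i, Some j) \notin om]].
have Z0 : 0 <= mass D by exact: fk_mass_ge0.
have K0 : 0 <= Q.+1%:R * expR (- lambda) * mass D.
  by rewrite !mulr_ge0// expR_ge0.
apply: (@le_trans _ _ (\sum_u mass (F u))); last first.
  rewrite -mulrA mulr_natl -[X in _ <= _ *+ X]card_ord -sumr_const; apply: ler_sum => u _.
  have [uM|Mu] := ltnP (a + u).+1 (a + n); last first.
    apply: le_trans K0; rewrite /fk_mass big1// => om /andP[_] /existsP[i /existsP[j]].
    by move=> /and4P[_ /eqP -> h1 _]; rewrite ltnNge Mu in h1.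
  have jM : ((a + u).+1 < M)%N by exact: leq_trans uM aM.
  pose i := Ordinal (ltnW jM); pose j := Ordinal jM.
  apply: le_trans (_ : mass (fun om => D om && ((Some i, Some j) \notin om)) <= _).
    apply: le_fk_mass => // om /andP[-> /existsP[i' /existsP[j' /and4P[/eqP i1 /eqP j1 _]]]].
    have -> : i' = i by apply: val_inj.
    by have -> : j' = j by apply: val_inj.
  apply: fk_mass_edge_closed_le => //; apply: indepS iD.
  rewrite finset.sub1set !inE /= leq_addr ltn_add2l ltn_ord (leq_trans (leq_addr u a) (leqnSn _)).
  exact: uM.
apply: fk_mass_union => // om /andP[Dom ng].
have [/existsP[u Fu]|/existsPn nF] := boolP [exists u, F u om]; first by exists u.
case/negP: ng; have aM' : (a < M)%N by apply: leq_trans aM; rewrite -addn1 leq_add2l.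
apply/existsP; exists (Ordinal aM'); rewrite inE /= leqnn -[X in (X < _)%N]addn0 ltn_add2l n0 /=.
rewrite mul1r ler_nat -[X in (X <= _)%N](addKn a) -(@card_itv M a (a + n))// ?leq_addr//.
apply: subset_leq_card; apply/fintype.subsetP => y yi; rewrite inE yi /=.
rewrite inE in yi; apply: connect_path => // i j ai ij jn.
have ua : (i - a < n)%N by rewrite ltn_subLR// (leq_trans _ jn)// ij ltnW.
have := nF (Ordinal ua); rewrite /F Dom /= => /existsPn/(_ i)/existsPn/(_ j).
by rewrite subnKC// ij eqxx eqxx -ij jn /= negbK.
Qed.

Lemma block_bound_le h (th th' p p' : R) : th' <= th -> p <= p' ->
  block_bound beta lambda Q M h th p -> block_bound beta lambda Q M h th' p'.
Proof.
move=> tt pp H a D aM iD; apply: (@le_trans _ _ (p * mass D)); last first.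
  by rewrite ler_wpM2r// fk_mass_ge0.
apply: le_trans (H a D aM iD); apply: le_fk_mass => // om /andP[-> /=]; apply: contra.
move=> /existsP[x /andP[xi xt]]; apply/existsP; exists x; rewrite xi.
by apply: le_trans xt; rewrite ler_wpM2r.
Qed.

End BaseScale.

(** * Choice of the scales *)

Section Iteration.
Variables (R : realType) (beta : R) (Q : nat).
Hypothesis beta1 : 1 < beta.

(* At scale [m] the blocks have [2 h_m] sites; the next scale is [s ^ al] times
   larger with [s = s_m], a fraction of order [1 / s] of the density is lost,
   and the failure probability [s ^ - (2 al + 1)] is divided by [2 ^ (2 al + 1)]. *)
Lemma long_range_blocks : exists (lambda : R) (h : nat -> nat),
  0 < lambda /\ forall m, (m < h m)%N /\
    forall M, block_bound beta lambda Q M (h m) (3 / 4) (1 / 2).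
Proof.
have beta0 : 0 < beta by exact: lt_trans beta1.
have beta1' := beta1.
have [th0 [th01 th02 b1]] : exists th0 : R, [/\ 3 / 4 < th0, th0 < 1 & 1 < beta * th0 ^+ 2].
  (* For th0 = 1 - u, beta th0^2 is at least beta - 2 beta u >= (beta + 1) / 2 > 1, and u <= 1/8
     keeps th0 above 3/4. *)
  pose u : R := Num.min (1 / 8) ((beta - 1) / (4 * beta)).
  have u0 : 0 < u by rewrite lt_min !divr_gt0 ?mulr_gt0 ?subr_gt0.
  have u1 : u <= 1 / 8 by rewrite ge_min lexx.
  have u2 : beta * u <= (beta - 1) / 4.
    have : u <= (beta - 1) / (4 * beta) by rewrite ge_min lexx orbT.
    by rewrite ler_pdivlMr ?mulr_gt0//; lra.
  clearbody u; exists (1 - u); split; [lra|lra|].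
  have : 0 <= beta * u ^+ 2 by rewrite mulr_ge0 ?sqr_ge0//; lra.
  rewrite sqrrB expr1n mul1r; lra.
set b := beta * th0 ^+ 2 in b1.
(* With C = s^al and S = s^al', positions against cut cost give C S^(- b) = s^(1 - (b - 1) al'),
   which must be at most 1 / s. *)
have [al' al1] : exists n : nat, 2 <= (b - 1) * n%:R.
  exists (Num.bound (2 / (b - 1))); rewrite mulrC -ler_pdivrMr; last by lra.
  by rewrite ltW// archi_boundP// divr_ge0//; lra.
pose al := al'.+1; pose B := (2 * al).+1.
(* In turn: the initial density is at most 1, each step gains the factor 2^(- B), and s is at least
   32. *)
have [s0 [s01 s02 s03]] : exists m0 : nat, [/\ 4 / (2 ^ m0)%:R <= 1 - th0,
    (4 + 2 * Q.+1%:R * expR (3 * b)) * (2 ^ B)%:R <= (2 ^ m0)%:R & (5 <= m0)%N].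
  have arch (x : R) m0 : 0 <= x -> (Num.bound x <= m0)%N -> x <= (2 ^ m0)%:R.
    move=> x0 xm; apply: (@le_trans _ _ (Num.bound x)%:R); first by rewrite ltW// archi_boundP.
    by rewrite ler_nat (leq_trans xm)// ltnW// ltn_expl.
  pose x := 4 / (1 - th0); pose y := (4 + 2 * Q.+1%:R * expR (3 * b)) * (2 ^ B)%:R.
  have x0 : 0 <= x by rewrite divr_ge0//; lra.
  have y0 : 0 <= y by rewrite mulr_ge0// addr_ge0// mulr_ge0 ?expR_ge0// mulr_ge0.
  exists (Num.bound x + Num.bound y + 5)%N; split.
  - rewrite ler_pdivrMr ?ltr0n ?expn_gt0// mulrC -ler_pdivrMr; last by lra.
    by apply: arch => //; rewrite -addnA leq_addr.
  - by apply: arch => //; rewrite addnAC leq_addl.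
  - by rewrite leq_addl.
pose s m := (2 ^ (m + s0))%N.
have s_gt0 m : (0 < s m)%N by rewrite expn_gt0.
have sr0 m : 0 < (s m)%:R :> R by rewrite ltr0n.
have sS m : s m.+1 = (2 * s m)%N by rewrite /s addSn expnS.
have s_ge m : (2 ^ s0 <= s m)%N by rewrite leq_exp2l// leq_addl.
have s_ge32 m : (32 <= s m)%N by apply: leq_trans (s_ge m); rewrite -[32%N]/(2 ^ 5)%N leq_exp2l.
pose h := fix h m := if m is m'.+1 then (s m' ^ al * h m')%N else 1%N.
pose p m : R := ((s m)%:R ^+ B)^-1.
pose th m : R := th0 + 4 / (s m)%:R.
have p_gt0 m : 0 < p m by rewrite invr_gt0 exprn_gt0.
have h_gt0 m : (0 < h m)%N by elim: m => //= m IH; rewrite muln_gt0 IH expn_gt0 s_gt0.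
have h_gt m : (m < h m)%N.
  elim: m => // m IH /=; apply: leq_trans (_ : 2 * h m <= _)%N.
    by rewrite mul2n -addnn; apply: leq_trans (leq_add IH (h_gt0 m)); rewrite addn1.
  rewrite leq_mul2r; apply/orP; right; apply: leq_trans (_ : s m <= _)%N.
    by apply: leq_trans (s_ge32 m).
  by rewrite /al expnS leq_pmulr// expn_gt0 s_gt0.
(* Fixed by the initial scale alone: blocks of two sites then fail with probability at most p 0. *)
pose lambda : R := Num.max 1 (ln (2 * Q.+1%:R / p 0)).
have l0 : 0 < lambda by rewrite lt_max ltr01.
exists lambda, h; split => // m; split => // M.
suff H : block_bound beta lambda Q M (h m) (th m) (p m).
  have h1 : 3 / 4 <= th m by rewrite /th; have := divr_ge0 (ler0n R 4) (ltW (sr0 m)); lra.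
  have h2 : p m <= 1 / 2.
    rewrite /p div1r lef_pV2 ?posrE ?exprn_gt0//.
    apply: (@le_trans _ _ (s m)%:R); first by rewrite (ler_nat _ 2) (leq_trans _ (s_ge32 m)).
    by rewrite exprS ler_peMr ?ler0n// exprn_ege1// ler1n.
  exact: block_bound_le h1 h2 H.
elim: m => [|m IH].
  have := @block_bound_base R beta lambda Q M (lt_trans ltr01 beta1) l0 1 isT.
  apply: block_bound_le => //; first by rewrite /th /s add0n; lra.
  have h1 : ln (2 * Q.+1%:R / p 0) <= lambda by rewrite le_max lexx orbT.
  have x0 : 0 < 2 * Q.+1%:R / p 0 by rewrite divr_gt0 ?mulr_gt0.
  have : expR (- lambda) <= (2 * Q.+1%:R / p 0)^-1.
    by rewrite expRN lef_pV2 ?posrE ?expR_gt0// -[leLHS]lnK// ler_expR.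
  rewrite invf_div ler_pdivlMr ?mulr_gt0// => h2; apply: le_trans h2.
  by rewrite mulrA [leRHS]mulrC.
pose C := (s m ^ al)%N; pose S := (s m ^ al')%N.
have S0 : (0 < S)%N by rewrite expn_gt0 s_gt0.
have CS : C = (s m * S)%N by rewrite /C /al expnS.
have SC : (S.+2 <= C)%N.
  rewrite CS; apply: leq_trans (_ : 32 * S <= _)%N; last by rewrite leq_mul2r s_ge32 orbT.
  by rewrite -(@leq_add2r S) in S0 *; lia.
have thm0 : th0 <= th m by rewrite /th lerDl divr_ge0.
have thm1 : th m <= 1.
  have : 4 / (s m)%:R <= 4 / (2 ^ s0)%:R :> R.
    by rewrite ler_pM2l// lef_pV2 ?posrE ?ltr0n ?expn_gt0// ler_nat.
  by rewrite /th; lra.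
have thC : th m.+1 * C%:R <= th m * (C - S.+1)%:R.
  rewrite natrB; last by rewrite ltnW.
  (* As s doubles, the density drops by 2 / s, which pays for the loss of S + 1 <= 2 S out of C = s
     S. *)
  have e : th m.+1 = th m - 2 / (s m)%:R.
    by rewrite /th sS natrM; field; rewrite gt_eqF.
  have Ss : 2 / (s m)%:R * C%:R = 2 * S%:R :> R.
    by rewrite CS natrM; field; rewrite gt_eqF.
  have Sr : S.+1%:R <= 2 * S%:R :> R by rewrite -natrM ler_nat mul2n -addnn -addn1 leq_add2l.
  rewrite e mulrBl Ss mulrBr lerD2l lerN2; apply: le_trans Sr.
  by rewrite ler_piMl.
have := @block_bound_step R beta lambda Q M (lt_trans ltr01 beta1) l0 (h m) C S (th m) (th m.+1) (p m)
  (h_gt0 m) (lt_le_trans th01 thm0) S0 SC (ltW (p_gt0 m)) thC IH.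
apply: block_bound_le => //.
set x : R := (s m)%:R; have x0 : 0 < x by exact: sr0.
have x_ge : (4 + 2 * Q.+1%:R * expR (3 * b)) * (2 ^ B)%:R <= x.
  by apply: le_trans s02 _; rewrite ler_nat.
have E0 : 0 < expR (3 * b) by exact: expR_gt0.
have q1 : 1 <= Q.+1%:R :> R by rewrite ler1n.
have twoB : 1 <= (2 ^ B)%:R :> R by rewrite ler1n expn_gt0.
have x_exp : expR (3 * b) <= x.
  apply: le_trans x_ge; apply: (@le_trans _ _ (4 + 2 * Q.+1%:R * expR (3 * b))).
    have : expR (3 * b) <= Q.+1%:R * expR (3 * b) by rewrite ler_peMl// ltW.
    lra.
  by rewrite ler_peMr// addr_ge0// !mulr_ge0// ltW.
have al'0 : (1 <= al')%N.
  by case: (al') al1 => // al1'; exfalso; move: al1'; rewrite mulr0; lra.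
have y3 : 3 <= ln x.
  rewrite -[leLHS]expRK ler_ln ?posrE ?expR_gt0//; apply: le_trans x_exp.
  by rewrite ler_expR; lra.
have lnS : ln S%:R = al'%:R * ln x by rewrite /S natrX lnXn// mulr_natl.
have lnS3 : 0 <= ln S%:R - 3 :> R.
  rewrite lnS subr_ge0; apply: (le_trans y3); rewrite ler_peMl ?ler1n//.
  by apply: (le_trans _ y3).
have C2 : C.*2%:R = 2 * x ^+ al :> R by rewrite -mul2n natrM /C natrX.
have h1 : C.*2%:R ^+ 2 * p m ^+ 2 = 4 / x * p m.
  have xB : x ^+ B = x * (x ^+ al * x ^+ al) by rewrite -exprD -exprS addnn -mul2n.
  rewrite C2 /p -/x xB; field.
  by rewrite expf_neq0 !gt_eqF.
have h2 : C.*2%:R * (Q.+1%:R * expR (- (beta * th m ^+ 2 * (ln S%:R - 3)))) <=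
    2 * Q.+1%:R * expR (3 * b) / x.
  apply: (@le_trans _ _ (C.*2%:R * (Q.+1%:R * expR (- (b * (ln S%:R - 3)))))).
    have thb : b <= beta * th m ^+ 2.
      apply: ler_wpM2l; first exact: ltW (lt_trans ltr01 beta1).
      by rewrite lerXn2r ?nnegrE//; lra.
    by rewrite !ler_wpM2l// ler_expR lerN2 ler_wpM2r.
  have -> : C.*2%:R = 2 * expR (al%:R * ln x).
    by rewrite C2; congr (2 * _); rewrite mulrC expRM_natr lnK.
  rewrite -[leLHS]mulrA [expR _ * (_ * _)]mulrCA -expRD -[leRHS]mulrA -[leRHS]mulrA.
  rewrite !ler_wpM2l//; have -> : x^-1 = expR (- ln x) by rewrite expRN lnK.
  rewrite -expRD ler_expR lnS /al -natr1.
  have : 2 * ln x <= (b - 1) * al'%:R * ln x by rewrite ler_wpM2r//; apply: (le_trans _ y3).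
  lra.
have -> : p m.+1 = (2 ^ B)%:R^-1 * p m.
  by rewrite /p sS natrM exprMn invfM natrX.
rewrite h1; apply: (@le_trans _ _ ((4 + 2 * Q.+1%:R * expR (3 * b)) / x * p m)).
  rewrite [X in _ <= X * _]mulrDl [leRHS]mulrDl.
  by rewrite lerD2l ler_wpM2r// ltW.
apply: ler_wpM2r; first exact: ltW.
by rewrite ler_pdivrMr// [leRHS]mulrC ler_pdivlMr// ltr0n expn_gt0.
Qed.

End Iteration.

(** * From large clusters to the magnetization *)

Section Magnetized.
Variables (R : realType) (beta lambda : R) (Q M : nat).
Hypotheses (beta0 : 0 < beta) (lambda0 : 0 < lambda) (Q0 : (0 < Q)%N).
Local Notation V := (option 'I_M).
Local Notation kfree := (@kfree R beta lambda M).
Local Notation mass := (@fk_mass R beta lambda Q M).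
Local Notation pair x y := [set (Some x, Some y)]%SET.

Let near_width N L x : (minn N (x + L.+1) - (x - L.+1) <= 2 * L.+1)%N. Proof. lia. Qed.

Let left_width N L : (minn N L.+1 - 0 <= L.+1)%N. Proof. lia. Qed.

Let right_width N L : (minn N N - (N - L.+1) <= L.+1)%N. Proof. lia. Qed.

Let Qr0 : 0 < Q%:R :> R. Proof. by rewrite ltr0n. Qed.

(** Given the random-cluster configuration, connected sites agree surely and any two sites agree
    with probability at least 1 / q. Averaging gives P[agree] >= 1 / q + (1 - 1 / q)
    P[connected]. *)
Lemma fk_mass_connect_le (x y : 'I_M) a b :
  Q%:R * mass (fun om => connect (adj a b om) x y) <=
    (Q.+1%:R * @prob R Q _ kfree (pair x y) - 1) * mass xpredT.
Proof.
have ZE : mass xpredT = pf Q kfree by rewrite pf_fkZ.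
have k0 : forall e, 0 <= kfree e by exact: kfree_ge0.
rewrite ZE mulrBl mul1r probE1 -mulrA divfK ?gt_eqF ?pf_gt0// pf_fkZ.
under eq_bigl do rewrite -compat1.
rewrite sum_compat_wt /fk_mass !mulr_sumr /fkZ -sumrB big_mkcond /=.
apply: ler_sum => om _; rewrite /fkw mulrCA [Q.+1%:R * _]mulrCA -mulrBr.
have u0 : 0 <= \prod_(e in om) (expR (kfree e) - 1).
  by apply: prodr_ge0 => e _; rewrite subr_ge0 -expR0 ler_expR.
case: ifP => [xy|_]; last first.
  apply: mulr_ge0 => //; rewrite subr_ge0 -natrM ler_nat.
  by apply: (@leq_ncompat_merge Q 'I_M om (pair x y) (Some x) (Some y)) => s _ e; rewrite compat1 /agree e.
apply: ler_wpM2l => //; rewrite (_ : ncompat _ (om :|: _)%SET = ncompat (@agree Q 'I_M) om).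
  by rewrite -natr1 mulrDl mul1r addrK.
apply: eq_card => s; rewrite !inE compatU compat1.
by case: (boolP (compat _ _ _)) => // cs; rewrite /agree /= (connect_agree cs xy) eqxx.
Qed.

(** The free measure is below the wired one by [prob_mono]; wiring the complement of a window around
    x then turns y into the boundary. *)
Lemma prob_free_le_center L (x y : 'I_M) : (L < x)%N -> (x + L < M)%N ->
  ~~ (x - L.+1 <= y < x + L.+1)%N ->
  @prob R Q _ kfree (pair x y) <= center_prob beta lambda Q L.
Proof.
move=> Lx xM yx; apply: (@le_trans _ _ (@prob R Q _ (kint beta lambda M) (pair x y))).
  apply: prob_mono => [e|]; first exact: kfree_ge0.
  by move=> [[i|] [j|]] //= _; rewrite ?addr0 ?add0r // addr_ge0 ?tail_ge0.
have h : (x - L.+1 + L.+1.*2 <= M)%N by lia.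
apply: le_trans (@prob_kint_shrink R beta lambda Q beta0 lambda0 _ _ _ h _) _.
have inj := @shift_ord_inj _ _ _ h.
rewrite imset_pair.
rewrite (_ : Some x = Some (shift_ord h (center L))); last first.
  by congr Some; apply: val_inj => /=; lia.
rewrite retractK// (_ : retract _ (Some y) = None)//.
apply/eqP; rewrite retract_None; apply: contra yx => /codomP[z ->] /=.
by have := ltn_ord z; lia.
Qed.

(** The mean number of connected pairs is estimated in two ways. A cluster of 3 M / 4 sites with
    probability 1/2 makes it at least 9/32 M^2. A pair is connected with probability at most mL,
    except for at most 4 (L + 1) M pairs near the ends or the diagonal. As M >= 64 (L + 1), this
    gives mL >= 9/32 - 2/32. *)
Lemma finite_magnetization_ge L : (forall N, block_bound beta lambda Q N M./2 (3 / 4) (1 / 2)) ->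
  (64 * L.+1 <= M)%N -> ~~ odd M ->
  1 / 8 <= finite_magnetization Q.+1 beta lambda L.+1.
Proof.
move=> bb LM Modd; set mL := finite_magnetization _ _ _ _.
have k0 : forall e, 0 <= kfree e by exact: kfree_ge0.
have MM : M./2.*2 = M by rewrite even_halfK.
have M0 : (0 < M)%N by apply: leq_trans LM; rewrite muln_gt0.
have Mr : 0 < M%:R :> R by rewrite ltr0n.
have mE : mL = (Q.+1%:R * center_prob beta lambda Q L - 1) / Q%:R.
  exact: finite_magnetization_center.
have mL0 : 0 <= mL.
  rewrite mE; apply: divr_ge0; last exact: ltW.
  by rewrite subr_ge0; apply: prob1_ge => e; exact: kint_ge0.
have Z0 : 0 < mass xpredT.
  have -> : mass xpredT = pf Q kfree by rewrite pf_fkZ.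
  exact: pf_gt0.
have two_point x y : mass (fun om => connect (adj 0 M om) x y) <= (mL +
    ((0 <= x < L.+1)%N%:R + (M - L.+1 <= x < M)%N%:R +
     (x - L.+1 <= y < x + L.+1)%N%:R)) * mass xpredT.
  rewrite -(ler_pM2l Qr0); apply: le_trans (fk_mass_connect_le _ _ _ _) _.
  rewrite [leRHS]mulrA; apply: ler_wpM2r; first exact: ltW.
  have p1 : @prob R Q _ kfree (pair x y) <= 1 by exact: prob_le1.
  have ex (d : R) : 1 <= d -> Q.+1%:R * @prob R Q _ kfree (pair x y) - 1 <= Q%:R * (mL + d).
    move=> d1; apply: (@le_trans _ _ (Q%:R * 1)); last first.
      by rewrite ler_pM2l//; lra.
    rewrite mulr1 lerBlDr natr1; apply: (@le_trans _ _ (Q.+1%:R * 1)); last by rewrite mulr1.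
    by rewrite ler_pM2l// ltr0n.
  have [xL|Lx] := leqP x L.
    by apply: ex; rewrite ltnS xL -addrA lerDl addr_ge0.
  have [xM|xM] := ltnP (x + L) M; last first.
    have -> : (M - L.+1 <= x < M)%N.
      by rewrite ltn_ord andbT leq_subLR addSn addnC ltnW.
    by apply: ex; rewrite addrAC lerDr addr_ge0.
  case: (boolP (x - L.+1 <= y < x + L.+1)%N) => yx.
    by apply: ex; rewrite lerDr addr_ge0.
  apply: (@le_trans _ _ (Q%:R * mL)); last by rewrite ler_pM2l// lerDl !addr_ge0.
  rewrite mE [leRHS]mulrC divfK ?gt_eqF// lerD2r ler_pM2l ?ltr0n//.
  exact: prob_free_le_center.
have upper : \sum_(x : 'I_M) \sum_(y : 'I_M) mass (fun om => connect (adj 0 M om) x y) <=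
    (M%:R ^+ 2 * mL + M%:R * (4 * L.+1%:R)) * mass xpredT.
  apply: (@le_trans _ _ (\sum_(x : 'I_M) \sum_(y : 'I_M) (mL +
    ((0 <= x < L.+1)%N%:R + (M - L.+1 <= x < M)%N%:R +
     (x - L.+1 <= y < x + L.+1)%N%:R)) * mass xpredT)).
    by apply: ler_sum => x _; apply: ler_sum => y _.
  under eq_bigr do rewrite -mulr_suml; rewrite -mulr_suml ler_pM2r//.
  have near_le (x : 'I_M) : \sum_(y : 'I_M) (x - L.+1 <= y < x + L.+1)%N%:R <= 2 * L.+1%:R :> R.
    rewrite -natr_sum -natrM ler_nat; exact: leq_trans (sum_nat_interval_le _ _ _) (near_width _ _ _).
  have left_le : \sum_(x : 'I_M) (0 <= x < L.+1)%N%:R <= L.+1%:R :> R.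
    rewrite -natr_sum ler_nat; exact: leq_trans (sum_nat_interval_le _ _ _) (left_width _ _).
  have right_le : \sum_(x : 'I_M) (M - L.+1 <= x < M)%N%:R <= L.+1%:R :> R.
    rewrite -natr_sum ler_nat; exact: leq_trans (sum_nat_interval_le _ _ _) (right_width _ _).
  have row (x : 'I_M) : \sum_(y : 'I_M) (mL + ((0 <= x < L.+1)%N%:R + (M - L.+1 <= x < M)%N%:R +
      (x - L.+1 <= y < x + L.+1)%N%:R)) <= M%:R * mL + 2 * L.+1%:R +
      M%:R * ((0 <= x < L.+1)%N%:R + (M - L.+1 <= x < M)%N%:R).
    rewrite big_split /= sumr_const card_ord -[mL *+ M]mulr_natl -addrA lerD2l addrC.
    by rewrite big_split /= sumr_const card_ord -[_ *+ M]mulr_natl lerD2l.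
  apply: le_trans (ler_sum _ (fun x _ => row x)) _.
  rewrite big_split /= sumr_const card_ord -[_ *+ M]mulr_natl -mulr_sumr big_split /=.
  have := ler_wpM2l (ltW Mr) (lerD left_le right_le); lra.
have lower : 9 / 32 * M%:R ^+ 2 * mass xpredT <=
    \sum_(x : 'I_M) \sum_(y : 'I_M) mass (fun om => connect (adj 0 M om) x y).
  have Zg : 1 / 2 * mass xpredT <= mass (fun om => good 0 M om (3 / 4 * M%:R : R)).
    have h := bb M 0 xpredT; rewrite add0n MM leqnn in h.
    have := h isT (fun=> erefl); rewrite /fk_mass.
    rewrite [X in _ <= 1 / 2 * X -> _](bigID (fun om => good 0 M om (3 / 4 * M%:R : R))) /=.
    rewrite [X in _ -> 1 / 2 * X <= _](bigID (fun om => good 0 M om (3 / 4 * M%:R : R))) /=.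
    lra.
  apply: (@le_trans _ _ ((3 / 4 * M%:R) ^+ 2 * mass (fun om => good 0 M om (3 / 4 * M%:R : R)))).
    have := ler_wpM2l (sqr_ge0 (3 / 4 * M%:R)) Zg; lra.
  under eq_bigr do under eq_bigr do rewrite /fk_mass big_mkcond.
  under eq_bigr do rewrite exchange_big; rewrite exchange_big /fk_mass big_mkcond mulr_sumr.
  apply: ler_sum => om _ /=.
  have w0 : 0 <= fkw Q kfree om by exact: fkw_ge0.
  have -> : \sum_(x : 'I_M) \sum_(y : 'I_M) (if connect (adj 0 M om) x y then fkw Q kfree om else 0) =
      (\sum_(x : 'I_M) \sum_(y : 'I_M) (connect (adj 0 M om) x y)%:R) * fkw Q kfree om.
    rewrite mulr_suml; apply: eq_bigr => x _; rewrite mulr_suml; apply: eq_bigr => y _.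
    by case: ifP; rewrite ?mul1r ?mul0r.
  case: ifP => [/existsP[x0 /andP[_ x0C]]|_]; last first.
    by rewrite mulr0; apply: mulr_ge0 => //; apply: sumr_ge0 => x _; exact: sumr_ge0.
  apply: ler_wpM2r => //; set C := clus _ _ _ _ in x0C.
  apply: (@le_trans _ _ ((#|C|)%:R ^+ 2)).
    by rewrite lerXn2r ?nnegrE//; rewrite mulr_ge0//; lra.
  rewrite -natrX -mulnn -[X in (X * _)%N]sum1_card big_distrl natr_sum /= big_mkcond.
  apply: ler_sum => x _; case: ifPn => [xC|_]; last exact: sumr_ge0.
  rewrite mul1n -sum1_card natr_sum big_mkcond; apply: ler_sum => y _.
  case: ifPn => // yC; rewrite (_ : connect _ x y)//.
  move: xC yC; rewrite !inE => /andP[_ cx] /andP[_]; apply: connect_trans.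
  by rewrite (sym_connect_sym (@adj_sym _ _ _ _)).
have := le_trans lower upper; rewrite ler_pM2r// => H.
have : M%:R * (9 / 32 * M%:R) <= M%:R * (M%:R * mL + 4 * L.+1%:R) by lra.
rewrite ler_pM2l// => {}H.
have LMr : 64 * L.+1%:R <= M%:R :> R by rewrite -natrM ler_nat.
have : 7 / 32 * M%:R <= M%:R * mL by lra.
by rewrite [leRHS]mulrC ler_pM2r//; lra.
Qed.

End Magnetized.

Lemma magnetization_gt0 (R : realType) (beta : R) (Q : nat) : (0 < Q)%N -> 1 < beta ->
  exists lambda, 0 < lambda /\ 0 < magnetization Q.+1 beta lambda.
Proof.
move=> Q0 beta1; have [lambda [h [l0 H]]] := @long_range_blocks R beta Q beta1.
exists lambda; split=> //.
apply: (@lt_le_trans _ _ (1 / 8)) => //.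
apply: (@magnetization_ge R beta lambda Q (lt_trans ltr01 beta1) l0 Q0) => L.
(* [lambda] serves all scales, so a scale with h > 32 (L + 1) can be taken for each [L], and the
   bound 1/8 survives in the limit. *)
have [hL bb] := H (32 * L.+1)%N.
apply: (@finite_magnetization_ge R beta lambda Q (h (32 * L.+1)%N).*2 (lt_trans ltr01 beta1) l0 Q0).
- by rewrite doubleK.
- lia.
- by rewrite odd_double.
Qed.

Theorem corollary5 (R : realType) (q : nat) (hq : (2 <= q)%N) :
  (forall beta : R, 1 < beta ->
     exists lambda : R, 0 < lambda /\ 0 < magnetization q beta lambda) /\
  (forall beta lambda : R, 0 < beta -> 0 < lambda ->
     0 < magnetization q beta lambda ->
     1 <= beta * magnetization q beta lambda ^+ 2).
Proof.
case: q hq => // Q Q0; split => [beta|beta lambda]; first exact: magnetization_gt0.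
by move=> beta0 lambda0; exact: magnetization_gap.
Qed.
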